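(* Let $\mu>0$ and consider the one-mode interaction potential $W(\theta)=-\cos(\theta-\alpha)$ and the equation $$\partial_\theta\rho+(\mu\,W'\star\rho+k)\,\rho=c,\qquad k,c\in\mathbb{R}\ \text{constants to be determined},$$ for traveling-wave steady states with profile a positive $2\pi$-periodic probability density $\rho$ on the circle. (a) Let $\alpha\in(-\pi/2,\pi/2)$. The equation undergoes a continuous global phase transition at $\mu_\alpha=2\sec\alpha$. More precisely: whenever $\mu\le\mu_\alpha$, the incoherent state $\rho_\infty\equiv\frac1{2\pi}$ is the unique solution. For $\mu>\mu_\alpha$ there exists an additional coherent traveling-wave solution $$\rho(t,\theta)=\rho_{EMvM}(\theta-kt;\theta_0,k,r),$$ which is unique up to the arbitrary choice of $\theta_0\in[0,2\pi)$, and where $k\in\mathbb{R}$ and $r>0$ are solutions of $$\mu\,\frac{I_{1-ik}(r)}{I_{-ik}(r)}=e^{i\alpha}r .$$ (b) For $\alpha=0$, the equation undergoes a phase transition at $\mu=2$ to a coherent equilibrium steady state $\rho(\theta)=\rho_{vM}(\theta;\theta_0,r)$, which is unique up to the arbitrary choice of $\theta_0\in[0,2\pi)$. (c) For $\alpha=\pm\pi/2$, the incoherent state is the unique solution regardless of $\mu$.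
   Context: The underlying McKean–Vlasov equation (with diffusion constant $D=1$) is $\partial_t\rho=\partial_\theta^2\rho+\mu\,\partial_\theta(\rho\,\partial_\theta(W\star\rho))$ on the circle $\mathbb{S}^1\cong[0,2\pi)$, where $(W\star\rho)(\theta)=\int_0^{2\pi}W(\theta-\tilde\theta)\rho(\tilde\theta)\,d\tilde\theta$; the ansatz $\rho(t,\theta)=\rho(\theta-kt)$ yields the stated equation, $k$ being the wave speed. Solutions are required to satisfy $\rho>0$, $\rho(0)=\rho(2\pi)$ (periodicity) and $\int_0^{2\pi}\rho\,d\theta=1$. Uniqueness refers to the density $\rho$ (the uniform density solves the equation for every $k$ with $c=k/(2\pi)$). $I_\nu(r)=\sum_{p\ge0}\frac{1}{p!\,\Gamma(\nu+p+1)}(r/2)^{\nu+2p}$ is the modified Bessel function of the first kind of complex order $\nu$. Von Mises density: $\rho_{vM}(\theta;\theta_0,r)=\dfrac{e^{r\cos(\theta-\theta_0)}}{2\pi I_0(r)}$, $r>0$. Exponentially modified von Mises density: for $k\in\mathbb{R}\setminus\{0\}$ and $r\in\mathbb{R}$ let $\chi_{k,r}$ be the unique $2\pi$-periodic solution of $\frac{d\chi}{d\phi}+(r\sin\phi+k)\chi=k$, and let $\chi_{0,r}(\phi)=I_0(r)e^{r\cos\phi}$. With $Z_{k,r}=\int_0^{2\pi}\chi_{k,r}(\phi)\,d\phi$, set $\rho_{EMvM}(\theta;\theta_0,k,r)=\chi_{k,r}(\theta-\theta_0)/Z_{k,r}$. In particular $\rho_{EMvM}(\cdot;\theta_0,0,r)=\rho_{vM}(\cdot;\theta_0,r)$.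 *)

(* Defs.v *)
From Stdlib Require Import Reals Factorial ClassicalEpsilon.
From Coquelicot Require Import Coquelicot.
Open Scope R_scope.

(* Limits and series in C are taken componentwise; like [Lim_seq] and [Series]
   they are total, with unspecified values in the divergent case. *)
Definition CLim_seq (u : nat -> C) : C :=
  (real (Lim_seq (fun n => Re (u n))), real (Lim_seq (fun n => Im (u n)))).

Definition CSeries (a : nat -> C) : C :=
  (Series (fun n => Re (a n)), Series (fun n => Im (a n))).

Definition Cexp (z : C) : C :=
  (exp (Re z) * cos (Im z), exp (Re z) * sin (Im z)).

(* Principal value of x^z for a real base x, with 0^0 = 1. *)
Definition RCpower (x : R) (z : C) : C :=
  if Req_EM_T x 0 then (if Ceq_dec z (RtoC 0) then RtoC 1 else RtoC 0)
  else Cexp (z * (ln (Rabs x), if Rlt_dec x 0 then PI else 0))%C.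

(* z (z+1) ... (z+n-1) *)
Fixpoint Crising (z : C) (n : nat) : C :=
  match n with
  | O => RtoC 1
  | S m => (Crising z m * (z + RtoC (INR m)))%C
  end.

(* Euler's limit n! n^z / (z (z+1) ... (z+n)), valid on the whole domain of
   Gamma.  Since / 0 = 0, it takes the value 0 at the poles 0, -1, -2, ..., so
   that / CGamma z is the entire function 1/Gamma everywhere. *)
Definition CGamma (z : C) : C :=
  CLim_seq (fun n =>
    (RtoC (INR (fact n)) * RCpower (INR n) z / Crising z (S n))%C).

Definition besselI (nu : C) (r : R) : C :=
  CSeries (fun p =>
    (/ (RtoC (INR (fact p)) * CGamma (nu + RtoC (INR p) + RtoC 1))
     * RCpower (r / 2) (nu + RtoC (2 * INR p)))%C).

Definition besselI0 (r : R) : R := Re (besselI (RtoC 0) r).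

(* Functions and densities on the circle are 2 PI-periodic functions on R. *)
Definition periodic (f : R -> R) : Prop := forall x, f (x + 2 * PI) = f x.

Definition circle_conv (f g : R -> R) (theta : R) : R :=
  RInt (fun s => f (theta - s) * g s) 0 (2 * PI).

Definition rho_inf (theta : R) : R := 1 / (2 * PI).

Definition rho_vM (theta0 r theta : R) : R :=
  exp (r * cos (theta - theta0)) / (2 * PI * besselI0 r).

Definition is_chi (k r : R) (chi : R -> R) : Prop :=
  periodic chi /\
  forall phi, ex_derive chi phi /\
              Derive chi phi + (r * sin phi + k) * chi phi = k.

(* For k <> 0 there is exactly one function satisfying [is_chi k r]; [epsilon]
   picks it out. *)
Definition chi (k r : R) : R -> R :=
  if Req_EM_T k 0 then fun phi => besselI0 r * exp (r * cos phi)
  else epsilon (inhabits (fun _ : R => 0)) (is_chi k r).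

Definition Z_EMvM (k r : R) : R := RInt (chi k r) 0 (2 * PI).

Definition rho_EMvM (theta0 k r theta : R) : R :=
  chi k r (theta - theta0) / Z_EMvM k r.

Definition W (alpha theta : R) : R := - cos (theta - alpha).

Definition prob_density (rho : R -> R) : Prop :=
  (forall theta, 0 < rho theta) /\ periodic rho /\
  RInt rho 0 (2 * PI) = 1.

Definition profile_solution (mu alpha : R) (rho : R -> R) (k c : R) : Prop :=
  prob_density rho /\
  forall theta,
    ex_derive rho theta /\
    Derive rho theta
      + (mu * circle_conv (Derive (W alpha)) rho theta + k) * rho theta = c.

(* Classical solutions u t theta of the McKean-Vlasov equation
   u_t = u_xx + mu (u (W * u)_x)_x. *)
Definition McKean_Vlasov (mu alpha : R) (u : R -> R -> R) : Prop :=
  forall t theta,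
    let drift := fun x => u t x * Derive (circle_conv (W alpha) (u t)) x in
    ex_derive (fun s => u s theta) t /\
    ex_derive (u t) theta /\ ex_derive_n (u t) 2 theta /\
    ex_derive (circle_conv (W alpha) (u t)) theta /\
    ex_derive drift theta /\
    Derive (fun s => u s theta) t
      = Derive_n (u t) 2 theta + mu * Derive drift theta.

Definition coherent (rho : R -> R) : Prop :=
  exists theta, rho theta <> rho_inf theta.

Definition incoherent_is_solution (mu alpha : R) : Prop :=
  exists k c, profile_solution mu alpha rho_inf k c.

Definition incoherent_unique (mu alpha : R) : Prop :=
  incoherent_is_solution mu alpha /\
  forall rho k c, profile_solution mu alpha rho k c ->
    forall theta, rho theta = rho_inf theta.

Definition bessel_equation (mu alpha k r : R) : Prop :=
  (RtoC mu * (besselI (RtoC 1 - Ci * RtoC k) r / besselI (- (Ci * RtoC k)) r)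
   = Cexp (Ci * RtoC alpha) * RtoC r)%C.

Definition mu_crit (alpha : R) : R := 2 / cos alpha.

(* The transition at mu0 is continuous: solutions for mu slightly above mu0
   converge to the uniform density in L^1 as mu decreases to mu0. *)
Definition L1_continuous_at_transition (mu0 alpha : R) : Prop :=
  forall eps, 0 < eps -> exists delta, 0 < delta /\
    forall mu, mu0 < mu < mu0 + delta ->
    forall rho k c, profile_solution mu alpha rho k c ->
      RInt (fun theta => Rabs (rho theta - rho_inf theta)) 0 (2 * PI) < eps.

(* Main.v *)
Require Import Defs.
From Stdlib Require Import Reals Lra Lia Psatz Factorial Classical ClassicalEpsilon FunctionalExtensionality.
From Coquelicot Require Import Coquelicot.
Open Scope R_scope.

(** Since [W] has one Fourier mode, [mu * (W' * rho)] is [r * sin (theta - theta0)] with [r = mu * R],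
    where [R] is the modulus of the first Fourier coefficient of [rho].  In the rotated variable the
    equation is the linear equation [f' + (r sin x + k) f = c] ([circle_ode], [profile_rotate]), whose
    normalised positive solution is unique for given [k] and [r]: it is the modified von Mises density
    ([circle_density_unique]).  What remains is a consistency condition for [(k, r)].

    The Fourier coefficients [a_n] of [f] satisfy [(n + i k) a_n + (r/2) (a_(n+1) - a_(n-1)) = 0] for
    [n >= 1].  So does [(r/2)^n B_n (r^2/4)] with [B_n (s) = sum_p s^p / (p! (1 + i k)_(n+p))], which is
    [I_(n+ik) (r)] up to a constant factor and tends to 0.  The Casoratian of a bounded and a vanishing
    solution is 0 ([minimal_solution]), hence [a_1 B_0 = (r/2) B_1 a_0].  With [w = B_0 / B_1] the
    consistency condition becomes [w = (mu/2) e^(i alpha)] ([self_consistency]), and this is the Bessel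
    equation ([bessel_equation_iff]); the latter requires that Euler's limit for Gamma converges and
    does not vanish at the points [n + 1 + i k] ([CGamma_rising]).

    The condition on [w] is handled by real analysis.  Put [K = k^2] and [s = r^2/4].  The product
    formula for Bessel functions gives [(1 + K) |B_1|^2 = sum_n (n + 1) w_n s^n] with the positive
    weights [w_n = C_(n+1) / ((2^2 + K) ... ((n+1)^2 + K))], [C_n] the Catalan numbers.  Let [M_j] be
    the sum of [(n + 1)^j w_n s^n], and let [mean1 = M_1 / M_0] and [mean2 = M_2 / M_1].  Then
      [Re w = (mean2 + 1) / 2]  and  [Im w = (k / 2) (1 + 1 / mean1)].
    This is established by comparing differential equations ([bes_re_im_quotient]): both means satisfy
    Riccati equations in [s], thanks to a quadratic first integral ([mom_riccati]).

    - Threshold: [mean2 = 1] at [s = 0] and [mean2] increases strictly, so a coherent state forces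
      [mu cos alpha = 2 Re w > 2].
    - Uniqueness ([means_injective]): along a ray [s = q K] both means increase with [K], by a
      likelihood ratio argument; and [k (1 + 1 / mean1)] still increases strictly with [k], because
      the Riccati equations give [mean1 (K2) <= mean1 (K1) ^ (K2 / K1)] on the ray ([ray_mean1_upper]).
      Two solutions with [0 < k1 < k2] contradict the first fact if their [q = s / K] satisfy
      [q1 < q2], and the second one otherwise.
    - Existence ([means_surjective]): for each [k] there is exactly one [s] with the required real part,
      [mean1] depends continuously on [k] along this level set, and the imaginary part takes all values.

    Finally, every solution satisfies [|rho - 1 / (2 PI)| <= 2 r] ([sup_bound]).  For [r = 0] this gives
    the uniform density; it also gives the continuity of the transition, because [mean2 = mu cos alpha - 1]
    tends to 1 at the threshold, which forces [r] to 0 uniformly over the bounded range of speeds. *)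

(** * Catalan-type weights and their moments *)

(** [wgt K n] is [C_(n+1) / ((2^2 + K) ... ((n+1)^2 + K))] with [C_n] the Catalan numbers: the recursion
    multiplies by [C_(n+1) / C_n = 2 (2 n + 1) / (n + 2)]. *)
Fixpoint wgt (K : R) (n : nat) : R :=
  match n with
  | O => 1
  | S m => wgt K m * (2 * (2 * INR n + 1) / ((INR n + 2) * ((INR n + 1) ^ 2 + K)))
  end.

Definition wgt_coef (K : R) (j n : nat) : R := (INR n + 1) ^ j * wgt K n.

Definition mom (K : R) (j : nat) (s : R) : R := PSeries (wgt_coef K j) s.

Lemma is_lim_seq_inv_succ : is_lim_seq (fun n => / (INR n + 1)) 0.
Proof.
  apply is_lim_seq_ext with (fun n => / INR (S n)).
  { intros n; now rewrite S_INR. }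
  apply (is_lim_seq_incr_1 (fun n => / INR n)).
  replace (Finite 0) with (Rbar_inv p_infty) by reflexivity.
  apply is_lim_seq_inv; [apply is_lim_seq_INR|easy].
Qed.

Lemma wgt_pos K n : 0 <= K -> 0 < wgt K n.
Proof.
  intros HK; induction n as [|n IH]; [simpl; lra|].
  change (wgt K (S n)) with
    (wgt K n * (2 * (2 * INR (S n) + 1) / ((INR (S n) + 2) * ((INR (S n) + 1) ^ 2 + K)))).
  pose proof (pos_INR (S n)).
  apply Rmult_lt_0_compat; [exact IH|].
  apply Rdiv_lt_0_compat; [lra|apply Rmult_lt_0_compat; nra].
Qed.

Lemma wgt_coef_pos K j n : 0 <= K -> 0 < wgt_coef K j n.
Proof.
  intros HK; apply Rmult_lt_0_compat; [|now apply wgt_pos].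
  apply pow_lt; pose proof (pos_INR n); lra.
Qed.

(** Consecutive coefficients have ratio [O (1 / n)]. *)
Lemma wgt_coef_radius K j : 0 <= K -> CV_radius (wgt_coef K j) = p_infty.
Proof.
  intros HK. apply CV_radius_infinite_DAlembert.
  - intros n. pose proof (wgt_coef_pos K j n HK); lra.
  - apply is_lim_seq_le_le with (u := fun _ => 0) (w := fun n => (2 ^ j * 4) * / (INR n + 1)).
    + intros n; split; [apply Rabs_pos|].
      pose proof (wgt_coef_pos K j n HK) as H1; pose proof (wgt_coef_pos K j (S n) HK) as H2.
      rewrite Rabs_pos_eq by (apply Rlt_le, Rdiv_lt_0_compat; assumption).
      pose proof (pos_INR n) as Hn.
      apply (Rmult_le_reg_r (wgt_coef K j n)); [exact H1|].
      replace (wgt_coef K j (S n) / wgt_coef K j n * wgt_coef K j n) with (wgt_coef K j (S n)) by (field; lra).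
      unfold wgt_coef.
      change (wgt K (S n)) with
        (wgt K n * (2 * (2 * INR (S n) + 1) / ((INR (S n) + 2) * ((INR (S n) + 1) ^ 2 + K)))).
      rewrite S_INR.
      assert (Hp : (INR n + 1 + 1) ^ j <= 2 ^ j * (INR n + 1) ^ j).
      { rewrite <- Rpow_mult_distr. apply pow_incr; lra. }
      assert (Hc := wgt_pos K n HK).
      assert (Hq : 2 * (2 * (INR n + 1) + 1) / ((INR n + 1 + 2) * ((INR n + 1 + 1) ^ 2 + K))
                   <= 4 * / (INR n + 1)).
      { apply Rmult_le_reg_r with ((INR n + 1 + 2) * ((INR n + 1 + 1) ^ 2 + K) * (INR n + 1)).
        - apply Rmult_lt_0_compat; [apply Rmult_lt_0_compat|]; nra.
        - replace (2 * (2 * (INR n + 1) + 1) / ((INR n + 1 + 2) * ((INR n + 1 + 1) ^ 2 + K))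
                   * ((INR n + 1 + 2) * ((INR n + 1 + 1) ^ 2 + K) * (INR n + 1)))
            with (2 * (2 * (INR n + 1) + 1) * (INR n + 1)) by (field; nra).
          replace (4 * / (INR n + 1) * ((INR n + 1 + 2) * ((INR n + 1 + 1) ^ 2 + K) * (INR n + 1)))
            with (4 * ((INR n + 1 + 2) * ((INR n + 1 + 1) ^ 2 + K))) by (field; nra).
          nra. }
      assert (0 < 2 * (2 * (INR n + 1) + 1) / ((INR n + 1 + 2) * ((INR n + 1 + 1) ^ 2 + K))).
      { apply Rdiv_lt_0_compat; [lra|apply Rmult_lt_0_compat; nra]. }
      assert (0 < (INR n + 1) ^ j) by (apply pow_lt; lra).
      assert (0 < (INR n + 1 + 1) ^ j) by (apply pow_lt; lra).
      apply Rle_trans with ((2 ^ j * (INR n + 1) ^ j) * (wgt K n * (4 * / (INR n + 1)))).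
      * apply Rmult_le_compat; try lra.
        -- apply Rmult_le_pos; lra.
        -- apply Rmult_le_compat_l; lra.
      * right; ring.
    + apply is_lim_seq_const.
    + replace (Finite 0) with (Rbar_mult (2 ^ j * 4) (Finite 0))
        by (simpl; f_equal; ring).
      apply is_lim_seq_scal_l, is_lim_seq_inv_succ.
Qed.

Lemma mom_ex K j s : 0 <= K -> ex_series (fun n => wgt_coef K j n * s ^ n).
Proof.
  intros HK. apply ex_pseries_R, CV_radius_inside. rewrite wgt_coef_radius; easy.
Qed.

Lemma mom_is_series K j s : 0 <= K -> is_series (fun n => wgt_coef K j n * s ^ n) (mom K j s).
Proof. intros HK. now apply Series_correct, mom_ex. Qed.

Lemma mom_0 K j : mom K j 0 = 1.
Proof.
  unfold mom. rewrite PSeries_0. unfold wgt_coef; simpl. rewrite Rplus_0_l, pow1; ring.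
Qed.

Lemma mom_pos K j s : 0 <= K -> 0 <= s -> 0 < mom K j s.
Proof.
  intros HK Hs. apply Rlt_le_trans with 1; [lra|].
  rewrite <- (mom_0 K j). unfold mom, PSeries.
  apply Series_le.
  - intros n. split.
    + apply Rmult_le_pos; [now apply Rlt_le, wgt_coef_pos|apply pow_le; lra].
    + apply Rmult_le_compat_l; [now apply Rlt_le, wgt_coef_pos|apply pow_incr; lra].
  - now apply mom_ex.
Qed.

Lemma mom_ex_derive K j s : 0 <= K -> ex_derive (mom K j) s.
Proof. intros HK. apply ex_derive_PSeries. rewrite wgt_coef_radius; easy. Qed.

(** [s d/ds] multiplies the coefficient of [s^n] by [n], so [1 + s d/ds] raises the order of the moment by one. *)
Lemma mom_derive K j s : 0 <= K -> s * Derive (mom K j) s = mom K (S j) s - mom K j s.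
Proof.
  intros HK. unfold mom at 1. rewrite Derive_PSeries by (rewrite wgt_coef_radius; easy).
  assert (E : mom K (S j) s = PSeries (PS_plus (PS_incr_1 (PS_derive (wgt_coef K j))) (wgt_coef K j)) s).
  { unfold mom. apply PSeries_ext. intros [|n]; unfold PS_plus, PS_incr_1, PS_derive, wgt_coef.
    - rewrite plus_zero_l. simpl; ring.
    - rewrite S_INR. unfold plus; simpl. ring. }
  rewrite E, PSeries_plus, PSeries_incr_1.
  - unfold mom. ring.
  - apply ex_pseries_incr_1, CV_radius_inside. rewrite CV_radius_derive, wgt_coef_radius; easy.
  - apply CV_radius_inside. rewrite wgt_coef_radius; easy.
Qed.

(** * Monotone likelihood ratios *)

(** Chebyshev's argument: if [v n / u n] is nondecreasing, the weights [v] put more mass on large [n], so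
    their mean of [n + 1] is larger.  The difference of cross products is the sum over [i < j] of
    [(j - i) (v j * u i - v i * u j)], all of whose terms are nonnegative; the lower bound keeps the
    term [i = 0, j = 1], which makes strict comparisons possible. *)
Lemma likelihood_ratio_mean (u v : nat -> R) (U0 U1 V0 V1 : R) :
  (forall i j, (i <= j)%nat -> v i * u j <= v j * u i) ->
  is_series u U0 -> is_series (fun n => (INR n + 1) * u n) U1 ->
  is_series v V0 -> is_series (fun n => (INR n + 1) * v n) V1 ->
  v 1%nat * u 0%nat - v 0%nat * u 1%nat <= V1 * U0 - V0 * U1.
Proof.
  intros Hr HU0 HU1 HV0 HV1.
  (* The cross product of the partial sums increases with [n] and equals the lower bound at [n = 1]. *)
  set (T := fun n => sum_n (fun n => (INR n + 1) * v n) n * sum_n u n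
                     - sum_n v n * sum_n (fun n => (INR n + 1) * u n) n).
  assert (Hstep : forall n, T n <= T (S n)).
  { intros n. unfold T. rewrite !sum_Sn. unfold plus; simpl.
    assert (H : forall m, (m <= n)%nat ->
      0 <= v (S n) * ((INR (S n) + 1) * sum_n u m - sum_n (fun n => (INR n + 1) * u n) m)
         - u (S n) * ((INR (S n) + 1) * sum_n v m - sum_n (fun n => (INR n + 1) * v n) m)).
    { induction m as [|m IH]; intros Hm.
      - rewrite !sum_O. pose proof (Hr 0%nat (S n) ltac:(lia)). change (INR 0) with 0.
        assert (0 <= INR (S n)) by apply pos_INR. nra.
      - rewrite !sum_Sn. unfold plus; simpl plus.
        specialize (IH ltac:(lia)). pose proof (Hr (S m) (S n) ltac:(lia)) as H.
        assert (INR (S m) <= INR (S n)) by (apply le_INR; lia).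
        assert (0 <= (INR (S n) - INR (S m)) * (v (S n) * u (S m) - v (S m) * u (S n)))
          by (apply Rmult_le_pos; lra).
        simpl in *. lra. }
    specialize (H n (le_n n)). simpl in *. lra. }
  assert (Hlim : is_lim_seq T (V1 * U0 - V0 * U1)).
  { apply is_lim_seq_minus'; apply is_lim_seq_mult'; assumption. }
  assert (H1 : T 1%nat = v 1%nat * u 0%nat - v 0%nat * u 1%nat).
  { unfold T. rewrite !sum_Sn, !sum_O. unfold plus; simpl. ring. }
  rewrite <- H1.
  apply (is_lim_seq_le_loc (fun _ => T 1%nat) T (T 1%nat) (V1 * U0 - V0 * U1)).
  - exists 1%nat. intros n Hn. induction Hn as [|n Hn IH]; [lra|].
    specialize (Hstep n). lra.
  - apply is_lim_seq_const.
  - exact Hlim.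
Qed.

Lemma wgt_S K n : wgt K (S n) =
  wgt K n * (2 * (2 * (INR n + 1) + 1) / ((INR n + 3) * ((INR n + 2) ^ 2 + K))).
Proof.
  change (wgt K (S n)) with
    (wgt K n * (2 * (2 * INR (S n) + 1) / ((INR (S n) + 2) * ((INR (S n) + 1) ^ 2 + K)))).
  rewrite S_INR. f_equal. f_equal. f_equal; [ring|]. f_equal. ring.
Qed.

(** The ratio of consecutive terms of [wgt K n * s^n] is [s / (m + K)], with [m = (n + 2)^2], times a
    factor that depends on [n] alone.  This is why the comparison of two pairs [(K, s)], [(K', t)] is
    expressed by [s * (m + K') <= t * (m + K)]. *)
Lemma wgt_pow_likelihood K K' s t i j :
  0 <= K -> 0 <= K' -> 0 <= s -> 0 <= t ->
  (forall m, 1 <= m -> s * (m + K') <= t * (m + K)) -> (i <= j)%nat ->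
  wgt K' i * t ^ i * (wgt K j * s ^ j) <= wgt K' j * t ^ j * (wgt K i * s ^ i).
Proof.
  intros HK HK' Hs Ht Hst Hij. induction Hij as [|j Hij IH]; [right; ring|].
  rewrite !wgt_S. pose proof (pos_INR j) as Hj.
  set (A := 2 * (2 * (INR j + 1) + 1) / (INR j + 3)).
  assert (HA : 0 < A) by (apply Rdiv_lt_0_compat; lra).
  set (m := (INR j + 2) ^ 2).
  assert (Hm : 1 <= m) by (unfold m; nra).
  replace (2 * (2 * (INR j + 1) + 1) / ((INR j + 3) * (m + K))) with (A / (m + K))
    by (unfold A; field; lra).
  replace (2 * (2 * (INR j + 1) + 1) / ((INR j + 3) * (m + K'))) with (A / (m + K'))
    by (unfold A; field; lra).
  assert (H : s * (A / (m + K)) <= t * (A / (m + K'))).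
  { apply Rmult_le_reg_r with ((m + K) * (m + K')); [nra|].
    replace (s * (A / (m + K)) * ((m + K) * (m + K'))) with (A * (s * (m + K'))) by (field; lra).
    replace (t * (A / (m + K')) * ((m + K) * (m + K'))) with (A * (t * (m + K))) by (field; lra).
    apply Rmult_le_compat_l; [lra|auto]. }
  assert (H0 : 0 <= s * (A / (m + K)))
    by (apply Rmult_le_pos; [|apply Rlt_le, Rdiv_lt_0_compat]; lra).
  assert (Hp : forall K x n, 0 <= K -> 0 <= x -> 0 <= wgt K n * x ^ n).
  { intros; apply Rmult_le_pos; [now apply Rlt_le, wgt_pos|now apply pow_le]. }
  simpl pow.
  replace (wgt K' i * t ^ i * (wgt K j * (A / (m + K)) * (s * s ^ j)))
    with (wgt K' i * t ^ i * (wgt K j * s ^ j) * (s * (A / (m + K)))) by ring.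
  replace (wgt K' j * (A / (m + K')) * (t * t ^ j) * (wgt K i * s ^ i))
    with (wgt K' j * t ^ j * (wgt K i * s ^ i) * (t * (A / (m + K')))) by ring.
  apply Rmult_le_compat; auto. apply Rmult_le_pos; auto.
Qed.

Lemma mom_ratio_cross K K' s t j :
  0 <= K -> 0 <= K' -> 0 <= s -> 0 <= t ->
  (forall m, 1 <= m -> s * (m + K') <= t * (m + K)) ->
  2 ^ S j * (t / (4 + K') - s / (4 + K))
  <= mom K' (S j) t * mom K j s - mom K' j t * mom K (S j) s.
Proof.
  intros HK HK' Hs Ht Hst.
  eapply Rle_trans.
  2: apply (likelihood_ratio_mean (fun n => wgt_coef K j n * s ^ n) (fun n => wgt_coef K' j n * t ^ n)).
  - unfold wgt_coef; simpl. rewrite !Rplus_0_l, !pow1. right.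
    replace (1 + 1) with 2 by ring. field. lra.
  - intros i l Hil. unfold wgt_coef.
    pose proof (wgt_pow_likelihood K K' s t i l HK HK' Hs Ht Hst Hil) as H.
    assert (0 <= (INR i + 1) ^ j * (INR l + 1) ^ j).
    { pose proof (pos_INR i); pose proof (pos_INR l).
      apply Rmult_le_pos; apply pow_le; lra. }
    apply (Rmult_le_compat_l _ _ _ H0) in H. lra.
  - now apply mom_is_series.
  - apply is_series_ext with (2 := mom_is_series K (S j) s HK).
    intros n; unfold wgt_coef; simpl; ring.
  - now apply mom_is_series.
  - apply is_series_ext with (2 := mom_is_series K' (S j) t HK').
    intros n; unfold wgt_coef; simpl; ring.
Qed.

Lemma PSeries_lin2 a b x y s : CV_radius a = p_infty -> CV_radius b = p_infty ->
  x * PSeries a s + y * PSeries b s = PSeries (fun n => x * a n + y * b n) s.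
Proof.
  intros Ha Hb. rewrite <- !PSeries_scal, <- PSeries_plus.
  - apply PSeries_ext. intros n. unfold PS_plus, PS_scal, plus, scal; simpl. reflexivity.
  - apply ex_pseries_scal; [apply Rmult_comm|].
    apply CV_radius_inside; now rewrite Ha.
  - apply ex_pseries_scal; [apply Rmult_comm|].
    apply CV_radius_inside; now rewrite Hb.
Qed.

(** The coefficient recurrence in closed form; in view of [mom_derive] it is the fourth order equation
    in [s] satisfied by [mom K 0]. *)
Lemma mom_linear K s : 0 <= K ->
  mom K 4 s + (K - 1) * mom K 2 s - 4 * s * mom K 2 s - 2 * s * mom K 1 s = K * mom K 0 s.
Proof.
  intros HK.
  assert (R : forall j, CV_radius (wgt_coef K j) = p_infty) by (intros; now apply wgt_coef_radius).
  assert (I : forall j, ex_pseries (wgt_coef K j) s)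
    by (intros; apply CV_radius_inside; rewrite R; easy).
  assert (E : s * (4 * mom K 2 s + 2 * mom K 1 s)
              = PSeries (PS_incr_1 (fun n => 4 * wgt_coef K 2 n + 2 * wgt_coef K 1 n)) s).
  { unfold mom. rewrite PSeries_lin2 by auto. now rewrite PSeries_incr_1. }
  cut (mom K 4 s + ((K - 1) * mom K 2 s + - K * mom K 0 s) = s * (4 * mom K 2 s + 2 * mom K 1 s)).
  { intros H; lra. }
  rewrite E. unfold mom. rewrite (PSeries_lin2 (wgt_coef K 2)) by auto.
  rewrite <- PSeries_plus.
  - apply PSeries_ext. intros [|n]; unfold PS_plus, PS_incr_1, plus; simpl (Hierarchy.plus _ _).
    + unfold wgt_coef. simpl. unfold zero; simpl. ring.
    + unfold wgt_coef. rewrite wgt_S, S_INR. unfold plus; simpl. field.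
      pose proof (pos_INR n). split; nra.
  - auto.
  - apply (ex_pseries_plus (PS_scal (K - 1) (wgt_coef K 2)) (PS_scal (- K) (wgt_coef K 0)));
      apply ex_pseries_scal; auto; apply Rmult_comm.
Qed.

(** * The two means: Riccati equations and growth along rays *)

(** A function that starts nonnegative and cannot decrease while it is negative stays nonnegative: after
    the last time at which it is nonnegative, the mean value theorem would give a negative derivative.
    This is the comparison principle for all differential inequalities below. *)
Lemma nonneg_barrier (f : R -> R) (x : R) :
  0 <= x -> (forall t, 0 <= t <= x -> ex_derive f t) -> 0 <= f 0 ->
  (forall t, 0 < t <= x -> f t < 0 -> 0 <= Derive f t) -> 0 <= f x.
Proof.
  intros Hx Hd H0 Hb. destruct (Rle_or_lt 0 (f x)) as [|Hneg]; [assumption|exfalso].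
  set (E := fun t => 0 <= t <= x /\ 0 <= f t).
  destruct (completeness E) as [t0 [Hub Hlub]].
  { exists x. intros t [Ht _]; lra. }
  { exists 0; split; lra. }
  assert (Ht0 : 0 <= t0 <= x).
  { split; [apply Hub; split; lra|apply Hlub; intros t [Ht _]; lra]. }
  assert (Hcont : continuous f t0) by (apply (@ex_derive_continuous R_AbsRing R_NormedModule), Hd, Ht0).
  assert (Hf0 : 0 <= f t0).
  { destruct (Rle_or_lt 0 (f t0)) as [|Hn]; [assumption|exfalso].
    assert (Hloc : locally t0 (fun t => f t < 0)).
    { apply (Hcont (fun y => y < 0)). exists (mkposreal (- f t0) ltac:(lra)).
      intros y Hy. unfold ball in Hy; simpl in Hy.
      unfold AbsRing_ball, abs, minus, plus, opp in Hy; simpl in Hy.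
      apply Rabs_def2 in Hy; lra. }
    destruct Hloc as [d Hloc].
    assert (Hu : is_upper_bound E (t0 - d)).
    { intros t [Ht Hft]. destruct (Rle_or_lt t (t0 - d)) as [|Hlt]; [assumption|exfalso].
      assert (t <= t0) by (apply Hub; split; assumption).
      assert (f t < 0); [|lra]. apply Hloc.
      unfold ball; simpl; unfold AbsRing_ball, abs, minus, plus, opp; simpl.
      apply Rabs_def1; pose proof (cond_pos d); lra. }
    specialize (Hlub _ Hu). pose proof (cond_pos d); lra. }
  assert (Hlt : t0 < x) by (destruct (Rle_lt_or_eq_dec t0 x) as [|E0]; [lra|assumption|subst; lra]).
  destruct (MVT_cor2 f (Derive f) t0 x Hlt) as [c [Hc1 Hc2]].
  { intros c Hc. apply is_derive_Reals, Derive_correct, Hd; lra. }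
  assert (Hfc : f c < 0).
  { destruct (Rle_or_lt 0 (f c)) as [Hp|]; [exfalso|assumption].
    assert (c <= t0) by (apply Hub; split; [lra|assumption]). lra. }
  specialize (Hb c ltac:(lra) Hfc).
  assert (0 <= Derive f c * (x - t0)) by (apply Rmult_le_pos; lra). lra.
Qed.

(** A quadratic first integral of the fourth order equation [mom_linear]: the defect [Q] of the identity
    satisfies [s Q' = - 2 Q], so [Q^2] is nonincreasing, and it starts at 0. *)
Lemma mom_riccati K s : 0 <= K -> 0 <= s ->
  2 * mom K 1 s * mom K 3 s - mom K 2 s ^ 2 + (K - 1 - 4 * s) * mom K 1 s ^ 2
  = K * mom K 0 s ^ 2.
Proof.
  intros HK Hs.
  set (Q := fun s => 2 * mom K 1 s * mom K 3 s - mom K 2 s ^ 2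
                     + (K - 1 - 4 * s) * mom K 1 s ^ 2 - K * mom K 0 s ^ 2).
  set (Q' := fun s => 2 * (Derive (mom K 1) s * mom K 3 s + mom K 1 s * Derive (mom K 3) s)
     - 2 * mom K 2 s * Derive (mom K 2) s - 4 * mom K 1 s ^ 2
     + (K - 1 - 4 * s) * (2 * mom K 1 s * Derive (mom K 1) s)
     - K * (2 * mom K 0 s * Derive (mom K 0) s)).
  assert (HQ : forall t, is_derive Q t (Q' t)).
  { intros t. unfold Q, Q'. auto_derive.
    - repeat split; now apply mom_ex_derive.
    - change (fun x => mom K 1 x) with (mom K 1). change (fun x => mom K 2 x) with (mom K 2).
      change (fun x => mom K 3 x) with (mom K 3). change (fun x => mom K 0 x) with (mom K 0). ring. }
  assert (HQ2 : forall t, t * Q' t = - 2 * Q t).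
  { intros t. unfold Q', Q.
    pose proof (mom_linear K t HK) as L.
    pose proof (mom_derive K 0 t HK) as D0. pose proof (mom_derive K 1 t HK) as D1.
    pose proof (mom_derive K 2 t HK) as D2. pose proof (mom_derive K 3 t HK) as D3.
    transitivity (2 * (t * Derive (mom K 1) t * mom K 3 t + mom K 1 t * (t * Derive (mom K 3) t))
     - 2 * mom K 2 t * (t * Derive (mom K 2) t) - 4 * t * mom K 1 t ^ 2
     + (K - 1 - 4 * t) * (2 * mom K 1 t * (t * Derive (mom K 1) t))
     - K * (2 * mom K 0 t * (t * Derive (mom K 0) t))); [ring|].
    rewrite D0, D1, D2, D3.
    assert (L' : mom K 4 t = K * mom K 0 t - ((K - 1) * mom K 2 t - 4 * t * mom K 2 t - 2 * t * mom K 1 t)) by lra.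
    rewrite L'. ring. }
  cut (Q s = 0). { unfold Q; intros H; lra. }
  assert (Hsq : 0 <= - (Q s) ^ 2).
  { apply (nonneg_barrier (fun t => - (Q t) ^ 2)); [assumption| | |].
    - intros t _. auto_derive. exists (Q' t); apply HQ.
    - unfold Q. rewrite !mom_0. right; ring.
    - intros t Ht _.
      assert (E : Derive (fun t => - (Q t) ^ 2) t = - (2 * Q t * Q' t)).
      { apply is_derive_unique. auto_derive.
        - exists (Q' t); apply HQ.
        - change (fun x => Q x) with Q. rewrite (is_derive_unique _ _ _ (HQ t)). ring. }
      rewrite E.
      replace (- (2 * Q t * Q' t)) with (4 * Q t ^ 2 / t).
      + apply Rmult_le_pos; [nra|apply Rlt_le, Rinv_0_lt_compat; lra].
      + replace (Q' t) with (- 2 * Q t / t) by (rewrite <- HQ2; field; lra). field; lra. }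
  nra.
Qed.

(** The mean of [n + 1] under the weights [wgt K n * s^n]. *)
Definition mean1 (K s : R) : R := mom K 1 s / mom K 0 s.
(** The same mean for the size-biased weights [(n + 1) * wgt K n * s^n]. *)
Definition mean2 (K s : R) : R := mom K 2 s / mom K 1 s.

Lemma mean1_pos K s : 0 <= K -> 0 <= s -> 0 < mean1 K s.
Proof. intros; apply Rdiv_lt_0_compat; now apply mom_pos. Qed.

Lemma mean2_pos K s : 0 <= K -> 0 <= s -> 0 < mean2 K s.
Proof. intros; apply Rdiv_lt_0_compat; now apply mom_pos. Qed.

Lemma mean1_0 K : mean1 K 0 = 1.
Proof. unfold mean1; rewrite !mom_0; field. Qed.

Lemma mean2_0 K : mean2 K 0 = 1.
Proof. unfold mean2; rewrite !mom_0; field. Qed.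

Lemma ratio_ex_derive K j s : 0 <= K -> 0 <= s ->
  ex_derive (fun s => mom K (S j) s / mom K j s) s.
Proof.
  intros HK Hs. apply ex_derive_div; try now apply mom_ex_derive.
  apply Rgt_not_eq, Rlt_gt; now apply mom_pos.
Qed.

Lemma mean1_ex_derive K s : 0 <= K -> 0 <= s -> ex_derive (mean1 K) s.
Proof. apply (ratio_ex_derive K 0). Qed.

Lemma mean2_ex_derive K s : 0 <= K -> 0 <= s -> ex_derive (mean2 K) s.
Proof. apply (ratio_ex_derive K 1). Qed.

Lemma mean1_derive K s : 0 <= K -> 0 <= s ->
  s * Derive (mean1 K) s = mean1 K s * (mean2 K s - mean1 K s).
Proof.
  intros HK Hs. pose proof (mom_pos K 0 s HK Hs). pose proof (mom_pos K 1 s HK Hs).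
  unfold mean1 at 1. rewrite Derive_div by (try lra; now apply mom_ex_derive).
  replace (s * ((Derive (mom K 1) s * mom K 0 s - mom K 1 s * Derive (mom K 0) s) / mom K 0 s ^ 2))
    with ((s * Derive (mom K 1) s * mom K 0 s - mom K 1 s * (s * Derive (mom K 0) s)) / mom K 0 s ^ 2)
    by (field; lra).
  rewrite !mom_derive by assumption. unfold mean1, mean2. field; lra.
Qed.

(** [mom K 3] is eliminated by [mom_riccati], which closes the system for the two means. *)
Lemma mean2_derive K s : 0 <= K -> 0 <= s ->
  s * Derive (mean2 K) s = / 2 * (K / mean1 K s ^ 2 + 1 + 4 * s - K - mean2 K s ^ 2).
Proof.
  intros HK Hs. pose proof (mom_pos K 0 s HK Hs). pose proof (mom_pos K 1 s HK Hs).
  unfold mean2 at 1. rewrite Derive_div by (try lra; now apply mom_ex_derive).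
  replace (s * ((Derive (mom K 2) s * mom K 1 s - mom K 2 s * Derive (mom K 1) s) / mom K 1 s ^ 2))
    with ((s * Derive (mom K 2) s * mom K 1 s - mom K 2 s * (s * Derive (mom K 1) s)) / mom K 1 s ^ 2)
    by (field; lra).
  rewrite !mom_derive by assumption. unfold mean1, mean2.
  replace (K / (mom K 1 s / mom K 0 s) ^ 2) with (K * mom K 0 s ^ 2 / mom K 1 s ^ 2) by (field; lra).
  rewrite <- mom_riccati by assumption. field; lra.
Qed.

Lemma ratio_mono K K' s t j :
  0 <= K -> 0 <= K' -> 0 <= s -> 0 <= t ->
  (forall m, 1 <= m -> s * (m + K') <= t * (m + K)) ->
  mom K (S j) s / mom K j s <= mom K' (S j) t / mom K' j t.
Proof.
  intros HK HK' Hs Ht Hst.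
  pose proof (mom_pos K j s HK Hs). pose proof (mom_pos K' j t HK' Ht).
  pose proof (mom_ratio_cross K K' s t j HK HK' Hs Ht Hst) as H1.
  assert (0 <= t / (4 + K') - s / (4 + K)).
  { specialize (Hst 4 ltac:(lra)).
    replace (t / (4 + K') - s / (4 + K)) with ((t * (4 + K) - s * (4 + K')) / ((4 + K') * (4 + K)))
      by (field; lra).
    apply Rmult_le_pos; [lra|apply Rlt_le, Rinv_0_lt_compat; nra]. }
  assert (0 <= 2 ^ S j * (t / (4 + K') - s / (4 + K)))
    by (apply Rmult_le_pos; [apply pow_le|]; lra).
  apply Rmult_le_reg_r with (mom K j s * mom K' j t); [nra|].
  replace (mom K (S j) s / mom K j s * (mom K j s * mom K' j t))
    with (mom K (S j) s * mom K' j t) by (field; lra).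
  replace (mom K' (S j) t / mom K' j t * (mom K j s * mom K' j t))
    with (mom K' (S j) t * mom K j s) by (field; lra).
  lra.
Qed.

Lemma mean1_mono K K' s t : 0 <= K -> 0 <= K' -> 0 <= s -> 0 <= t ->
  (forall m, 1 <= m -> s * (m + K') <= t * (m + K)) -> mean1 K s <= mean1 K' t.
Proof. apply (ratio_mono K K' s t 0). Qed.

Lemma mean2_mono K K' s t : 0 <= K -> 0 <= K' -> 0 <= s -> 0 <= t ->
  (forall m, 1 <= m -> s * (m + K') <= t * (m + K)) -> mean2 K s <= mean2 K' t.
Proof. apply (ratio_mono K K' s t 1). Qed.

Lemma mean2_incr K s t : 0 <= K -> 0 <= s < t -> mean2 K s < mean2 K t.
Proof.
  intros HK [Hs Hst].
  pose proof (mom_pos K 1 s HK Hs). pose proof (mom_pos K 1 t HK ltac:(lra)).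
  pose proof (mom_ratio_cross K K s t 1 HK HK Hs ltac:(lra)) as H1.
  assert (H2 : 0 < 2 ^ 2 * (t / (4 + K) - s / (4 + K))).
  { replace (2 ^ 2 * (t / (4 + K) - s / (4 + K))) with (4 * (t - s) / (4 + K)) by (field; lra).
    apply Rdiv_lt_0_compat; lra. }
  assert (H3 : forall m, 1 <= m -> s * (m + K) <= t * (m + K)) by (intros; apply Rmult_le_compat_r; lra).
  specialize (H1 H3).
  unfold mean2. apply Rmult_lt_reg_r with (mom K 1 s * mom K 1 t); [nra|].
  replace (mom K 2 s / mom K 1 s * (mom K 1 s * mom K 1 t))
    with (mom K 2 s * mom K 1 t) by (field; lra).
  replace (mom K 2 t / mom K 1 t * (mom K 1 s * mom K 1 t))
    with (mom K 2 t * mom K 1 s) by (field; lra).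
  lra.
Qed.

Lemma mean2_gt_1 K s : 0 <= K -> 0 < s -> 1 < mean2 K s.
Proof. intros HK Hs. rewrite <- (mean2_0 K). apply mean2_incr; lra. Qed.

Lemma mean2_ge_1 K s : 0 <= K -> 0 <= s -> 1 <= mean2 K s.
Proof.
  intros HK [Hs|<-]; [now apply Rlt_le, mean2_gt_1|rewrite mean2_0; lra].
Qed.

Lemma mean1_ge_1 K s : 0 <= K -> 0 <= s -> 1 <= mean1 K s.
Proof.
  intros HK Hs. rewrite <- (mean1_0 K). apply mean1_mono; try lra.
  intros m Hm. nra.
Qed.

(** Bernoulli's inequality [L (z - 1) <= z^L - 1] for [z = exp y], from the tangent of [exp]
    at [y] evaluated at [L y] and at 0. *)
Lemma Bernoulli_exp L y : 1 <= L -> L * (exp y - 1) <= exp (L * y) - 1.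
Proof.
  intros HL.
  assert (H : forall z, exp y * (1 + (z - y)) <= exp z).
  { intros z. replace (exp z) with (exp y * exp (z - y)) by (rewrite <- exp_plus; f_equal; ring).
    apply Rmult_le_compat_l; [apply Rlt_le, exp_pos|].
    destruct (Req_dec (z - y) 0) as [->|Hz]; [rewrite exp_0; lra|].
    apply Rlt_le. now apply exp_ineq1. }
  pose proof (H (L * y)) as H1. pose proof (H 0) as H2. rewrite exp_0 in H2.
  pose proof (exp_pos y). nra.
Qed.

(** [l (1 + exp (- l^2 y))] increases with [l]: with [z = l^2 y] its derivative is
    [1 + exp (- z) (1 - 2 z)], and [2 z < exp z + 1]. *)
Lemma scaled_exp_incr lam y : 0 <= y -> 1 < lam ->
  1 + exp (- y) < lam * (1 + exp (- (lam ^ 2 * y))).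
Proof.
  intros Hy Hl.
  destruct (MVT_cor2 (fun l => l * (1 + exp (- (l ^ 2 * y))))
     (fun l => 1 + exp (- (l ^ 2 * y)) * (1 - 2 * (l ^ 2 * y))) 1 lam Hl) as [c [Hc1 Hc2]].
  { intros c Hc. apply is_derive_Reals. auto_derive; [easy|]. replace (c * (c * 1)) with (c ^ 2) by ring. ring. }
  replace (1 ^ 2 * y) with y in Hc1 by ring.
  assert (Hpos : 0 < 1 + exp (- (c ^ 2 * y)) * (1 - 2 * (c ^ 2 * y))).
  { set (z := c ^ 2 * y).
    assert (He : exp (-z) * exp z = 1) by (rewrite <- exp_plus, Rplus_opp_l; apply exp_0).
    assert (H1 : 2 * z < exp z + 1).
    { assert (z <= exp (z - 1)).
      { destruct (Req_dec (z - 1) 0) as [E|Hz]; [rewrite E, exp_0; lra|].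
        pose proof (exp_ineq1 _ Hz); lra. }
      replace z with (1 + (z - 1)) at 2 by ring. rewrite exp_plus.
      pose proof (exp_pos (z - 1)). pose proof (exp_ineq1 1 ltac:(lra)). nra. }
    pose proof (exp_pos (- z)). nra. }
  assert (0 < (1 + exp (- (c ^ 2 * y)) * (1 - 2 * (c ^ 2 * y))) * (lam - 1))
    by (apply Rmult_lt_0_compat; lra).
  lra.
Qed.

Section Ray.
Context (K1 K2 : R) (HK1 : 0 < K1) (HK : K1 < K2).
Let L := K2 / K1.

Lemma ray_mean1 q : 0 <= q -> mean1 K1 (q * K1) <= mean1 K2 (q * K2).
Proof. intros Hq. apply mean1_mono; try nra. intros m Hm. assert (0 <= q * m * (K2 - K1)) by (apply Rmult_le_pos; nra). nra. Qed.

Lemma ray_mean2 q : 0 <= q -> mean2 K1 (q * K1) <= mean2 K2 (q * K2).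
Proof. intros Hq. apply mean2_mono; try nra. intros m Hm. assert (0 <= q * m * (K2 - K1)) by (apply Rmult_le_pos; nra). nra. Qed.

Lemma ray_L_gt_1 : 1 < L.
Proof. unfold L. apply Rmult_lt_reg_r with K1; [lra|]. field_simplify; lra. Qed.

Lemma ray_L_mul : L * K1 = K2.
Proof. unfold L; field; lra. Qed.

(** On a ray [mean2 - 1] grows at most linearly in [K].  Where the difference [F] is negative,
    [L (g1 - 1) < g2 - 1], so the quadratic terms of the two Riccati equations have the right order,
    while [ray_mean1] orders the terms with [mean1]. *)
Lemma ray_mean2_upper q : 0 <= q -> mean2 K2 (q * K2) - 1 <= L * (mean2 K1 (q * K1) - 1).
Proof.
  intros Hq. pose proof ray_L_gt_1 as HL.
  set (F := fun q => L * (mean2 K1 (q * K1) - 1) - (mean2 K2 (q * K2) - 1)).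
  cut (0 <= F q); [unfold F; lra|].
  assert (D : forall t, 0 <= t -> is_derive F t
     (L * (K1 * Derive (mean2 K1) (t * K1)) - K2 * Derive (mean2 K2) (t * K2))).
  { intros t Ht. unfold F. auto_derive.
    - repeat split; apply mean2_ex_derive; nra.
    - change (fun x => mean2 K1 x) with (mean2 K1). change (fun x => mean2 K2 x) with (mean2 K2). ring. }
  apply nonneg_barrier; [assumption| | |].
  - intros t Ht. eexists; apply D; lra.
  - unfold F. rewrite !Rmult_0_l, !mean2_0. lra.
  - intros t Ht Hneg. rewrite (is_derive_unique _ _ _ (D t ltac:(lra))).
    assert (E1 : t * (K1 * Derive (mean2 K1) (t * K1)) = _) by
      (rewrite <- Rmult_assoc; apply mean2_derive; nra).
    assert (E2 : t * (K2 * Derive (mean2 K2) (t * K2)) = _) by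
      (rewrite <- Rmult_assoc; apply mean2_derive; nra).
    apply Rmult_le_reg_l with t; [lra|]. rewrite Rmult_0_r.
    replace (t * (L * (K1 * Derive (mean2 K1) (t * K1)) - K2 * Derive (mean2 K2) (t * K2)))
      with (L * (t * (K1 * Derive (mean2 K1) (t * K1))) - t * (K2 * Derive (mean2 K2) (t * K2))) by ring.
    rewrite E1, E2.
    pose proof (ray_mean1 t ltac:(lra)) as Hk. pose proof (ray_mean2 t ltac:(lra)) as Hg.
    pose proof (mean1_pos K1 (t * K1) ltac:(lra) ltac:(nra)) as Hk1.
    pose proof (mean2_ge_1 K1 (t * K1) ltac:(lra) ltac:(nra)) as Hg1.
    unfold F in Hneg. revert Hneg Hk Hg Hk1 Hg1.
    generalize (mean1 K1 (t * K1)) (mean2 K1 (t * K1)) (mean1 K2 (t * K2)) (mean2 K2 (t * K2)).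
    intros k1 g1 k2 g2 Hneg Hk Hg Hk1 Hg1.
    assert (Hi : / k2 ^ 2 <= / k1 ^ 2) by (apply Rinv_le_contravar; nra).
    rewrite <- ray_L_mul.
    assert (H1 : 0 <= L * K1 * (/ k1 ^ 2 - / k2 ^ 2)) by (apply Rmult_le_pos; nra).
    assert (H2 : 0 <= (g2 ^ 2 - 1) - L * (g1 ^ 2 - 1)).
    { replace (g2 ^ 2 - 1) with ((g2 - 1) * (g2 + 1)) by ring.
      replace (g1 ^ 2 - 1) with ((g1 - 1) * (g1 + 1)) by ring.
      assert (L * (g1 - 1) * (g1 + 1) <= (g2 - 1) * (g2 + 1)).
      { apply Rmult_le_compat; nra. } lra. }
    unfold Rdiv. lra.
  Qed.

(** On a ray [mean1] grows at most like a power: where the difference of logarithms is negative,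
    Bernoulli's inequality turns [mean1 (K1) ^ L < mean1 (K2)] into [L (mean1 (K1) - 1) <= mean1 (K2) - 1],
    and [ray_mean2_upper] then fixes the sign of the derivative. *)
Lemma ray_mean1_upper q : 0 <= q -> ln (mean1 K2 (q * K2)) <= L * ln (mean1 K1 (q * K1)).
Proof.
  intros Hq. pose proof ray_L_gt_1 as HL.
  set (F := fun q => L * ln (mean1 K1 (q * K1)) - ln (mean1 K2 (q * K2))).
  cut (0 <= F q); [unfold F; lra|].
  assert (D : forall t, 0 <= t -> is_derive F t
     (L * (K1 * Derive (mean1 K1) (t * K1) / mean1 K1 (t * K1)) - K2 * Derive (mean1 K2) (t * K2) / mean1 K2 (t * K2))).
  { intros t Ht. unfold F. auto_derive.
    - repeat split; try (apply mean1_ex_derive; nra); apply mean1_pos; nra.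
    - change (fun x => mean1 K1 x) with (mean1 K1). change (fun x => mean1 K2 x) with (mean1 K2).
      field. split; apply Rgt_not_eq, Rlt_gt, mean1_pos; nra. }
  apply nonneg_barrier; [assumption| | |].
  - intros t Ht. eexists; apply D; lra.
  - unfold F. rewrite !Rmult_0_l, !mean1_0, ln_1. lra.
  - intros t Ht Hneg. rewrite (is_derive_unique _ _ _ (D t ltac:(lra))).
    assert (E1 : t * (K1 * Derive (mean1 K1) (t * K1)) = _) by
      (rewrite <- Rmult_assoc; apply mean1_derive; nra).
    assert (E2 : t * (K2 * Derive (mean1 K2) (t * K2)) = _) by
      (rewrite <- Rmult_assoc; apply mean1_derive; nra).
    pose proof (mean1_pos K1 (t * K1) ltac:(lra) ltac:(nra)) as Hk1.
    pose proof (mean1_pos K2 (t * K2) ltac:(lra) ltac:(nra)) as Hk2.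
    apply Rmult_le_reg_l with t; [lra|]. rewrite Rmult_0_r.
    replace (t * (L * (K1 * Derive (mean1 K1) (t * K1) / mean1 K1 (t * K1)) - K2 * Derive (mean1 K2) (t * K2) / mean1 K2 (t * K2)))
      with (L * (t * (K1 * Derive (mean1 K1) (t * K1)) / mean1 K1 (t * K1)) - t * (K2 * Derive (mean1 K2) (t * K2)) / mean1 K2 (t * K2))
      by (field; lra).
    rewrite E1, E2.
    pose proof (ray_mean2_upper t ltac:(lra)) as Hg.
    assert (Hb : L * (mean1 K1 (t * K1) - 1) <= mean1 K2 (t * K2) - 1).
    { rewrite <- (exp_ln (mean1 K1 (t * K1))) by lra. rewrite <- (exp_ln (mean1 K2 (t * K2))) by lra.
      eapply Rle_trans; [apply Bernoulli_exp; lra|].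
      unfold F in Hneg.
      pose proof (exp_increasing (L * ln (mean1 K1 (t * K1))) (ln (mean1 K2 (t * K2))) ltac:(lra)). lra. }
    replace (mean1 K1 (t * K1) * (mean2 K1 (t * K1) - mean1 K1 (t * K1)) / mean1 K1 (t * K1))
      with (mean2 K1 (t * K1) - mean1 K1 (t * K1)) by (field; lra).
    replace (mean1 K2 (t * K2) * (mean2 K2 (t * K2) - mean1 K2 (t * K2)) / mean1 K2 (t * K2))
      with (mean2 K2 (t * K2) - mean1 K2 (t * K2)) by (field; lra).
    lra.
Qed.
End Ray.

(** Although [mean1] increases with [k] on a ray, the factor [k] wins: with [y = ln (mean1 (K1))] and
    [l = k2 / k1], [ray_mean1_upper] reduces the claim to [scaled_exp_incr]. *)
Lemma ray_im_incr k1 k2 q : 0 < k1 -> k1 < k2 -> 0 <= q ->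
  k1 * (1 + / mean1 (k1 ^ 2) (q * k1 ^ 2)) < k2 * (1 + / mean1 (k2 ^ 2) (q * k2 ^ 2)).
Proof.
  intros H1 H12 Hq.
  assert (HK1 : 0 < k1 ^ 2) by nra. assert (HK : k1 ^ 2 < k2 ^ 2) by nra.
  pose proof (ray_mean1_upper _ _ HK1 HK q Hq) as H.
  pose proof (mean1_ge_1 (k1 ^ 2) (q * k1 ^ 2) ltac:(lra) ltac:(nra)) as G1.
  pose proof (mean1_ge_1 (k2 ^ 2) (q * k2 ^ 2) ltac:(nra) ltac:(nra)) as G2.
  set (y := ln (mean1 (k1 ^ 2) (q * k1 ^ 2))) in *.
  assert (E1 : / mean1 (k1 ^ 2) (q * k1 ^ 2) = exp (- y)).
  { unfold y. rewrite exp_Ropp, exp_ln; lra. }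
  assert (E2 : exp (- ((k2 / k1) ^ 2 * y)) <= / mean1 (k2 ^ 2) (q * k2 ^ 2)).
  { rewrite <- (exp_ln (/ mean1 (k2 ^ 2) (q * k2 ^ 2))) by (apply Rinv_0_lt_compat; lra).
    rewrite ln_Rinv by lra.
    replace ((k2 / k1) ^ 2) with (k2 ^ 2 / k1 ^ 2) by (field; lra).
    apply Rle_lt_or_eq_dec in H. destruct H as [H|H].
    - apply Rlt_le, exp_increasing. lra.
    - rewrite H. lra. }
  assert (Hy : 0 <= y).
  { unfold y. rewrite <- ln_1. apply Rle_lt_or_eq_dec in G1; destruct G1 as [G1|G1].
    - apply Rlt_le, ln_increasing; lra.
    - rewrite <- G1; lra. }
  assert (Hl : 1 < k2 / k1).
  { apply Rmult_lt_reg_r with k1; [lra|]. field_simplify; lra. }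
  pose proof (scaled_exp_incr (k2 / k1) y Hy Hl) as HM.
  rewrite E1.
  apply Rlt_le_trans with (k1 * (k2 / k1 * (1 + exp (- ((k2 / k1) ^ 2 * y))))).
  - apply Rmult_lt_compat_l; lra.
  - replace (k1 * (k2 / k1 * (1 + exp (- ((k2 / k1) ^ 2 * y)))))
      with (k2 * (1 + exp (- ((k2 / k1) ^ 2 * y)))) by (field; lra).
    apply Rmult_le_compat_l; lra.
Qed.

(** * Uniqueness of the speed and of the modulus *)

(** Twice the imaginary part of the Bessel quotient [w]. *)
Definition twice_im (k s : R) : R := k * (1 + / mean1 (k ^ 2) s).

Lemma twice_im_opp k s : twice_im (- k) s = - twice_im k s.
Proof. unfold twice_im. replace ((- k) ^ 2) with (k ^ 2) by ring. ring. Qed.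

Lemma twice_im_factor k s : 0 <= s -> 0 < 1 + / mean1 (k ^ 2) s <= 2.
Proof.
  intros Hs. pose proof (mean1_ge_1 (k ^ 2) s ltac:(nra) Hs).
  assert (0 < / mean1 (k ^ 2) s) by (apply Rinv_0_lt_compat; lra).
  assert (/ mean1 (k ^ 2) s <= 1) by (rewrite <- Rinv_1; apply Rinv_le_contravar; lra).
  lra.
Qed.

(** Compare the rays [q1 = s1 / K1] and [q2 = s2 / K2].  If [q1 < q2], going from [(K1, s1)] to [(K2, s2)]
    raises [K] along a ray and then [s], so [mean2] grows strictly.  If [q2 <= q1], going from [(K1, s1)]
    to [(K2, s2)] lowers [s] and then raises [k] along a ray, and [twice_im] grows strictly. *)
Lemma no_two_speeds k1 k2 s1 s2 : 0 < k1 < k2 -> 0 < s1 -> 0 < s2 ->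
  mean2 (k1 ^ 2) s1 = mean2 (k2 ^ 2) s2 -> twice_im k1 s1 = twice_im k2 s2 -> False.
Proof.
  intros Hk Hs1 Hs2 Hg Hh.
  assert (P1 : 0 < k1 ^ 2) by nra. assert (P2 : 0 < k2 ^ 2) by nra.
  assert (P12 : k1 ^ 2 < k2 ^ 2) by nra.
  set (q1 := s1 / k1 ^ 2). set (q2 := s2 / k2 ^ 2).
  assert (Q1 : 0 < q1) by (apply Rdiv_lt_0_compat; lra).
  assert (Q2 : 0 < q2) by (apply Rdiv_lt_0_compat; lra).
  assert (E1 : s1 = q1 * k1 ^ 2) by (unfold q1; field; lra).
  assert (E2 : s2 = q2 * k2 ^ 2) by (unfold q2; field; lra).
  destruct (Rlt_or_le q1 q2) as [Hq|Hq].
  - pose proof (ray_mean2 _ _ P1 P12 q1 ltac:(lra)) as H1. rewrite <- E1 in H1.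
    pose proof (mean2_incr (k2 ^ 2) (q1 * k2 ^ 2) s2 ltac:(lra)) as H2.
    specialize (H2 ltac:(rewrite E2; split; [nra|apply Rmult_lt_compat_r; lra])). lra.
  - pose proof (ray_im_incr k1 k2 q2 ltac:(lra) ltac:(lra) ltac:(lra)) as H1.
    rewrite <- E2 in H1. fold (twice_im k2 s2) in H1. rewrite <- Hh in H1.
    assert (H2 : mean1 (k1 ^ 2) (q2 * k1 ^ 2) <= mean1 (k1 ^ 2) s1).
    { apply mean1_mono; try nra. intros m Hm. rewrite E1.
      apply Rmult_le_compat_r; [lra|]. apply Rmult_le_compat_r; lra. }
    assert (0 < mean1 (k1 ^ 2) (q2 * k1 ^ 2)) by (apply mean1_pos; nra).
    assert (/ mean1 (k1 ^ 2) s1 <= / mean1 (k1 ^ 2) (q2 * k1 ^ 2)) by (apply Rinv_le_contravar; lra).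
    unfold twice_im in H1. apply Rmult_lt_reg_l in H1; lra.
Qed.

Lemma twice_im_sign k s : 0 <= s -> (0 < k -> 0 < twice_im k s) /\ (k < 0 -> twice_im k s < 0).
Proof. intros Hs. pose proof (twice_im_factor k s Hs). unfold twice_im; split; intros; nra. Qed.

(** The sign of [twice_im] is that of [k], and [twice_im] is odd in [k], so only two positive speeds have
    to be compared.  For equal speeds [mean2] is injective in [s]. *)
Lemma means_injective k1 k2 s1 s2 : 0 < s1 -> 0 < s2 ->
  mean2 (k1 ^ 2) s1 = mean2 (k2 ^ 2) s2 -> twice_im k1 s1 = twice_im k2 s2 -> k1 = k2 /\ s1 = s2.
Proof.
  intros Hs1 Hs2 Hg Hh.
  assert (Hk : k1 = k2).
  { destruct (twice_im_sign k1 s1 ltac:(lra)) as [A1 B1]. destruct (twice_im_sign k2 s2 ltac:(lra)) as [A2 B2].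
    destruct (Rtotal_order k1 k2) as [H|[H|H]]; [exfalso| exact H|exfalso].
    - destruct (Rlt_or_le 0 k1) as [P|P]; [now apply (no_two_speeds k1 k2 s1 s2)|].
      destruct (Rlt_or_le k2 0) as [N|N].
      + apply (no_two_speeds (- k2) (- k1) s2 s1); try lra.
        * now replace ((- k2) ^ 2) with (k2 ^ 2) by ring; replace ((- k1) ^ 2) with (k1 ^ 2) by ring.
        * rewrite !twice_im_opp; lra.
      + assert (twice_im 0 s1 = 0) by (unfold twice_im; ring). assert (twice_im 0 s2 = 0) by (unfold twice_im; ring).
        destruct (Rle_lt_or_eq_dec k1 0 P) as [L1|L1]; destruct (Rle_lt_or_eq_dec 0 k2 N) as [L2|L2];
          subst; try specialize (A2 L2); try specialize (B1 L1); lra.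
    - destruct (Rlt_or_le 0 k2) as [P|P]; [apply (no_two_speeds k2 k1 s2 s1); auto|].
      destruct (Rlt_or_le k1 0) as [N|N].
      + apply (no_two_speeds (- k1) (- k2) s1 s2); try lra.
        * now replace ((- k2) ^ 2) with (k2 ^ 2) by ring; replace ((- k1) ^ 2) with (k1 ^ 2) by ring.
        * rewrite !twice_im_opp; lra.
      + assert (twice_im 0 s1 = 0) by (unfold twice_im; ring). assert (twice_im 0 s2 = 0) by (unfold twice_im; ring).
        destruct (Rle_lt_or_eq_dec k2 0 P) as [L1|L1]; destruct (Rle_lt_or_eq_dec 0 k1 N) as [L2|L2];
          subst; try specialize (A1 L2); try specialize (B2 L1); lra. }
  split; [exact Hk|]. subst k2.
  assert (P : 0 <= k1 ^ 2) by nra.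
  destruct (Rtotal_order s1 s2) as [H|[H|H]]; [exfalso|exact H|exfalso].
  - pose proof (mean2_incr (k1 ^ 2) s1 s2 P ltac:(lra)); lra.
  - pose proof (mean2_incr (k1 ^ 2) s2 s1 P ltac:(lra)); lra.
Qed.

(** The Riccati equation of [mean2] has slope [2] for large [s] as long as [mean2] is bounded, which
    is incompatible with a bound. *)
Lemma mean2_unbounded K G : 0 <= K -> exists s, 0 < s /\ G < mean2 K s.
Proof.
  intros HK.
  set (H := Rmax G 0).
  (* Beyond [s0] the bound [mean2 <= H] makes the right hand side of the Riccati equation at least [s]. *)
  set (s0 := K + H ^ 2 + 1).
  assert (H0 : 0 <= H) by apply Rmax_r. assert (HG : G <= H) by apply Rmax_l.
  assert (Hs0 : 1 <= s0) by (unfold s0; nra).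
  destruct (Rlt_or_le H (mean2 K (s0 + H))) as [Hlt|Hle].
  { exists (s0 + H); lra. }
  exfalso.
  assert (Hb : forall s, 0 <= s <= s0 + H -> mean2 K s <= H).
  { intros s [Hs1 [Hs2|Hs2]]; [|subst; exact Hle]. pose proof (mean2_incr K s (s0 + H) HK ltac:(lra)); lra. }
  assert (HH : 0 < H).
  { pose proof (mean2_pos K (s0 + H) HK ltac:(lra)). lra. }
  destruct (MVT_cor2 (mean2 K) (Derive (mean2 K)) s0 (s0 + H) ltac:(lra)) as [c [Hc1 Hc2]].
  { intros c Hc. apply is_derive_Reals, Derive_correct, mean2_ex_derive; lra. }
  assert (Hd : 1 <= Derive (mean2 K) c).
  { apply Rmult_le_reg_l with c; [lra|]. rewrite mean2_derive by lra.
    pose proof (Hb c ltac:(lra)) as Hgc. pose proof (mean2_pos K c HK ltac:(lra)).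
    pose proof (mean1_pos K c HK ltac:(lra)).
    assert (0 <= K / mean1 K c ^ 2) by (apply Rmult_le_pos; [lra|apply Rlt_le, Rinv_0_lt_compat; nra]).
    unfold s0 in Hc2. nra. }
  assert (H <= Derive (mean2 K) c * (s0 + H - s0)) by nra.
  pose proof (mean2_pos K s0 HK ltac:(lra)). lra.
Qed.

Lemma mean2_level K G : 0 <= K -> 1 < G -> exists s, 0 < s /\ mean2 K s = G.
Proof.
  intros HK HG. destruct (mean2_unbounded K G HK) as [S [HS HGS]].
  destruct (Ranalysis5.IVT_interv (fun s => mean2 K s - G) 0 S) as [s [Hs1 Hs2]].
  - intros a Ha. apply continuity_pt_minus; [|apply continuity_pt_const; now intros ? ?].
    apply continuity_pt_filterlim, (@ex_derive_continuous R_AbsRing R_NormedModule), mean2_ex_derive; lra.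
  - exact HS.
  - rewrite mean2_0; lra.
  - lra.
  - exists s. split; [|lra]. destruct (proj1 Hs1) as [|E]; [assumption|].
    subst s. rewrite mean2_0 in Hs2; lra.
Qed.

Section Compare.
Context (K K' : R) (HK : 0 <= K) (HKK : K <= K').
Let x := (1 + K) / (1 + K').

(** [(1 + K) / (1 + K')] is the factor by which [s] must shrink so that lowering [K'] to [K] does not
    raise the consecutive ratios [s / (m + K)], [m >= 1]. *)
Lemma shrink_bounds : 0 < x <= 1.
Proof.
  unfold x; split; [apply Rdiv_lt_0_compat; lra|].
  apply Rmult_le_reg_r with (1 + K'); [lra|]. field_simplify; lra.
Qed.

Lemma means_antitone s : 0 <= s -> mean1 K' s <= mean1 K s /\ mean2 K' s <= mean2 K s.
Proof.
  intros Hs. split; [apply mean1_mono|apply mean2_mono]; try lra;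
  intros m Hm; apply Rmult_le_compat_l; lra.
Qed.

Lemma means_shrunk s : 0 <= s -> mean1 K (s * x) <= mean1 K' s /\ mean2 K (s * x) <= mean2 K' s.
Proof.
  intros Hs. pose proof shrink_bounds.
  assert (H1 : forall m, 1 <= m -> s * x * (m + K') <= s * (m + K)).
  { intros m Hm. rewrite Rmult_assoc. apply Rmult_le_compat_l; [lra|].
    apply Rmult_le_reg_r with (1 + K'); [lra|]. unfold x.
    replace ((1 + K) / (1 + K') * (m + K') * (1 + K')) with ((1 + K) * (m + K')) by (field; lra).
    nra. }
  split; [apply mean1_mono|apply mean2_mono]; try lra; try nra; exact H1.
Qed.
End Compare.

Lemma mean2_le_inv K s t : 0 <= K -> 0 <= s -> 0 <= t -> mean2 K s <= mean2 K t -> s <= t.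
Proof.
  intros HK Hs Ht H. destruct (Rle_or_lt s t) as [|Hl]; [assumption|].
  pose proof (mean2_incr K t s HK ltac:(lra)); lra.
Qed.

Lemma mean1_incr K s t : 0 <= K -> 0 <= s <= t -> mean1 K s <= mean1 K t.
Proof. intros HK Hs. apply mean1_mono; try lra. intros m Hm; apply Rmult_le_compat_r; lra. Qed.

(** How far the level set of [mean2] moves when [K] changes. *)
Lemma level_compare G K K' s s' : 0 <= K <= K' -> 0 < s -> 0 < s' ->
  mean2 K s = G -> mean2 K' s' = G -> s <= s' <= s * ((1 + K') / (1 + K)).
Proof.
  intros HK Hs Hs' E E'. split.
  - apply (mean2_le_inv K); try lra. rewrite E, <- E'. apply means_antitone; lra.
  - pose proof (shrink_bounds K K' ltac:(lra) ltac:(lra)) as Hx.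
    set (y := s * ((1 + K') / (1 + K))).
    assert (Hy : 0 < y) by (apply Rmult_lt_0_compat; [|apply Rdiv_lt_0_compat]; lra).
    apply (mean2_le_inv K'); try lra. rewrite E', <- E.
    replace s with (y * ((1 + K) / (1 + K'))) at 1 by (unfold y; field; lra).
    apply means_shrunk; lra.
Qed.

(** Two-sided control of [mean1] along a level set of [mean2] by the single function [mean1 K0].  It
    yields the continuity of [mean1] along the level set by squeezing, for [X] tending to 1. *)
Lemma level_mean1_bounds G K0 K' s0 s' X : 0 <= K0 -> 0 <= K' -> 0 < s0 -> 0 < s' ->
  mean2 K0 s0 = G -> mean2 K' s' = G -> 1 <= X -> 1 + K0 <= X * (1 + K') -> 1 + K' <= X * (1 + K0) ->
  mean1 K0 (s0 / X) <= mean1 K' s' <= mean1 K0 (s0 * X).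
Proof.
  intros HK0 HK' Hs0 Hs' E0 E' HX H1 H2.
  assert (HXi : 0 < / X <= 1).
  { split; [apply Rinv_0_lt_compat; lra|]. rewrite <- Rinv_1. apply Rinv_le_contravar; lra. }
  destruct (Rle_or_lt K0 K') as [L|L].
  - destruct (level_compare G K0 K' s0 s' ltac:(lra) Hs0 Hs' E0 E') as [A B].
    assert (Bx : (1 + K') / (1 + K0) <= X).
    { apply Rmult_le_reg_r with (1 + K0); [lra|]. field_simplify; lra. }
    split.
    + assert (Hx : / X <= (1 + K0) / (1 + K')).
      { replace ((1 + K0) / (1 + K')) with (/ ((1 + K') / (1 + K0))) by (field; lra).
        apply Rinv_le_contravar; [apply Rdiv_lt_0_compat; lra|exact Bx]. }
      eapply Rle_trans; [|apply (proj1 (means_shrunk K0 K' HK0 L s' ltac:(lra)))].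
      apply mean1_incr; [lra|]. unfold Rdiv at 1 2. split; [nra|].
      apply Rmult_le_compat; try lra; exact Hx.
    + eapply Rle_trans; [apply (proj1 (means_antitone K0 K' HK0 L s' ltac:(lra)))|].
      apply mean1_incr; [lra|]. split; [lra|]. eapply Rle_trans; [exact B|].
      apply Rmult_le_compat_l; lra.
  - destruct (level_compare G K' K0 s' s0 ltac:(lra) Hs' Hs0 E' E0) as [A B].
    assert (Bx : (1 + K0) / (1 + K') <= X).
    { apply Rmult_le_reg_r with (1 + K'); [lra|]. field_simplify; lra. }
    assert (Hx : / X <= (1 + K') / (1 + K0)).
    { replace ((1 + K') / (1 + K0)) with (/ ((1 + K0) / (1 + K'))) by (field; lra).
      apply Rinv_le_contravar; [apply Rdiv_lt_0_compat; lra|exact Bx]. }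
    split.
    + eapply Rle_trans; [|apply (proj1 (means_antitone K' K0 HK' ltac:(lra) s' ltac:(lra)))].
      apply mean1_incr; [lra|]. split; [unfold Rdiv; nra|].
      apply Rmult_le_reg_r with X; [lra|]. replace (s0 / X * X) with s0 by (field; lra).
      eapply Rle_trans; [exact B|]. apply Rmult_le_compat_l; lra.
    + set (y := s' * ((1 + K0) / (1 + K'))).
      pose proof (proj1 (means_shrunk K' K0 HK' ltac:(lra) y
        ltac:(apply Rmult_le_pos; [lra|apply Rlt_le, Rdiv_lt_0_compat; lra]))) as C.
      replace (y * ((1 + K') / (1 + K0))) with s' in C by (unfold y; field; lra).
      eapply Rle_trans; [exact C|]. apply mean1_incr; [lra|].
      split; [apply Rmult_le_pos; [lra|apply Rlt_le, Rdiv_lt_0_compat; lra]|].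
      unfold y. apply Rmult_le_compat; try lra. apply Rlt_le, Rdiv_lt_0_compat; lra.
Qed.

(** * Existence of the speed and of the modulus *)

Lemma continuous_squeeze (f g h : R -> R) x :
  (forall y, f y <= g y <= h y) -> f x = h x ->
  continuous f x -> continuous h x -> continuous g x.
Proof.
  intros Hle E Hf Hh. assert (Eg : g x = f x) by (specialize (Hle x); lra).
  apply (filterlim_le_le (F := locally x) f g h (Finite (g x))).
  - apply filter_forall; exact Hle.
  - rewrite Eg. exact Hf.
  - rewrite Eg, E. exact Hh.
Qed.

Lemma mean1_continuous K s : 0 <= K -> 0 <= s -> continuous (mean1 K) s.
Proof. intros. apply (@ex_derive_continuous R_AbsRing R_NormedModule), mean1_ex_derive; lra. Qed.

(** Intermediate value theorem in [k] along the level set [mean2 = G]; since [1 < 1 + 1 / mean1], the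
    function [k (1 + 1 / mean1)] exceeds [|b|] in absolute value at [k = +- (|b| + 1)]. *)
Lemma means_surjective G b : 1 < G -> exists k s, 0 < s /\ mean2 (k ^ 2) s = G /\ twice_im k s = b.
Proof.
  intros HG.
  set (lev := fun k => epsilon (inhabits 0) (fun s => 0 < s /\ mean2 (k ^ 2) s = G)).
  assert (Hlev : forall k, 0 < lev k /\ mean2 (k ^ 2) (lev k) = G).
  { intros k. apply (epsilon_spec (inhabits 0) (fun s => 0 < s /\ mean2 (k ^ 2) s = G)).
    apply mean2_level; nra. }
  set (kp := fun k => mean1 (k ^ 2) (lev k)).
  assert (Hkp : forall k, 1 <= kp k).
  { intros k. apply mean1_ge_1; [nra|]. destruct (Hlev k); lra. }
  assert (Hc : forall k0, continuous kp k0).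
  { intros k0.
    (* Both [(1 + k^2) / (1 + k0^2)] and its inverse are at most [X k]. *)
    set (X := fun k => 1 + Rabs (k ^ 2 - k0 ^ 2)).
    assert (HX : continuous X k0).
    { unfold X. apply (continuous_plus (fun _ => 1)); [apply continuous_const|].
      apply (continuous_comp (fun k => k ^ 2 - k0 ^ 2) Rabs).
      - apply (@ex_derive_continuous R_AbsRing R_NormedModule). auto_derive. easy.
      - apply continuous_Rabs. }
    assert (EX : X k0 = 1) by (unfold X; rewrite Rminus_diag, Rabs_R0; ring).
    destruct (Hlev k0) as [L0 E0].
    apply (continuous_squeeze (fun k => mean1 (k0 ^ 2) (lev k0 / X k)) kp
             (fun k => mean1 (k0 ^ 2) (lev k0 * X k))).
    - intros k. destruct (Hlev k) as [L E].
      apply (level_mean1_bounds G); try assumption; try nra.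
      + unfold X. pose proof (Rabs_pos (k ^ 2 - k0 ^ 2)); lra.
      + unfold X. pose proof (Rabs_pos (k ^ 2 - k0 ^ 2)).
        pose proof (Rabs_maj2 (k ^ 2 - k0 ^ 2)). nra.
      + unfold X. pose proof (Rabs_pos (k ^ 2 - k0 ^ 2)).
        pose proof (Rle_abs (k ^ 2 - k0 ^ 2)). nra.
    - rewrite EX. f_equal. field.
    - apply (continuous_comp (fun k => lev k0 / X k) (mean1 (k0 ^ 2))).
      + apply (continuous_mult (fun _ => lev k0)); [apply continuous_const|].
        apply continuous_Rinv_comp; [exact HX|]. rewrite EX; lra.
      + rewrite EX. apply mean1_continuous; [nra|]. unfold Rdiv; rewrite Rinv_1; lra.
    - apply (continuous_comp (fun k => lev k0 * X k) (mean1 (k0 ^ 2))).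
      + apply (continuous_mult (fun _ => lev k0)); [apply continuous_const|exact HX].
      + rewrite EX. apply mean1_continuous; nra. }
  set (B := Rabs b + 1).
  assert (HB : 1 <= B) by (unfold B; pose proof (Rabs_pos b); lra).
  destruct (Ranalysis5.IVT_interv (fun k => k * (1 + / kp k) - b) (- B) B) as [k [Hk1 Hk2]].
  - intros k _. apply continuity_pt_filterlim.
    apply (continuous_minus (fun k => k * (1 + / kp k)) (fun _ => b)); [|apply continuous_const].
    apply (continuous_mult (fun k : R => k) (fun k => 1 + / kp k)); [apply continuous_id|].
    apply (continuous_plus (fun _ => 1)); [apply continuous_const|].
    apply continuous_Rinv_comp; [apply Hc|]. specialize (Hkp k); lra.
  - lra.
  - assert (0 < / kp (- B)) by (apply Rinv_0_lt_compat; specialize (Hkp (- B)); lra).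
    unfold B in *. pose proof (Rabs_maj2 b). nra.
  - assert (0 < / kp B) by (apply Rinv_0_lt_compat; specialize (Hkp B); lra).
    unfold B in *. pose proof (Rle_abs b). nra.
  - exists k, (lev k). destruct (Hlev k). split; [assumption|split; [assumption|]].
    unfold twice_im. fold (kp k). lra.
Qed.

(** * Bessel series of imaginary order and their quotient *)

(** Each factor [1 + n + i k] has modulus at least [n + 1]. *)
Lemma Crising_mod k n : INR (fact n) <= Cmod (Crising (1, k) n).
Proof.
  induction n as [|n IH]; simpl Crising.
  - rewrite Cmod_R, Rabs_R1. simpl; lra.
  - rewrite Cmod_mult, fact_simpl, mult_INR, Rmult_comm.
    apply Rmult_le_compat; try apply pos_INR; [exact IH|].
    eapply Rle_trans; [|apply (Rmax_Cmod ((1, k) + RtoC (INR n))%C)].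
    eapply Rle_trans; [|apply Rmax_l].
    simpl fst. rewrite S_INR, Rplus_comm. apply Rle_abs.
Qed.

Lemma Crising_neq_0 k n : Crising (1, k) n <> 0%C.
Proof.
  intros H. pose proof (Crising_mod k n) as H1. rewrite H, Cmod_0 in H1.
  pose proof (INR_fact_lt_0 n); lra.
Qed.

(** Coefficient of [s^p] in [B_n (s) = sum_p s^p / (p! (1 + i k)_(n+p))], a multiple of the Bessel function
    of order [n + i k] with [s] the square of half the argument. *)
Definition bcoef (k : R) (n p : nat) : C :=
  (/ (RtoC (INR (fact p)) * Crising (1, k) (n + p)))%C.

Lemma RtoC_fact_neq_0 p : RtoC (INR (fact p)) <> 0%C.
Proof. intros H. injection H as H. now apply (INR_fact_neq_0 p). Qed.

Lemma bcoef_mod k n p : Cmod (bcoef k n p) <= / INR (fact p) * / INR (fact n).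
Proof.
  unfold bcoef. rewrite Cmod_inv by (apply Cmult_neq_0; [apply RtoC_fact_neq_0|apply Crising_neq_0]).
  rewrite Cmod_mult, Cmod_R, Rabs_pos_eq by apply pos_INR.
  pose proof (INR_fact_lt_0 p). pose proof (INR_fact_lt_0 n).
  rewrite Rinv_mult. apply Rmult_le_compat_l; [apply Rlt_le, Rinv_0_lt_compat; lra|].
  apply Rinv_le_contravar; [lra|].
  eapply Rle_trans; [|apply Crising_mod]. apply le_INR, fact_le; lia.
Qed.

Lemma Re_Cmod z : Rabs (Re z) <= Cmod z.
Proof. eapply Rle_trans; [apply Rmax_l|apply (Rmax_Cmod z)]. Qed.

Lemma Im_Cmod z : Rabs (Im z) <= Cmod z.
Proof. eapply Rle_trans; [apply Rmax_r|apply (Rmax_Cmod z)]. Qed.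

Lemma is_series_exp s : is_series (fun p => / INR (fact p) * s ^ p) (exp s).
Proof.
  pose proof (is_exp_Reals s) as H. apply is_pseries_R in H. exact H.
Qed.

Lemma exp_dominated (a : nat -> R) M s :
  0 <= M -> (forall p, Rabs (a p) <= / INR (fact p) * M) ->
  ex_series (fun p => Rabs (a p * s ^ p)) /\ Rabs (PSeries a s) <= M * exp (Rabs s).
Proof.
  intros HM Ha.
  assert (Hle : forall p, 0 <= Rabs (a p * s ^ p) <= M * (/ INR (fact p) * Rabs s ^ p)).
  { intros p; split; [apply Rabs_pos|]. rewrite Rabs_mult, <- RPow_abs.
    rewrite <- Rmult_assoc. rewrite (Rmult_comm M).
    apply Rmult_le_compat_r; [apply pow_le, Rabs_pos|apply Ha]. }
  assert (He : is_series (fun p => M * (/ INR (fact p) * Rabs s ^ p)) (M * exp (Rabs s))).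
  { apply (is_series_scal M (fun p => / INR (fact p) * Rabs s ^ p)), is_series_exp. }
  assert (Hx : ex_series (fun p => Rabs (a p * s ^ p))).
  { apply (ex_series_le (K := R_AbsRing) (V := R_CompleteNormedModule)) with (2 := ex_intro _ _ He).
    intros p. unfold norm; simpl. unfold abs; simpl. rewrite Rabs_Rabsolu. apply Hle. }
  split; [exact Hx|].
  eapply Rle_trans; [apply Series_Rabs; exact Hx|].
  rewrite <- (is_series_unique _ _ He). apply Series_le; [exact Hle|eexists; exact He].
Qed.

Lemma exp_dominated_radius (a : nat -> R) M :
  0 <= M -> (forall p, Rabs (a p) <= / INR (fact p) * M) -> CV_radius a = p_infty.
Proof.
  intros HM Ha.
  assert (H : forall r : R, Rbar_le r (CV_radius a)).
  { intros r. apply (proj1 (CV_radius_bounded a)).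
    exists (M * exp (Rabs r)). intros n.
    assert (Hle : Rabs (a n * r ^ n) <= M * (/ INR (fact n) * Rabs r ^ n)).
    { rewrite Rabs_mult, <- RPow_abs. rewrite <- Rmult_assoc. rewrite (Rmult_comm M).
      apply Rmult_le_compat_r; [apply pow_le, Rabs_pos|apply Ha]. }
    eapply Rle_trans; [exact Hle|]. apply Rmult_le_compat_l; [exact HM|].
    assert (Hn : forall m, 0 <= / INR (fact m) * Rabs r ^ m).
    { intros m. apply Rmult_le_pos; [apply Rlt_le, Rinv_0_lt_compat, INR_fact_lt_0|apply pow_le, Rabs_pos]. }
    pose proof (is_series_exp (Rabs r)) as He.
    eapply Rle_trans; [|apply (is_lim_seq_incr_compare (sum_n (fun p => / INR (fact p) * Rabs r ^ p)) _ He)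
       with (n := n)].
    - destruct n as [|n]; [rewrite sum_O; lra|]. rewrite sum_Sn. unfold plus; simpl plus.
      assert (0 <= sum_n (fun p => / INR (fact p) * Rabs r ^ p) n).
      { rewrite sum_n_Reals. now apply cond_pos_sum. }
      simpl in *. lra.
    - intros m. rewrite sum_Sn. unfold plus; simpl plus. specialize (Hn (S m)). simpl in *. lra. }
  destruct (CV_radius a) as [x| |] eqn:E; [exfalso|reflexivity|exfalso].
  - specialize (H (x + 1)). simpl in H. lra.
  - exact (H 0).
Qed.

Definition bes_re (k : R) (n : nat) (s : R) : R := PSeries (fun p => Re (bcoef k n p)) s.
Definition bes_im (k : R) (n : nat) (s : R) : R := PSeries (fun p => Im (bcoef k n p)) s.

Section BesselQuotient.
Context (k : R).

Lemma Re_bcoef_le n p : Rabs (Re (bcoef k n p)) <= / INR (fact p) * / INR (fact n).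
Proof. eapply Rle_trans; [apply Re_Cmod|apply bcoef_mod]. Qed.
Lemma Im_bcoef_le n p : Rabs (Im (bcoef k n p)) <= / INR (fact p) * / INR (fact n).
Proof. eapply Rle_trans; [apply Im_Cmod|apply bcoef_mod]. Qed.
Lemma inv_fact_nonneg n : 0 <= / INR (fact n).
Proof. apply Rlt_le, Rinv_0_lt_compat, INR_fact_lt_0. Qed.

Lemma bes_re_radius n : CV_radius (fun p => Re (bcoef k n p)) = p_infty.
Proof. apply exp_dominated_radius with (1 := inv_fact_nonneg n), Re_bcoef_le. Qed.
Lemma bes_im_radius n : CV_radius (fun p => Im (bcoef k n p)) = p_infty.
Proof. apply exp_dominated_radius with (1 := inv_fact_nonneg n), Im_bcoef_le. Qed.

Lemma bes_re_bound n s : Rabs (bes_re k n s) <= / INR (fact n) * exp (Rabs s).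
Proof. apply exp_dominated with (1 := inv_fact_nonneg n), Re_bcoef_le. Qed.
Lemma bes_im_bound n s : Rabs (bes_im k n s) <= / INR (fact n) * exp (Rabs s).
Proof. apply exp_dominated with (1 := inv_fact_nonneg n), Im_bcoef_le. Qed.

(** The coefficient form of [B_n' = B_(n+1)]. *)
Lemma bcoef_succ n p : (RtoC (INR (S p)) * bcoef k n (S p))%C = bcoef k (S n) p.
Proof.
  unfold bcoef. replace (n + S p)%nat with (S n + p)%nat by lia.
  rewrite fact_simpl, mult_INR, RtoC_mult.
  pose proof (Crising_neq_0 k (S n + p)). pose proof (RtoC_fact_neq_0 p).
  assert (RtoC (INR (S p)) <> 0%C) by (intros E; injection E as E; now apply (not_0_INR (S p))).
  field. auto.
Qed.

Lemma Re_RtoC_mult x z : Re (RtoC x * z) = x * Re z.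
Proof. destruct z; simpl; ring. Qed.
Lemma Im_RtoC_mult x z : Im (RtoC x * z) = x * Im z.
Proof. destruct z; simpl; ring. Qed.

Lemma bes_re_is_derive n s : is_derive (bes_re k n) s (bes_re k (S n) s).
Proof.
  unfold bes_re at 2. rewrite (PSeries_ext _ (PS_derive (fun p => Re (bcoef k n p)))).
  - apply is_derive_PSeries. rewrite bes_re_radius; easy.
  - intros p. unfold PS_derive. rewrite <- bcoef_succ, Re_RtoC_mult; reflexivity.
Qed.
Lemma bes_im_is_derive n s : is_derive (bes_im k n) s (bes_im k (S n) s).
Proof.
  unfold bes_im at 2. rewrite (PSeries_ext _ (PS_derive (fun p => Im (bcoef k n p)))).
  - apply is_derive_PSeries. rewrite bes_im_radius; easy.
  - intros p. unfold PS_derive. rewrite <- bcoef_succ, Im_RtoC_mult; reflexivity.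
Qed.

(** The coefficient form of [B_n = (n + 1 + i k) B_(n+1) + s B_(n+2)]. *)
Lemma bcoef_rec n p :
  bcoef k n p = (((INR n + 1)%R, k) * bcoef k (S n) p +
     match p with O => 0 | S p' => bcoef k (S (S n)) p' end)%C.
Proof.
  assert (E : forall m, Crising (1, k) (S m) = (Crising (1, k) m * ((1 + INR m)%R, k))%C).
  { intros m. simpl. f_equal. unfold RtoC, Cplus; simpl. f_equal; ring. }
  assert (Hm : forall m, (1 + INR m, k) <> RtoC 0).
  { intros m H. injection H as H1 H2. pose proof (pos_INR m); lra. }
  destruct p as [|p]; unfold bcoef.
  - rewrite Nat.add_0_r, Nat.add_0_r, E, Rplus_comm.
    pose proof (Crising_neq_0 k n). pose proof (RtoC_fact_neq_0 0). specialize (Hm n). field. auto.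
  - replace (S n + S p)%nat with (S (n + S p)) by lia.
    replace (S (S n) + p)%nat with (S (n + S p)) by lia.
    rewrite E, fact_simpl, mult_INR, RtoC_mult.
    pose proof (Crising_neq_0 k (n + S p)). pose proof (RtoC_fact_neq_0 p). specialize (Hm (n + S p)%nat).
    assert (RtoC (INR (S p)) <> 0%C) by (intros E'; injection E' as E'; now apply (not_0_INR (S p))).
    assert (E2 : (1 + INR (n + S p), k) = (((INR n + 1)%R, k) + RtoC (INR (S p)))%C).
    { apply injective_projections; unfold Cplus, RtoC, fst, snd; [rewrite plus_INR|]; ring. }
    rewrite E2 in *. field. auto.
Qed.

Lemma PSeries_shift_lin (a b c d : nat -> R) x y s :
  CV_radius b = p_infty -> CV_radius c = p_infty -> CV_radius d = p_infty ->
  (forall p, a p = x * b p + y * c p + match p with O => 0 | S p' => d p' end) ->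
  PSeries a s = x * PSeries b s + y * PSeries c s + s * PSeries d s.
Proof.
  intros Hb Hc Hd E.
  assert (I : forall e, CV_radius e = p_infty -> ex_pseries e s)
    by (intros e He; apply CV_radius_inside; rewrite He; easy).
  rewrite PSeries_lin2, <- PSeries_incr_1 by assumption.
  rewrite <- PSeries_plus.
  - apply PSeries_ext. intros [|p]; rewrite E; reflexivity.
  - apply (ex_pseries_plus (PS_scal x b) (PS_scal y c)); apply ex_pseries_scal; auto; apply Rmult_comm.
  - apply ex_pseries_incr_1; auto.
Qed.

Lemma bes_re_rec n s : bes_re k n s = (INR n + 1) * bes_re k (S n) s + - k * bes_im k (S n) s + s * bes_re k (S (S n)) s.
Proof.
  apply PSeries_shift_lin; [apply bes_re_radius | apply bes_im_radius | apply bes_re_radius |].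
  intros p. rewrite (bcoef_rec n p). destruct p as [|p]; simpl; ring.
Qed.
Lemma bes_im_rec n s : bes_im k n s = (INR n + 1) * bes_im k (S n) s + k * bes_re k (S n) s + s * bes_im k (S (S n)) s.
Proof.
  apply PSeries_shift_lin; [apply bes_im_radius | apply bes_re_radius | apply bes_im_radius |].
  intros p. rewrite (bcoef_rec n p). destruct p as [|p]; simpl; ring.
Qed.

(** The real part of the quotient [w = B_0 / B_1], and in [quo_im] its imaginary part; the link with the
    series is [bes_re_im_quotient]. *)
Definition quo_re (s : R) : R := (mean2 (k ^ 2) s + 1) / 2.
Definition quo_im (s : R) : R := twice_im k s / 2.

Lemma quo_re_ge_1 s : 0 <= s -> 1 <= quo_re s.
Proof. intros Hs. unfold quo_re. pose proof (mean2_ge_1 (k ^ 2) s ltac:(nra) Hs). lra. Qed.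

(** With [quo_im_derive], the complex Riccati equation [s w' = s + w (1 + i k - w)] in real terms. *)
Lemma quo_re_derive s : 0 <= s -> ex_derive quo_re s /\
  s * Derive quo_re s = s - quo_re s * (quo_re s - 1) - quo_im s * (k - quo_im s).
Proof.
  intros Hs. assert (HK : 0 <= k ^ 2) by nra.
  assert (D : is_derive quo_re s (Derive (mean2 (k ^ 2)) s / 2)).
  { unfold quo_re. generalize (k ^ 2), HK. intros K HK'.
    auto_derive; [repeat split; apply mean2_ex_derive; lra|].
    change (fun x => mean2 K x) with (mean2 K). field. }
  split; [eexists; exact D|]. rewrite (is_derive_unique _ _ _ D).
  replace (s * (Derive (mean2 (k ^ 2)) s / 2)) with (s * Derive (mean2 (k ^ 2)) s / 2) by field.
  rewrite mean2_derive by assumption. unfold quo_re, quo_im, twice_im.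
  pose proof (mean1_pos (k ^ 2) s HK Hs) as Hp. revert Hp.
  generalize (mean1 (k ^ 2) s), (mean2 (k ^ 2) s). intros x y Hp. field. lra.
Qed.

Lemma quo_im_derive s : 0 <= s -> ex_derive quo_im s /\
  s * Derive quo_im s = quo_re s * (k - 2 * quo_im s) + quo_im s.
Proof.
  intros Hs. assert (HK : 0 <= k ^ 2) by nra.
  pose proof (mean1_pos (k ^ 2) s HK Hs) as Hp.
  assert (D : is_derive quo_im s (- (k / 2) * Derive (mean1 (k ^ 2)) s / mean1 (k ^ 2) s ^ 2)).
  { unfold quo_im, twice_im. generalize dependent (k ^ 2). intros K HK' HK.
    auto_derive; [repeat split; [apply mean1_ex_derive; lra|lra]|].
    change (fun x => mean1 K x) with (mean1 K). field; lra. }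
  split; [eexists; exact D|]. rewrite (is_derive_unique _ _ _ D).
  replace (s * (- (k / 2) * Derive (mean1 (k ^ 2)) s / mean1 (k ^ 2) s ^ 2))
    with (- (k / 2) * (s * Derive (mean1 (k ^ 2)) s) / mean1 (k ^ 2) s ^ 2) by (field; lra).
  rewrite mean1_derive by assumption. unfold quo_re, quo_im, twice_im. revert Hp.
  generalize (mean1 (k ^ 2) s), (mean2 (k ^ 2) s). intros x y Hp. field. lra.
Qed.

Lemma bcoef_0 n : bcoef k n 0 = (/ Crising (1, k) n)%C.
Proof.
  unfold bcoef. rewrite Nat.add_0_r. simpl fact. simpl INR. now rewrite Cmult_1_l.
Qed.

Lemma bes_0_at_0 : bes_re k 0 0 = 1 /\ bes_im k 0 0 = 0.
Proof.
  unfold bes_re, bes_im. rewrite !PSeries_0, bcoef_0. simpl. split; field.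
Qed.

Lemma bes_1_at_0 : bes_re k 1 0 = / (1 + k ^ 2) /\ bes_im k 1 0 = - k / (1 + k ^ 2).
Proof.
  unfold bes_re, bes_im. rewrite !PSeries_0, bcoef_0. simpl. split; field; nra.
Qed.

(** By the Riccati equation of [w], the error [e = B_0 - w B_1] satisfies [s e' = - w e].  Its modulus
    does not increase, as [Re w >= 1], and it vanishes at 0.  No division by [B_1] takes place, so
    that its zeros need not be excluded beforehand. *)
Lemma bes_re_im_quotient s : 0 <= s ->
  bes_re k 0 s = quo_re s * bes_re k 1 s - quo_im s * bes_im k 1 s /\
  bes_im k 0 s = quo_re s * bes_im k 1 s + quo_im s * bes_re k 1 s.
Proof.
  intros Hs.
  set (eR := fun s => bes_re k 0 s - (quo_re s * bes_re k 1 s - quo_im s * bes_im k 1 s)).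
  set (eI := fun s => bes_im k 0 s - (quo_re s * bes_im k 1 s + quo_im s * bes_re k 1 s)).
  assert (DR : forall t, 0 <= t -> is_derive eR t
    (bes_re k 1 t - (Derive quo_re t * bes_re k 1 t + quo_re t * bes_re k 2 t - Derive quo_im t * bes_im k 1 t - quo_im t * bes_im k 2 t))).
  { intros t Ht. unfold eR. auto_derive.
    - repeat split; lazymatch goal with
      | |- context [bes_re] => eexists; apply bes_re_is_derive
      | |- context [bes_im] => eexists; apply bes_im_is_derive
      | |- context [quo_re] => apply (proj1 (quo_re_derive t Ht))
      | |- context [quo_im] => apply (proj1 (quo_im_derive t Ht)) end.
    - change (fun x => bes_re k 0 x) with (bes_re k 0). change (fun x => bes_re k 1 x) with (bes_re k 1).
      change (fun x => bes_im k 1 x) with (bes_im k 1). change (fun x => quo_re x) with quo_re. change (fun x => quo_im x) with quo_im.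
      rewrite (is_derive_unique _ _ _ (bes_re_is_derive 0 t)), (is_derive_unique _ _ _ (bes_re_is_derive 1 t)),
        (is_derive_unique _ _ _ (bes_im_is_derive 1 t)). ring. }
  assert (DI : forall t, 0 <= t -> is_derive eI t
    (bes_im k 1 t - (Derive quo_re t * bes_im k 1 t + quo_re t * bes_im k 2 t + Derive quo_im t * bes_re k 1 t + quo_im t * bes_re k 2 t))).
  { intros t Ht. unfold eI. auto_derive.
    - repeat split; lazymatch goal with
      | |- context [bes_re] => eexists; apply bes_re_is_derive
      | |- context [bes_im] => eexists; apply bes_im_is_derive
      | |- context [quo_re] => apply (proj1 (quo_re_derive t Ht))
      | |- context [quo_im] => apply (proj1 (quo_im_derive t Ht)) end.
    - change (fun x => bes_im k 0 x) with (bes_im k 0). change (fun x => bes_re k 1 x) with (bes_re k 1).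
      change (fun x => bes_im k 1 x) with (bes_im k 1). change (fun x => quo_re x) with quo_re. change (fun x => quo_im x) with quo_im.
      rewrite (is_derive_unique _ _ _ (bes_im_is_derive 0 t)), (is_derive_unique _ _ _ (bes_re_is_derive 1 t)),
        (is_derive_unique _ _ _ (bes_im_is_derive 1 t)). ring. }
  assert (H : 0 <= - (eR s ^ 2 + eI s ^ 2)).
  { set (F := fun s => - (eR s ^ 2 + eI s ^ 2)).
    assert (DF : forall t, 0 <= t -> is_derive F t (- 2 * (eR t * Derive eR t + eI t * Derive eI t))).
    { intros t Ht. unfold F. auto_derive.
      - repeat split; [eexists; apply DR|eexists; apply DI]; assumption.
      - change (fun x => eR x) with eR. change (fun x => eI x) with eI. ring. }
    apply (nonneg_barrier F s Hs).
    - intros t Ht. eexists; apply DF; lra.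
    - unfold F, eR, eI. destruct bes_0_at_0 as [-> ->]. destruct bes_1_at_0 as [-> ->].
      unfold quo_re, quo_im, twice_im. rewrite mean2_0, mean1_0. right. field. nra.
    - intros t Ht _. rewrite (is_derive_unique _ _ _ (DF t ltac:(lra))).
      apply Rmult_le_reg_l with t; [lra|]. rewrite Rmult_0_r.
      rewrite (is_derive_unique _ _ _ (DR t ltac:(lra))), (is_derive_unique _ _ _ (DI t ltac:(lra))).
      destruct (quo_re_derive t ltac:(lra)) as [_ WR]. destruct (quo_im_derive t ltac:(lra)) as [_ WI].
      pose proof (bes_re_rec 0 t) as R0. pose proof (bes_im_rec 0 t) as I0. simpl INR in R0, I0.
      assert (XR : t * (bes_re k 1 t - (Derive quo_re t * bes_re k 1 t + quo_re t * bes_re k 2 t - Derive quo_im t * bes_im k 1 t - quo_im t * bes_im k 2 t))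
                = - (quo_re t * eR t - quo_im t * eI t)).
      { transitivity (t * bes_re k 1 t - (t * Derive quo_re t * bes_re k 1 t + quo_re t * (t * bes_re k 2 t) - t * Derive quo_im t * bes_im k 1 t - quo_im t * (t * bes_im k 2 t))); [ring|].
        rewrite WR, WI. replace (t * bes_re k 2 t) with (bes_re k 0 t - bes_re k 1 t + k * bes_im k 1 t) by lra.
        replace (t * bes_im k 2 t) with (bes_im k 0 t - bes_im k 1 t - k * bes_re k 1 t) by lra. unfold eR, eI. ring. }
      assert (XI : t * (bes_im k 1 t - (Derive quo_re t * bes_im k 1 t + quo_re t * bes_im k 2 t + Derive quo_im t * bes_re k 1 t + quo_im t * bes_re k 2 t))
                = - (quo_re t * eI t + quo_im t * eR t)).
      { transitivity (t * bes_im k 1 t - (t * Derive quo_re t * bes_im k 1 t + quo_re t * (t * bes_im k 2 t) + t * Derive quo_im t * bes_re k 1 t + quo_im t * (t * bes_re k 2 t))); [ring|].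
        rewrite WR, WI. replace (t * bes_re k 2 t) with (bes_re k 0 t - bes_re k 1 t + k * bes_im k 1 t) by lra.
        replace (t * bes_im k 2 t) with (bes_im k 0 t - bes_im k 1 t - k * bes_re k 1 t) by lra. unfold eR, eI. ring. }
      match goal with |- 0 <= t * (-2 * (eR t * ?x + eI t * ?y)) =>
        replace (t * (-2 * (eR t * x + eI t * y))) with (-2 * (eR t * (t * x) + eI t * (t * y))) by ring end.
      rewrite XR, XI.
      replace (-2 * (eR t * - (quo_re t * eR t - quo_im t * eI t) + eI t * - (quo_re t * eI t + quo_im t * eR t)))
        with (2 * quo_re t * (eR t ^ 2 + eI t ^ 2)) by ring.
      pose proof (quo_re_ge_1 t ltac:(lra)). nra. }
  assert (eR s = 0) by nra. assert (eI s = 0) by nra. unfold eR, eI in *. lra.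
Qed.

(** [s (|B_1|^2)' = 2 (Re w - 1) |B_1|^2 >= 0], so [|B_1|^2] stays above its value at 0. *)
Lemma bes_1_norm_pos s : 0 <= s -> 0 < bes_re k 1 s ^ 2 + bes_im k 1 s ^ 2.
Proof.
  intros Hs.
  set (F := fun s => bes_re k 1 s ^ 2 + bes_im k 1 s ^ 2 - / (1 + k ^ 2)).
  assert (DF : forall t, is_derive F t (2 * (bes_re k 1 t * bes_re k 2 t + bes_im k 1 t * bes_im k 2 t))).
  { intros t. unfold F. auto_derive.
    - repeat split; [eexists; apply bes_re_is_derive|eexists; apply bes_im_is_derive].
    - change (fun x => bes_re k 1 x) with (bes_re k 1). change (fun x => bes_im k 1 x) with (bes_im k 1).
      rewrite (is_derive_unique _ _ _ (bes_re_is_derive 1 t)), (is_derive_unique _ _ _ (bes_im_is_derive 1 t)). ring. }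
  assert (H : 0 <= F s).
  { apply (nonneg_barrier F s Hs).
    - intros t Ht. eexists; apply DF.
    - unfold F. destruct bes_1_at_0 as [-> ->]. right. field. nra.
    - intros t Ht _. rewrite (is_derive_unique _ _ _ (DF t)).
      apply Rmult_le_reg_l with t; [lra|]. rewrite Rmult_0_r.
      pose proof (bes_re_rec 0 t) as R0. pose proof (bes_im_rec 0 t) as I0. simpl INR in R0, I0.
      destruct (bes_re_im_quotient t ltac:(lra)) as [Q1 Q2].
      replace (t * (2 * (bes_re k 1 t * bes_re k 2 t + bes_im k 1 t * bes_im k 2 t)))
        with (2 * (bes_re k 1 t * (t * bes_re k 2 t) + bes_im k 1 t * (t * bes_im k 2 t))) by ring.
      replace (t * bes_re k 2 t) with (bes_re k 0 t - bes_re k 1 t + k * bes_im k 1 t) by lra.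
      replace (t * bes_im k 2 t) with (bes_im k 0 t - bes_im k 1 t - k * bes_re k 1 t) by lra.
      rewrite Q1, Q2.
      match goal with |- 0 <= ?x => replace x with (2 * (quo_re t - 1) * (bes_re k 1 t ^ 2 + bes_im k 1 t ^ 2)) by ring end.
      pose proof (quo_re_ge_1 t ltac:(lra)). apply Rmult_le_pos; nra. }
  assert (0 < / (1 + k ^ 2)) by (apply Rinv_0_lt_compat; nra).
  unfold F in H. lra.
Qed.
End BesselQuotient.

(** * The minimal solution of the moment recurrence *)

Lemma Cmult_eq_reg_l (c x y : C) : c <> 0%C -> (c * x = c * y)%C -> x = y.
Proof.
  intros Hc E. rewrite <- (Cmult_1_l x), <- (Cmult_1_l y), <- (Cinv_l c Hc), <- !Cmult_assoc.
  now rewrite E.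
Qed.

(** The Casoratian [a n * b (S n) - a (S n) * b n] only changes sign from one index to the next.  It tends
    to 0 because [a] is bounded and [b] tends to 0. *)
Lemma minimal_solution (nu : nat -> C) (h : R) (a b : nat -> C) (M : R) :
  h <> 0 ->
  (forall n, (nu n * a (S n) + RtoC h * (a (S (S n)) - a n) = 0)%C) ->
  (forall n, (nu n * b (S n) + RtoC h * (b (S (S n)) - b n) = 0)%C) ->
  (forall n, Cmod (a n) <= M) ->
  is_lim_seq (fun n => Cmod (b n)) 0 ->
  (a 1%nat * b 0%nat = a 0%nat * b 1%nat)%C.
Proof.
  intros Hh Ra Rb Ba Lb.
  set (cas := fun n => (a n * b (S n) - a (S n) * b n)%C).
  assert (Hc : RtoC h <> 0%C) by (intros E; injection E; lra).
  assert (step : forall n, cas (S n) = (- cas n)%C).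
  { intros n. apply Cmult_eq_reg_l with (RtoC h); [exact Hc|].
    unfold cas.
    transitivity (a (S n) * (RtoC h * (b (S (S n)) - b n)) - b (S n) * (RtoC h * (a (S (S n)) - a n))
       + RtoC h * (a (S n) * b n - a n * b (S n)))%C; [ring|].
    replace (RtoC h * (b (S (S n)) - b n))%C with (- (nu n * b (S n)))%C
      by (rewrite <- (Cplus_0_r (- _)), <- (Rb n); ring).
    replace (RtoC h * (a (S (S n)) - a n))%C with (- (nu n * a (S n)))%C
      by (rewrite <- (Cplus_0_r (- _)), <- (Ra n); ring).
    ring. }
  assert (cst : forall n, Cmod (cas n) = Cmod (cas 0%nat)).
  { induction n as [|n IH]; [reflexivity|]. now rewrite step, Cmod_opp. }
  assert (Z : Cmod (cas 0%nat) <= 0).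
  { apply (is_lim_seq_le (fun _ => Cmod (cas 0%nat))
       (fun n => M * Cmod (b (S n)) + M * Cmod (b n)) (Cmod (cas 0%nat)) 0).
    - intros n. rewrite <- (cst n). unfold cas, Cminus.
      eapply Rle_trans; [apply Cmod_triangle|]. rewrite Cmod_opp, !Cmod_mult.
      apply Rplus_le_compat; (apply Rmult_le_compat_r; [apply Cmod_ge_0|apply Ba]).
    - apply is_lim_seq_const.
    - replace (Finite 0) with (Finite (M * 0 + M * 0)) by (f_equal; ring).
      apply is_lim_seq_plus'; apply (is_lim_seq_scal_l _ M (Finite 0)); [|exact Lb].
      apply is_lim_seq_incr_1 in Lb. exact Lb. }
  assert (E : cas 0%nat = 0%C) by (apply Cmod_eq_0; pose proof (Cmod_ge_0 (cas 0%nat)); lra).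
  unfold cas in E. symmetry. rewrite <- (Cplus_0_r (a 1%nat * _)), <- E. ring.
Qed.

Definition bessel_solution (k h : R) (n : nat) : C := (h ^ n * bes_re k n (h ^ 2), h ^ n * bes_im k n (h ^ 2)).

Lemma bessel_solution_rec k h n :
  (((INR n + 1)%R, k) * bessel_solution k h (S n) + RtoC h * (bessel_solution k h (S (S n)) - bessel_solution k h n) = 0)%C.
Proof.
  unfold bessel_solution. rewrite (bes_re_rec k n), (bes_im_rec k n).
  apply injective_projections; unfold Cminus, Copp, Cmult, Cplus, RtoC, fst, snd; simpl; ring.
Qed.

(** [|h|^n / n!] tends to 0. *)
Lemma bessel_solution_lim k h : is_lim_seq (fun n => Cmod (bessel_solution k h n)) 0.
Proof.
  apply is_lim_seq_le_le with (fun _ => 0) (fun n => 2 * exp (h ^ 2) * (Rabs h ^ n / INR (fact n))).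
  - intros n. split; [apply Cmod_ge_0|].
    eapply Rle_trans; [apply Cmod_2Rmax|].
    assert (Hs : sqrt 2 <= 2).
    { rewrite <- (sqrt_square 2) at 2 by lra. apply sqrt_le_1; lra. }
    pose proof (INR_fact_lt_0 n) as Hf.
    assert (Hh : Rabs (h ^ 2) = h ^ 2) by (apply Rabs_pos_eq, pow2_ge_0).
    assert (X : forall y, Rabs y <= / INR (fact n) * exp (Rabs (h ^ 2)) ->
              Rabs (h ^ n * y) <= exp (h ^ 2) * (Rabs h ^ n / INR (fact n))).
    { intros y Hy. rewrite Rabs_mult, <- RPow_abs, Hh in *.
      replace (exp (h ^ 2) * (Rabs h ^ n / INR (fact n))) with (Rabs h ^ n * (/ INR (fact n) * exp (h ^ 2)))
        by (field; lra).
      apply Rmult_le_compat_l; [apply pow_le, Rabs_pos|exact Hy]. }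
    rewrite (Rmult_assoc 2). apply Rmult_le_compat; [apply sqrt_pos| |exact Hs|].
    + eapply Rle_trans; [apply Rabs_pos|apply Rmax_l].
    + unfold bessel_solution, fst, snd. apply Rmax_lub; apply X; [apply bes_re_bound|apply bes_im_bound].
  - apply is_lim_seq_const.
  - replace (Finite 0) with (Rbar_mult (2 * exp (h ^ 2)) (Finite 0)) by (simpl; f_equal; ring).
    apply is_lim_seq_scal_l. apply is_lim_seq_Reals. apply cv_speed_pow_fact.
Qed.

(** * Fourier coefficients of the profile equation *)

(** The profile equation in the frame where the mean field is [r * sin]. *)
Definition circle_ode (k r c : R) (f : R -> R) : Prop :=
  periodic f /\ forall x, is_derive f x (c - (r * sin x + k) * f x).

Definition cos_moment (f : R -> R) (n : nat) : R := RInt (fun x => f x * cos (INR n * x)) 0 (2 * PI).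
Definition sin_moment (f : R -> R) (n : nat) : R := RInt (fun x => f x * sin (INR n * x)) 0 (2 * PI).

Lemma ex_RInt_cont (f : R -> R) a b : (forall x, continuous f x) -> ex_RInt f a b.
Proof. intros H. apply (ex_RInt_continuous (V := R_CompleteNormedModule)). intros; apply H. Qed.

Lemma is_RInt_lin2 (f g : R -> R) a b u v x y :
  is_RInt f a b u -> is_RInt g a b v -> is_RInt (fun t => x * f t + y * g t) a b (x * u + y * v).
Proof.
  intros Hf Hg. apply (is_RInt_plus (V := R_NormedModule)); apply (is_RInt_scal (V := R_NormedModule)); assumption.
Qed.

Lemma continuous_derivable (f : R -> R) x : ex_derive f x -> continuous f x.
Proof. apply (@ex_derive_continuous R_AbsRing R_NormedModule). Qed.

Lemma continuous_mul (f g : R -> R) x : continuous f x -> continuous g x -> continuous (fun t => f t * g t) x.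
Proof. intros. now apply (continuous_mult f g). Qed.

Lemma continuous_cos_lin a x : continuous (fun t => cos (a * t)) x.
Proof. apply continuous_derivable. now auto_derive. Qed.
Lemma continuous_sin_lin a x : continuous (fun t => sin (a * t)) x.
Proof. apply continuous_derivable. now auto_derive. Qed.

Lemma sin_turns n : sin (INR n * (2 * PI)) = 0.
Proof. replace (INR n * (2 * PI)) with (0 + 2 * INR n * PI) by ring. now rewrite sin_period, sin_0. Qed.
Lemma cos_turns n : cos (INR n * (2 * PI)) = 1.
Proof. replace (INR n * (2 * PI)) with (0 + 2 * INR n * PI) by ring. now rewrite cos_period, cos_0. Qed.

Lemma is_cos_moment f n : (forall x, continuous f x) ->
  is_RInt (fun x => f x * cos (INR n * x)) 0 (2 * PI) (cos_moment f n).
Proof.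
  intros H. apply (RInt_correct (V := R_CompleteNormedModule)), ex_RInt_cont.
  intros x. apply continuous_mul; [apply H|apply continuous_cos_lin].
Qed.
Lemma is_sin_moment f n : (forall x, continuous f x) ->
  is_RInt (fun x => f x * sin (INR n * x)) 0 (2 * PI) (sin_moment f n).
Proof.
  intros H. apply (RInt_correct (V := R_CompleteNormedModule)), ex_RInt_cont.
  intros x. apply continuous_mul; [apply H|apply continuous_sin_lin].
Qed.

Lemma is_RInt_deriv (F dF : R -> R) a b :
  (forall x, is_derive F x (dF x)) -> (forall x, continuous dF x) -> is_RInt dF a b (F b - F a).
Proof.
  intros D C. apply (is_RInt_derive F dF); intros; auto.
Qed.

Section Circle.
Context (k r c : R) (f : R -> R) (Hf : circle_ode k r c f).

Lemma circle_ode_continuous x : continuous f x.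
Proof. apply continuous_derivable. eexists. apply Hf. Qed.

Lemma periodic_0 : f (2 * PI) = f 0.
Proof. rewrite <- (Rplus_0_l (2 * PI)). apply Hf. Qed.

(** Integrate the derivative of [f x * cos (N x)] and of [f x * sin (N x)], [N = n + 1], over a period; the
    constant [c] contributes nothing to a nonzero Fourier mode. *)
Lemma moment_rec n :
  (((INR n + 1)%R, k) * (cos_moment f (S n), sin_moment f (S n)) +
   RtoC (r / 2) * ((cos_moment f (S (S n)), sin_moment f (S (S n))) - (cos_moment f n, sin_moment f n)) = 0)%C.
Proof.
  set (N := INR n + 1).
  assert (HN : N <> 0) by (pose proof (pos_INR n); unfold N; lra).
  assert (E1 : INR (S n) = N) by apply S_INR.
  assert (E2 : INR (S (S n)) = N + 1) by now rewrite S_INR, E1.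
  assert (E0 : INR n = N - 1) by (unfold N; ring).
  pose proof circle_ode_continuous as Hc.
  pose proof (is_cos_moment f n Hc) as C0. pose proof (is_cos_moment f (S n) Hc) as C1.
  pose proof (is_cos_moment f (S (S n)) Hc) as C2.
  pose proof (is_sin_moment f n Hc) as S0. pose proof (is_sin_moment f (S n) Hc) as S1.
  pose proof (is_sin_moment f (S (S n)) Hc) as S2.
  assert (Cc : forall n x, continuous (fun x => f x * cos (INR n * x)) x)
    by (intros; apply continuous_mul; [apply Hc|apply continuous_cos_lin]).
  assert (Cs : forall n x, continuous (fun x => f x * sin (INR n * x)) x)
    by (intros; apply continuous_mul; [apply Hc|apply continuous_sin_lin]).
  assert (lin : forall (g h : R -> R) a b x, continuous g x -> continuous h x ->
     continuous (fun t => a * g t + b * h t) x).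
  { intros. apply (continuous_plus (fun t => a * g t) (fun t => b * h t));
      apply continuous_mul; auto; apply continuous_const. }
  assert (F1 : is_RInt (fun x => 1 * (- (r / 2) * (f x * sin (INR (S (S n)) * x)) + (r / 2) * (f x * sin (INR n * x)))
                 + 1 * (- k * (f x * cos (INR (S n) * x)) + - N * (f x * sin (INR (S n) * x)))) 0 (2 * PI)
       ((f (2 * PI) * cos (N * (2 * PI)) - c * (sin (N * (2 * PI)) / N)) -
         (f 0 * cos (N * 0) - c * (sin (N * 0) / N)))).
  { apply (is_RInt_deriv (fun x => f x * cos (N * x) - c * (sin (N * x) / N))).
    - intros x.
      assert (D := proj2 Hf x).
      auto_derive; [eexists; exact D|].
      change (fun x => f x) with f. rewrite (is_derive_unique _ _ _ D).
      rewrite E2, E0, E1. replace ((N + 1) * x) with (N * x + x) by ring.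
      replace ((N - 1) * x) with (N * x - x) by ring. rewrite sin_plus, sin_minus. field. exact HN.
    - intros x. apply (lin (fun x => - (r / 2) * (f x * sin (INR (S (S n)) * x)) + (r / 2) * (f x * sin (INR n * x)))
         (fun x => - k * (f x * cos (INR (S n) * x)) + - N * (f x * sin (INR (S n) * x))));
       [apply (lin (fun x => f x * sin (INR (S (S n)) * x)) (fun x => f x * sin (INR n * x)))|
        apply (lin (fun x => f x * cos (INR (S n) * x)) (fun x => f x * sin (INR (S n) * x)))]; auto. }
  assert (F2 : is_RInt (fun x => 1 * ((r / 2) * (f x * cos (INR (S (S n)) * x)) + - (r / 2) * (f x * cos (INR n * x)))
                 + 1 * (- k * (f x * sin (INR (S n) * x)) + N * (f x * cos (INR (S n) * x)))) 0 (2 * PI)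
       ((f (2 * PI) * sin (N * (2 * PI)) + c * (cos (N * (2 * PI)) / N)) -
         (f 0 * sin (N * 0) + c * (cos (N * 0) / N)))).
  { apply (is_RInt_deriv (fun x => f x * sin (N * x) + c * (cos (N * x) / N))).
    - intros x.
      assert (D := proj2 Hf x).
      auto_derive; [eexists; exact D|].
      change (fun x => f x) with f. rewrite (is_derive_unique _ _ _ D).
      rewrite E2, E0, E1. replace ((N + 1) * x) with (N * x + x) by ring.
      replace ((N - 1) * x) with (N * x - x) by ring. rewrite cos_plus, cos_minus. field. exact HN.
    - intros x. apply (lin (fun x => (r / 2) * (f x * cos (INR (S (S n)) * x)) + - (r / 2) * (f x * cos (INR n * x)))
         (fun x => - k * (f x * sin (INR (S n) * x)) + N * (f x * cos (INR (S n) * x))));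
       [apply (lin (fun x => f x * cos (INR (S (S n)) * x)) (fun x => f x * cos (INR n * x)))|
        apply (lin (fun x => f x * sin (INR (S n) * x)) (fun x => f x * cos (INR (S n) * x)))]; auto. }
  apply (is_RInt_unique (V := R_CompleteNormedModule)) in F1.
  apply (is_RInt_unique (V := R_CompleteNormedModule)) in F2.
  rewrite (is_RInt_unique (V := R_CompleteNormedModule) _ _ _ _
     (is_RInt_lin2 _ _ _ _ _ _ 1 1 (is_RInt_lin2 _ _ _ _ _ _ (- (r / 2)) (r / 2) S2 S0)
                                    (is_RInt_lin2 _ _ _ _ _ _ (- k) (- N) C1 S1))) in F1.
  rewrite (is_RInt_unique (V := R_CompleteNormedModule) _ _ _ _
     (is_RInt_lin2 _ _ _ _ _ _ 1 1 (is_RInt_lin2 _ _ _ _ _ _ (r / 2) (- (r / 2)) C2 C0)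
                                    (is_RInt_lin2 _ _ _ _ _ _ (- k) N S1 C1))) in F2.
  rewrite periodic_0, <- E1, Rmult_0_r, sin_turns, cos_turns, sin_0, cos_0, E1 in F1, F2.
  apply injective_projections; unfold Cminus, Copp, Cmult, Cplus, RtoC, fst, snd; lra.
Qed.

Lemma moment_bounded n :
  Cmod (cos_moment f n, sin_moment f n) <= 2 * RInt (fun x => Rabs (f x)) 0 (2 * PI).
Proof.
  pose proof circle_ode_continuous as Hc. pose proof PI_RGT_0 as HP.
  assert (Ca : forall g : R -> R, (forall x, continuous g x) -> forall x, continuous (fun x => Rabs (g x)) x).
  { intros g Hg x. apply (continuous_comp g Rabs); [apply Hg|apply continuous_Rabs]. }
  assert (X : forall g : R -> R, (forall x, continuous g x) -> (forall x, Rabs (g x) <= 1) ->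
     Rabs (RInt (fun x => f x * g x) 0 (2 * PI)) <= RInt (fun x => Rabs (f x)) 0 (2 * PI)).
  { intros g Hg Bg. eapply Rle_trans; [apply abs_RInt_le; [lra|]|].
    - apply ex_RInt_cont. intros; now apply continuous_mul.
    - apply RInt_le; [lra| | |].
      + apply ex_RInt_cont, (Ca (fun x => f x * g x)). intros; now apply continuous_mul.
      + apply ex_RInt_cont, Ca, Hc.
      + intros x _. rewrite Rabs_mult. rewrite <- (Rmult_1_r (Rabs (f x))) at 2.
        apply Rmult_le_compat_l; [apply Rabs_pos|apply Bg]. }
  eapply Rle_trans; [apply Cmod_2Rmax|].
  assert (Hs : sqrt 2 <= 2).
  { rewrite <- (sqrt_square 2) at 2 by lra. apply sqrt_le_1; lra. }
  apply Rmult_le_compat; [apply sqrt_pos| |exact Hs|].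
  - eapply Rle_trans; [apply Rabs_pos|apply Rmax_l].
  - apply Rmax_lub; apply X.
    + intros; apply continuous_cos_lin.
    + intros; apply Rabs_le, COS_bound.
    + intros; apply continuous_sin_lin.
    + intros; apply Rabs_le, SIN_bound.
Qed.

(** The real form of [a_1 w = (r / 2) a_0], where [a_n] is the Fourier coefficient
    [cos_moment f n + i sin_moment f n]. *)
Lemma first_moment_law : 0 < r ->
  cos_moment f 1 * quo_re k ((r / 2) ^ 2) - sin_moment f 1 * quo_im k ((r / 2) ^ 2) = r / 2 * cos_moment f 0 /\
  cos_moment f 1 * quo_im k ((r / 2) ^ 2) + sin_moment f 1 * quo_re k ((r / 2) ^ 2) = 0.
Proof.
  intros Hr. set (s := (r / 2) ^ 2). assert (Hs : 0 <= s) by apply pow2_ge_0.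
  pose proof (minimal_solution (fun n => ((INR n + 1)%R, k)) (r / 2)
    (fun n => (cos_moment f n, sin_moment f n)) (bessel_solution k (r / 2)) _ ltac:(lra)
    moment_rec (bessel_solution_rec k (r / 2)) moment_bounded (bessel_solution_lim k (r / 2))) as E.
  assert (S0 : sin_moment f 0 = 0).
  { unfold sin_moment. rewrite (RInt_ext _ (fun _ => 0)).
    - rewrite RInt_const. unfold scal; simpl. unfold mult; simpl. ring.
    - intros. simpl INR. rewrite Rmult_0_l, sin_0. apply Rmult_0_r. }
  unfold bessel_solution in E. fold s in E.
  apply (f_equal (fun z => (Re z, Im z))) in E. unfold Re, Im, Cmult, fst, snd in E.
  rewrite S0 in E. injection E as E1 E2.
  destruct (bes_re_im_quotient k s Hs) as [Q1 Q2]. rewrite Q1, Q2 in E1, E2.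
  pose proof (bes_1_norm_pos k s Hs) as NZ.
  set (x := cos_moment f 1) in *. set (y := sin_moment f 1) in *. set (m := cos_moment f 0) in *.
  set (p := bes_re k 1 s) in *. set (q := bes_im k 1 s) in *.
  set (u := x * quo_re k s - y * quo_im k s - r / 2 * m). set (v := x * quo_im k s + y * quo_re k s).
  assert (A1 : u * p - v * q = 0) by (unfold u, v; lra).
  assert (A2 : u * q + v * p = 0) by (unfold u, v; lra).
  assert (u * (p ^ 2 + q ^ 2) = 0).
  { transitivity (p * (u * p - v * q) + q * (u * q + v * p)); [ring|]. rewrite A1, A2. ring. }
  assert (v * (p ^ 2 + q ^ 2) = 0).
  { transitivity (p * (u * q + v * p) - q * (u * p - v * q)); [ring|]. rewrite A1, A2. ring. }
  assert (u = 0) by (apply Rmult_eq_reg_r with (p ^ 2 + q ^ 2); lra).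
  assert (v = 0) by (apply Rmult_eq_reg_r with (p ^ 2 + q ^ 2); lra).
  unfold u, v in *. lra.
Qed.
End Circle.

(** * The Euler limit for the Gamma function *)

Definition cis (t : R) : C := (cos t, sin t).

Lemma cis_plus a b : cis (a + b) = (cis a * cis b)%C.
Proof.
  unfold cis. rewrite cos_plus, sin_plus.
  apply injective_projections; unfold Cmult, fst, snd; ring.
Qed.

Lemma cis_neq_0 t : cis t <> 0%C.
Proof.
  intros H. injection H as H1 H2. pose proof (sin2_cos2 t) as E. unfold Rsqr in E. nra.
Qed.

Lemma RtoC_neq_0 x : x <> 0 -> RtoC x <> 0%C.
Proof. intros H E. now injection E. Qed.

Lemma cis_opp t : cis (- t) = (/ cis t)%C.
Proof.
  apply Cmult_eq_reg_l with (cis t); [apply cis_neq_0|].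
  rewrite <- cis_plus, Cinv_r by apply cis_neq_0.
  unfold cis. now rewrite Rplus_opp_r, cos_0, sin_0.
Qed.

Lemma polar_right_half x y : 0 < x -> (x, y) = (RtoC (Cmod (x, y)) * cis (atan (y / x)))%C.
Proof.
  intros Hx. unfold cis.
  set (t := atan (y / x)).
  assert (Hc : 0 < cos t) by (pose proof (atan_bound (y / x)); apply cos_gt_0; unfold t; lra).
  assert (Ht : sin t = y / x * cos t).
  { replace (y / x) with (tan t) by apply tan_atan. unfold tan. field. lra. }
  assert (E : Cmod (x, y) * cos t = x).
  { unfold Cmod. simpl fst. simpl snd.
    replace (x ^ 2 + y ^ 2) with ((x / cos t) ^ 2).
    - rewrite sqrt_pow2; [field; lra|]. apply Rlt_le, Rdiv_lt_0_compat; lra.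
    - pose proof (sin2_cos2 t) as E. unfold Rsqr in E. rewrite Ht in E.
      replace (x ^ 2 + y ^ 2) with (x ^ 2 / cos t ^ 2 * (y / x * cos t * (y / x * cos t) + cos t * cos t))
        by (field; lra).
      rewrite E. field; lra. }
  apply injective_projections; unfold Cmult, RtoC, fst, snd.
  - lra.
  - rewrite Ht. transitivity (y / x * (Cmod (x, y) * cos t)); [|ring]. rewrite E. field; lra.
Qed.

Definition euler_seq (z : C) (n : nat) : C :=
  (RtoC (INR (fact n)) * RCpower (INR n) z / Crising z (S n))%C.

(** The index is shifted by one since [RCpower 0 z] is not given by the exponential. *)
Definition euler_limit (z g : C) : Prop :=
  is_lim_seq (fun n => Re (euler_seq z (S n))) (Re g) /\
  is_lim_seq (fun n => Im (euler_seq z (S n))) (Im g).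

Lemma CGamma_limit z g : euler_limit z g -> CGamma z = g.
Proof.
  intros [HR HI].
  apply (is_lim_seq_incr_1 (fun n => Re (euler_seq z n))), is_lim_seq_unique in HR.
  apply (is_lim_seq_incr_1 (fun n => Im (euler_seq z n))), is_lim_seq_unique in HI.
  change (CGamma z) with (real (Lim_seq (fun n => Re (euler_seq z n))), real (Lim_seq (fun n => Im (euler_seq z n)))).
  rewrite HR, HI. now destruct g.
Qed.

Lemma RCpower_pos x a b : 0 < x -> RCpower x (a, b) = (RtoC (exp (a * ln x)) * cis (b * ln x))%C.
Proof.
  intros Hx. unfold RCpower. destruct (Req_EM_T x 0); [lra|].
  destruct (Rlt_dec x 0); [lra|]. rewrite Rabs_pos_eq by lra.
  unfold Cexp, cis. apply injective_projections; unfold Cmult, RtoC, Re, Im, fst, snd.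
  - replace (a * ln x - b * 0) with (a * ln x) by ring. replace (a * 0 + b * ln x) with (b * ln x) by ring. ring.
  - replace (a * ln x - b * 0) with (a * ln x) by ring. replace (a * 0 + b * ln x) with (b * ln x) by ring. ring.
Qed.

Lemma is_lim_seq_Cmult (a b : nat -> C) (u v : C) :
  is_lim_seq (fun n => Re (a n)) (Re u) -> is_lim_seq (fun n => Im (a n)) (Im u) ->
  is_lim_seq (fun n => Re (b n)) (Re v) -> is_lim_seq (fun n => Im (b n)) (Im v) ->
  is_lim_seq (fun n => Re (a n * b n)%C) (Re (u * v)%C) /\
  is_lim_seq (fun n => Im (a n * b n)%C) (Im (u * v)%C).
Proof.
  intros A1 A2 B1 B2. unfold Cmult, Re, Im in *. simpl in *. split.
  - apply is_lim_seq_minus'; now apply is_lim_seq_mult'.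
  - apply is_lim_seq_plus'; now apply is_lim_seq_mult'.
Qed.

Lemma Crising_shift z n : (z * Crising (z + 1) n = Crising z (S n))%C.
Proof.
  induction n as [|n IH]; [simpl; apply injective_projections; simpl; ring|].
  change (Crising (z + 1) (S n)) with (Crising (z + 1) n * (z + 1 + RtoC (INR n)))%C.
  rewrite Cmult_assoc, IH.
  change (Crising z (S (S n))) with (Crising z (S n) * (z + RtoC (INR (S n))))%C.
  f_equal. rewrite S_INR, RtoC_plus. ring.
Qed.

Lemma Crising_neq_0_right x y n : 0 < x -> Crising (x, y) n <> 0%C.
Proof.
  intros Hx. induction n as [|n IH]; simpl.
  - intros E. injection E. lra.
  - apply Cmult_neq_0; [exact IH|]. intros E. injection E as E1 E2. pose proof (pos_INR n). lra.
Qed.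

(** [Gamma (z + 1) = z Gamma (z)]: the two Euler sequences differ by the factor [z (n + 1) / (z + n + 2)],
    whose limit is [z]. *)
Lemma euler_limit_succ x y g : 0 < x ->
  euler_limit (x, y) g -> euler_limit (x + 1, y) ((x, y) * g)%C.
Proof.
  intros Hx [HR HI].
  (* [w n] is [(n + 1) / (z + n + 2)], written by real and imaginary part. *)
  set (d := fun n => x + 2 + INR n).
  assert (Hd : forall n, 0 < d n) by (intros n; unfold d; pose proof (pos_INR n); lra).
  set (w := fun n => ((INR n + 1) * d n / (d n ^ 2 + y ^ 2), - ((INR n + 1) * y) / (d n ^ 2 + y ^ 2))).
  assert (E : forall n, euler_seq (x + 1, y) (S n) = ((x, y) * (euler_seq (x, y) (S n) * w n))%C).
  { intros n. pose proof (pos_INR n) as Hn. specialize (Hd n).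
    unfold euler_seq. assert (HS : 0 < INR (S n)) by (rewrite S_INR; lra).
    rewrite !RCpower_pos by exact HS.
    assert (Hz : (x, y) <> RtoC 0) by (intros H; apply (f_equal fst) in H; simpl in H; lra).
    assert (Hz1 : ((x + 1)%R, y) = ((x, y) + RtoC 1)%C) by (apply injective_projections; simpl; ring).
    assert (A : (w n = RtoC (INR (S n)) / (d n, y))%C).
    { unfold w. rewrite S_INR. apply injective_projections; unfold Cdiv, Cmult, Cinv, RtoC, fst, snd; field; nra. }
    assert (Hdn : (d n, y) <> RtoC 0) by (intros H; apply (f_equal fst) in H; simpl in H; lra).
    assert (B : ((x, y) * Crising ((x + 1)%R, y) (S (S n)) = Crising (x, y) (S (S n)) * (d n, y))%C).
    { rewrite Hz1, Crising_shift. change (Crising (x, y) (S (S (S n)))) with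
        (Crising (x, y) (S (S n)) * ((x, y) + RtoC (INR (S (S n)))))%C. f_equal.
      apply injective_projections; unfold d, Cplus, RtoC, fst, snd; rewrite ?S_INR; ring. }
    rewrite A.
    assert (X : exp ((x + 1) * ln (INR (S n))) = exp (x * ln (INR (S n))) * INR (S n)).
    { rewrite Rmult_plus_distr_r, exp_plus, Rmult_1_l, exp_ln by exact HS. reflexivity. }
    rewrite X, RtoC_mult.
    pose proof (Crising_neq_0_right x y (S (S n)) Hx) as N1.
    pose proof (Crising_neq_0_right (x + 1) y (S (S n)) ltac:(lra)) as N2.
    apply Cmult_eq_reg_l with (Crising (x + 1, y) (S (S n))); [exact N2|].
    apply Cmult_eq_reg_l with (Crising (x, y) (S (S n)) * (d n, y))%C; [now apply Cmult_neq_0|].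
    set (f := RtoC (INR (fact (S n)))) in *. set (e := RtoC (exp (x * ln (INR (S n))))) in *.
    set (m := RtoC (INR (S n))) in *. set (cc := cis (y * ln (INR (S n)))) in *.
    transitivity ((Crising (x, y) (S (S n)) * (d n, y)) * (f * (e * m * cc)))%C;
      [field; exact N2|].
    rewrite <- B at 1.
    transitivity ((x, y) * Crising ((x + 1)%R, y) (S (S n)) * (f * (e * m * cc)))%C; [reflexivity|].
    field. auto. }
  assert (L : is_lim_seq (fun n => Re (w n)) (Re 1%C) /\ is_lim_seq (fun n => Im (w n)) (Im 1%C)).
  { pose proof is_lim_seq_inv_succ as L0.
    assert (Hn : forall n, 0 < INR n + 1) by (intros n; pose proof (pos_INR n); lra).
    assert (LD : is_lim_seq (fun n => 1 + (x + 1) * / (INR n + 1)) (1 + (x + 1) * 0)).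
    { apply is_lim_seq_plus'; [apply is_lim_seq_const|]. now apply (is_lim_seq_scal_l _ (x + 1) (Finite 0)). }
    assert (LY : is_lim_seq (fun n => y * / (INR n + 1)) (y * 0))
      by now apply (is_lim_seq_scal_l _ y (Finite 0)).
    assert (LQ : is_lim_seq (fun n => (1 + (x + 1) * / (INR n + 1)) * (1 + (x + 1) * / (INR n + 1))
        + (y * / (INR n + 1)) * (y * / (INR n + 1)))
        ((1 + (x + 1) * 0) * (1 + (x + 1) * 0) + (y * 0) * (y * 0))).
    { apply is_lim_seq_plus'; now apply is_lim_seq_mult'. }
    assert (LN : is_lim_seq (fun n => -1 * (y * / (INR n + 1))) (-1 * (y * 0)))
      by now apply (is_lim_seq_scal_l _ (-1) (Finite (y * 0))).
    split.
    - eapply is_lim_seq_ext; [|replace (Re 1%C) with ((1 + (x + 1) * 0) / ((1 + (x + 1) * 0) * (1 + (x + 1) * 0) + (y * 0) * (y * 0)))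
         by (simpl; field); apply (is_lim_seq_div' _ _ _ _ LD LQ); nra].
      intros n. specialize (Hn n). pose proof (Hd n). unfold w, Re, fst, d in *. field. split; nra.
    - eapply is_lim_seq_ext; [|replace (Im 1%C) with ((-1 * (y * 0)) / ((1 + (x + 1) * 0) * (1 + (x + 1) * 0) + (y * 0) * (y * 0)))
         by (simpl; field); apply (is_lim_seq_div' _ _ _ _ LN LQ); nra].
      intros n. specialize (Hn n). pose proof (Hd n). unfold w, Im, snd, d in *. field. split; nra. }
  destruct (is_lim_seq_Cmult _ _ g 1%C HR HI (proj1 L) (proj2 L)) as [P1 P2].
  destruct (is_lim_seq_Cmult (fun _ => (x, y)) _ (x, y) (g * 1)%C
     (is_lim_seq_const _) (is_lim_seq_const _) P1 P2) as [Q1 Q2].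
  rewrite Cmult_1_r in Q1, Q2. split; (eapply is_lim_seq_ext; [|eassumption]); intros n; now rewrite E.
Qed.

(** * Nonvanishing of Gamma on the line of real part 1 *)

Section EulerModulus.
Context (k : R).

(** The modulus of the Euler sequence at [1 + i k], up to a factor tending to 1. *)
Definition euler_mod (n : nat) : R := INR (fact (S n)) / Cmod (Crising (1, k) (S n)).

Lemma Cmod_fst_le x y : 0 <= x -> x <= Cmod (x, y).
Proof.
  intros Hx. eapply Rle_trans; [|apply Rmax_Cmod]. eapply Rle_trans; [|apply Rmax_l].
  simpl. apply Rle_abs.
Qed.

Lemma euler_mod_step n :
  euler_mod (S n) = euler_mod n * ((INR n + 2) / Cmod ((INR n + 2)%R, k)).
Proof.
  unfold euler_mod. pose proof (pos_INR n).
  change (Crising (1, k) (S (S n))) with (Crising (1, k) (S n) * ((1, k) + RtoC (INR (S n))))%C.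
  rewrite Cmod_mult, (fact_simpl (S n)), mult_INR, !S_INR.
  replace ((1, k) + RtoC (INR n + 1))%C with ((INR n + 2)%R, k)
    by (apply injective_projections; unfold Cplus, RtoC, fst, snd; ring).
  pose proof (Crising_neq_0 k (S n)) as N. apply Cmod_gt_0 in N.
  pose proof (Cmod_fst_le (INR n + 2) k ltac:(lra)).
  replace (INR n + 1 + 1) with (INR n + 2) by ring. field. split; lra.
Qed.

Lemma Cmod_right_le m : 0 < m -> Cmod (m, k) <= m * exp (k ^ 2 / m ^ 2).
Proof.
  intros Hm. unfold Cmod. simpl fst. simpl snd.
  assert (Hq : 0 <= k ^ 2 / m ^ 2) by (apply Rdiv_le_0_compat; nra).
  apply Rle_trans with (m * (1 + k ^ 2 / m ^ 2)).
  - rewrite <- (sqrt_pow2 (m * (1 + k ^ 2 / m ^ 2))) by (apply Rmult_le_pos; lra).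
    apply sqrt_le_1; [nra|apply pow2_ge_0|].
    replace (m ^ 2 + k ^ 2) with (m ^ 2 * (1 + k ^ 2 / m ^ 2)) by (field; lra).
    rewrite Rpow_mult_distr. apply Rmult_le_compat_l; nra.
  - apply Rmult_le_compat_l; [lra|]. apply exp_ineq1_le.
Qed.

(** Each factor is at least [exp (- k^2 / m^2)], and [1 / m^2 <= 1 / (m - 1) - 1 / m] telescopes. *)
Lemma euler_mod_lower n : exp (- k ^ 2 * (2 - / (INR n + 1))) <= euler_mod n.
Proof.
  induction n as [|n IH].
  - unfold euler_mod. simpl INR. simpl Crising.
    replace (1 * ((1, k) + 0))%C with (1, k) by (apply injective_projections; simpl; ring).
    pose proof (Cmod_right_le 1 ltac:(lra)) as H. pose proof (Cmod_fst_le 1 k ltac:(lra)).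
    replace (- k ^ 2 * (2 - / (0 + 1))) with (- (k ^ 2 / 1 ^ 2)) by field.
    rewrite exp_Ropp. unfold Rdiv. rewrite Rmult_1_l. apply Rinv_le_contravar; lra.
  - rewrite euler_mod_step, S_INR. pose proof (pos_INR n).
    set (m := INR n + 2). replace (INR n + 1 + 1) with m by (unfold m; ring).
    replace (INR n + 1) with (m - 1) in IH by (unfold m; ring).
    assert (Hm : 2 <= m) by (unfold m; lra).
    pose proof (Cmod_right_le m ltac:(lra)) as Hu. pose proof (Cmod_fst_le m k ltac:(lra)).
    apply Rle_trans with (exp (- k ^ 2 * (2 - / (m - 1))) * exp (- (k ^ 2 / m ^ 2))).
    + rewrite <- exp_plus.
      destruct (Rle_lt_or_eq_dec (- k ^ 2 * (2 - / m)) (- k ^ 2 * (2 - / (m - 1)) + - (k ^ 2 / m ^ 2))) as [L|L].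
      * assert (/ m ^ 2 <= / (m - 1) - / m).
        { replace (/ (m - 1) - / m) with (/ (m * (m - 1))) by (field; lra). apply Rinv_le_contravar; nra. }
        unfold Rdiv. nra.
      * now apply Rlt_le, exp_increasing.
      * rewrite L. lra.
    + apply Rmult_le_compat; [apply Rlt_le, exp_pos|apply Rlt_le, exp_pos|exact IH|].
      apply Rmult_le_reg_r with (Cmod (m, k)); [lra|].
      replace (m / Cmod (m, k) * Cmod (m, k)) with m by (field; lra).
      apply Rle_trans with (exp (- (k ^ 2 / m ^ 2)) * (m * exp (k ^ 2 / m ^ 2))).
      * apply Rmult_le_compat_l; [apply Rlt_le, exp_pos|exact Hu].
      * right. transitivity (m * (exp (- (k ^ 2 / m ^ 2)) * exp (k ^ 2 / m ^ 2))); [ring|].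
        rewrite <- exp_plus, Rplus_opp_l, exp_0. ring.
Qed.

Lemma euler_mod_limit : exists l, 0 < l /\ is_lim_seq euler_mod l.
Proof.
  assert (Lo : forall n, exp (- k ^ 2 * 2) <= euler_mod n).
  { intros n. eapply Rle_trans; [|apply euler_mod_lower].
    assert (0 < / (INR n + 1)) by (apply Rinv_0_lt_compat; pose proof (pos_INR n); lra).
    destruct (Rle_lt_or_eq_dec (- k ^ 2 * 2) (- k ^ 2 * (2 - / (INR n + 1)))) as [L|L]; [nra| |].
    - now apply Rlt_le, exp_increasing.
    - rewrite <- L. lra. }
  destruct (ex_finite_lim_seq_decr euler_mod (exp (- k ^ 2 * 2))) as [l Hl].
  - intros n. rewrite euler_mod_step. pose proof (pos_INR n).
    pose proof (Cmod_fst_le (INR n + 2) k ltac:(lra)) as H1.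
    rewrite <- (Rmult_1_r (euler_mod n)) at 2. apply Rmult_le_compat_l.
    + eapply Rle_trans; [|apply Lo]. apply Rlt_le, exp_pos.
    + apply Rmult_le_reg_r with (Cmod (INR n + 2, k)); [lra|].
      unfold Rdiv. rewrite Rmult_assoc, Rinv_l by lra. lra.
  - exact Lo.
  - exists l. split; [|exact Hl]. apply Rlt_le_trans with (exp (- k ^ 2 * 2)); [apply exp_pos|].
    apply (is_lim_seq_le (fun _ => exp (- k ^ 2 * 2)) euler_mod (exp (- k ^ 2 * 2)) l Lo); [apply is_lim_seq_const|exact Hl].
Qed.
End EulerModulus.

(** A continuous determination of the argument of [(1 + i k)_n]. *)
Fixpoint arg_sum (k : R) (n : nat) : R :=
  match n with O => 0 | S m => arg_sum k m + atan (k / INR (S m)) end.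

Definition euler_arg (k : R) (n : nat) : R := k * ln (INR (S n)) - arg_sum k (S (S n)).

Lemma Crising_polar k n : Crising (1, k) n = (RtoC (Cmod (Crising (1, k) n)) * cis (arg_sum k n))%C.
Proof.
  induction n as [|n IH].
  - simpl. rewrite Cmod_1. unfold cis. rewrite cos_0, sin_0. now rewrite Cmult_1_l.
  - change (Crising (1, k) (S n)) with (Crising (1, k) n * ((1, k) + RtoC (INR n)))%C.
    replace ((1, k) + RtoC (INR n))%C with (INR (S n), k)
      by (apply injective_projections; unfold Cplus, RtoC, fst, snd; rewrite ?S_INR; ring).
    rewrite Cmod_mult, RtoC_mult. change (arg_sum k (S n)) with (arg_sum k n + atan (k / INR (S n))).
    rewrite cis_plus, IH at 1.
    rewrite (polar_right_half (INR (S n)) k) at 1 by (rewrite S_INR; pose proof (pos_INR n); lra).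
    ring.
Qed.

Lemma atan_opp_div k m : atan (- k / m) = - atan (k / m).
Proof. rewrite <- atan_opp. f_equal. unfold Rdiv. ring. Qed.

Lemma euler_arg_opp k n : euler_arg (- k) n = - euler_arg k n.
Proof.
  assert (E : forall m, arg_sum (- k) m = - arg_sum k m).
  { induction m as [|m IH]; [simpl; ring|].
    change (arg_sum (- k) (S m)) with (arg_sum (- k) m + atan (- k / INR (S m))).
    change (arg_sum k (S m)) with (arg_sum k m + atan (k / INR (S m))). rewrite IH, atan_opp_div. ring. }
  unfold euler_arg. rewrite E. ring.
Qed.

Lemma atan_bounds x : 0 <= x -> x - x ^ 2 <= atan x <= x.
Proof.
  intros Hx.
  assert (M : forall G : R -> R, G 0 = 0 -> (forall t, ex_derive G t) -> (forall t, 0 <= t -> 0 <= Derive G t) -> 0 <= G x).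
  { intros G G0 D P. apply (nonneg_barrier G x Hx); intros; [apply D|lra|apply P; lra]. }
  set (G1 := fun t => t - atan t). set (G2 := fun t => atan t - (t - t ^ 2)).
  assert (D1 : forall t, is_derive G1 t (1 - / (1 + t ^ 2))).
  { intros t. unfold G1. auto_derive; [easy|]. field. nra. }
  assert (D2 : forall t, is_derive G2 t (/ (1 + t ^ 2) - (1 - 2 * t))).
  { intros t. unfold G2. auto_derive; [easy|]. field. nra. }
  split.
  - assert (0 <= atan x - (x - x ^ 2)); [|lra].
    apply (M G2).
    + unfold G2. rewrite atan_0. ring.
    + intros t. eexists. apply D2.
    + intros t Ht. rewrite (is_derive_unique _ _ _ (D2 t)).
      replace (/ (1 + t ^ 2) - (1 - 2 * t)) with (t * (2 - t + 2 * t ^ 2) / (1 + t ^ 2)) by (field; nra).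
      apply Rdiv_le_0_compat; [apply Rmult_le_pos; nra|nra].
  - assert (0 <= x - atan x); [|lra].
    apply (M G1).
    + unfold G1. rewrite atan_0. ring.
    + intros t. eexists. apply D1.
    + intros t Ht. rewrite (is_derive_unique _ _ _ (D1 t)).
      replace (1 - / (1 + t ^ 2)) with (t ^ 2 / (1 + t ^ 2)) by (field; nra).
      apply Rdiv_le_0_compat; nra.
Qed.

Lemma ln_succ_bounds m : 0 < m -> / (m + 1) <= ln ((m + 1) / m) <= / m.
Proof.
  intros Hm.
  assert (X : forall y, 0 < y -> ln y <= y - 1).
  { intros y Hy. pose proof (exp_ineq1_le (ln y)) as H. rewrite exp_ln in H by exact Hy. lra. }
  split.
  - assert (H : ln (m / (m + 1)) <= m / (m + 1) - 1) by (apply X, Rdiv_lt_0_compat; lra).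
    replace (m / (m + 1)) with (/ ((m + 1) / m)) in H at 1 by (field; lra).
    rewrite ln_Rinv in H by (apply Rdiv_lt_0_compat; lra).
    replace (/ (m + 1)) with (- (m / (m + 1) - 1)) by (field; lra). lra.
  - assert (H : ln ((m + 1) / m) <= (m + 1) / m - 1) by (apply X, Rdiv_lt_0_compat; lra).
    replace (/ m) with ((m + 1) / m - 1) by (field; lra). exact H.
Qed.

(** The sequence increases, as [atan (k / (m + 2)) <= k / (m + 1) <= k ln ((m + 1) / m)], and its increments
    are bounded by a telescoping multiple of [1 / m - 1 / (m + 1)]. *)
Lemma euler_arg_limit_pos k : 0 <= k -> ex_finite_lim_seq (euler_arg k).
Proof.
  intros Hk.
  assert (St : forall n, 0 <= euler_arg k (S n) - euler_arg k n <= (2 * k + k ^ 2) * (/ (INR n + 1) - / (INR n + 2))).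
  { intros n. pose proof (pos_INR n). set (m := INR n + 1).
    assert (E : euler_arg k (S n) - euler_arg k n = k * ln ((m + 1) / m) - atan (k / (m + 2))).
    { unfold euler_arg. change (arg_sum k (S (S (S n)))) with (arg_sum k (S (S n)) + atan (k / INR (S (S (S n))))).
      rewrite !S_INR. unfold m. rewrite ln_div by lra.
      replace (INR n + 1 + 1 + 1) with (INR n + 1 + 2) by ring. ring. }
    rewrite E. replace (INR n + 2) with (m + 1) by (unfold m; ring).
    assert (Hm : 1 <= m) by (unfold m; lra).
    destruct (ln_succ_bounds m ltac:(lra)) as [L1 L2].
    set (i := / (m + 2)). assert (Hi : 0 < i) by (apply Rinv_0_lt_compat; lra).
    destruct (atan_bounds (k / (m + 2))) as [A1 A2]; [apply Rdiv_le_0_compat; lra|].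
    change (k / (m + 2)) with (k * i) in *.
    assert (i <= / (m + 1)) by (apply Rinv_le_contravar; lra).
    split.
    - assert (k * i <= k * ln ((m + 1) / m)) by (apply Rmult_le_compat_l; lra). lra.
    - assert (k * ln ((m + 1) / m) <= k * / m) by (apply Rmult_le_compat_l; lra).
      assert (I1 : / m - i <= 2 * (/ m - / (m + 1))).
      { unfold i. replace (2 * (/ m - / (m + 1))) with (2 * / (m * (m + 1))) by (field; lra).
        replace (/ m - / (m + 2)) with (2 * / (m * (m + 2))) by (field; lra).
        apply Rmult_le_compat_l; [lra|]. apply Rinv_le_contravar; nra. }
      assert (I2 : i ^ 2 <= / m - / (m + 1)).
      { unfold i. replace (/ m - / (m + 1)) with (/ (m * (m + 1))) by (field; lra).
        replace ((/ (m + 2)) ^ 2) with (/ ((m + 2) * (m + 2))) by (field; lra).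
        apply Rinv_le_contravar; nra. }
      assert (k * (/ m - i) <= k * (2 * (/ m - / (m + 1)))) by (apply Rmult_le_compat_l; lra).
      assert (k ^ 2 * i ^ 2 <= k ^ 2 * (/ m - / (m + 1))) by (apply Rmult_le_compat_l; nra).
      rewrite Rpow_mult_distr in A1. lra. }
  apply (ex_finite_lim_seq_incr (euler_arg k) (euler_arg k 0 + (2 * k + k ^ 2))).
  - intros n. specialize (St n). lra.
  - assert (B : forall n, euler_arg k n <= euler_arg k 0 + (2 * k + k ^ 2) * (1 - / (INR n + 1))).
    { induction n as [|n IH]; [simpl INR; right; field|].
      specialize (St n). rewrite S_INR. replace (INR n + 1 + 1) with (INR n + 2) by ring. nra. }
    intros n. specialize (B n).
    assert (0 < / (INR n + 1)) by (apply Rinv_0_lt_compat; pose proof (pos_INR n); lra). nra.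
Qed.

Lemma euler_arg_limit k : ex_finite_lim_seq (euler_arg k).
Proof.
  destruct (Rle_or_lt 0 k) as [Hk|Hk]; [now apply euler_arg_limit_pos|].
  destruct (euler_arg_limit_pos (- k) ltac:(lra)) as [l Hl].
  exists (- l). apply is_lim_seq_ext with (fun n => - euler_arg (- k) n).
  - intros n. rewrite euler_arg_opp. ring.
  - now apply (is_lim_seq_opp _ (Finite l)).
Qed.

(** Convergence in polar coordinates; the limit is not 0 because the modulus is bounded below. *)
Lemma euler_limit_1 k : exists g, g <> RtoC 0 /\ euler_limit (1, k) g.
Proof.
  destruct (euler_mod_limit k) as [l [Hl Ll]]. destruct (euler_arg_limit k) as [t Lt].
  exists (RtoC l * cis t)%C. split.
  - apply Cmult_neq_0; [apply RtoC_neq_0; lra|apply cis_neq_0].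
  - set (q := fun n => 1 - / (INR n + 2)).
    assert (Lq : is_lim_seq q 1).
    { unfold q. replace (Finite 1) with (Finite (1 - 0)) by (f_equal; ring).
      apply is_lim_seq_minus'; [apply is_lim_seq_const|].
      pose proof is_lim_seq_inv_succ as L. apply is_lim_seq_incr_1 in L.
      eapply is_lim_seq_ext; [|exact L]. intros n. cbv beta. rewrite S_INR. f_equal. ring. }
    assert (E : forall n, euler_seq (1, k) (S n) = (RtoC (euler_mod k (S n) * q n) * cis (euler_arg k n))%C).
    { intros n. unfold euler_seq. assert (Hn : 0 < INR (S n)) by (rewrite S_INR; pose proof (pos_INR n); lra).
      rewrite RCpower_pos, Rmult_1_l, exp_ln by exact Hn.
      unfold euler_mod, euler_arg.
      replace (k * ln (INR (S n)) - arg_sum k (S (S n))) with (k * ln (INR (S n)) + - arg_sum k (S (S n))) by ring.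
      rewrite cis_plus, cis_opp.
      pose proof (Crising_neq_0 k (S (S n))) as N. rewrite (Crising_polar k (S (S n))) at 1.
      pose proof (cis_neq_0 (arg_sum k (S (S n)))) as NC.
      assert (NM : Cmod (Crising (1, k) (S (S n))) <> 0) by (apply Cmod_gt_0 in N; lra).
      assert (Q : INR (fact (S (S n))) / Cmod (Crising (1, k) (S (S n))) * q n
                  = INR (fact (S n)) * INR (S n) / Cmod (Crising (1, k) (S (S n)))).
      { unfold q. rewrite (fact_simpl (S n)), mult_INR, !S_INR. pose proof (pos_INR n). field. split; first [exact NM | lra]. }
      rewrite Q. rewrite RtoC_div by exact NM. rewrite RtoC_mult.
      apply RtoC_neq_0 in NM. field. split; assumption. }
    assert (M : is_lim_seq (fun n => euler_mod k (S n) * q n) l).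
    { replace (Finite l) with (Finite (l * 1)) by (f_equal; ring).
      apply is_lim_seq_mult'; [|exact Lq]. apply is_lim_seq_incr_1 in Ll. exact Ll. }
    assert (LC : is_lim_seq (fun n => cos (euler_arg k n)) (cos t)).
    { apply (is_lim_seq_continuous cos); [apply continuity_cos|exact Lt]. }
    assert (LS : is_lim_seq (fun n => sin (euler_arg k n)) (sin t)).
    { apply (is_lim_seq_continuous sin); [apply continuity_sin|exact Lt]. }
    split.
    + eapply is_lim_seq_ext; [|replace (Re (RtoC l * cis t)%C) with (l * cos t) by (unfold Re, Cmult, cis, RtoC, fst, snd; ring);
        apply (is_lim_seq_mult' _ _ _ _ M LC)].
      intros n. rewrite E. unfold Re, Cmult, cis, RtoC, fst, snd; ring.
    + eapply is_lim_seq_ext; [|replace (Im (RtoC l * cis t)%C) with (l * sin t) by (unfold Im, Cmult, cis, RtoC, fst, snd; ring);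
        apply (is_lim_seq_mult' _ _ _ _ M LS)].
      intros n. rewrite E. unfold Im, Cmult, cis, RtoC, fst, snd; ring.
Qed.

Lemma CGamma_rising k : exists g, g <> RtoC 0 /\
  forall m x, x = INR m + 1 -> CGamma (x, k) = (g * Crising (1, k) m)%C.
Proof.
  destruct (euler_limit_1 k) as [g [Hg Lg]]. exists g. split; [exact Hg|].
  assert (X : forall m, euler_limit ((INR m + 1)%R, k) (g * Crising (1, k) m)%C).
  { induction m as [|m IH].
    - simpl. rewrite Rplus_0_l, Cmult_1_r. exact Lg.
    - rewrite S_INR. change (Crising (1, k) (S m)) with (Crising (1, k) m * ((1, k) + RtoC (INR m)))%C.
      replace (g * (Crising (1, k) m * ((1, k) + RtoC (INR m))))%C
        with (((INR m + 1)%R, k) * (g * Crising (1, k) m))%C.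
      + apply euler_limit_succ; [pose proof (pos_INR m); lra|exact IH].
      + replace ((INR m + 1)%R, k) with ((1, k) + RtoC (INR m))%C
          by (apply injective_projections; unfold Cplus, RtoC, fst, snd; ring). ring. }
  intros m x ->. now apply CGamma_limit.
Qed.

(** * The Bessel equation in real terms *)

Definition bes (k : R) (n : nat) (s : R) : C := (bes_re k n s, bes_im k n s).

(** Gamma enters the series only through the values of [CGamma_rising], so the Bessel functions of order
    [n + i k] are the series [bes k n] up to an explicit nonzero factor.  The factors for [n = 0] and
    [n = 1] differ by [r / 2]. *)
Lemma besselI_eval k g r : 0 < r ->
  (forall m x, x = INR m + 1 -> CGamma (x, k) = (g * Crising (1, k) m)%C) -> g <> RtoC 0 ->
  forall n nu, nu = (INR n, k) ->
  besselI nu r = (RtoC ((r / 2) ^ n) * cis (k * ln (r / 2)) / g * bes k n ((r / 2) ^ 2))%C.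
Proof.
  intros Hr HG Hg n nu ->. set (h := r / 2). assert (Hh : 0 < h) by (unfold h; lra).
  set (e := (RtoC (h ^ n) * cis (k * ln h) / g)%C).
  assert (T : forall p, (/ (RtoC (INR (fact p)) * CGamma ((INR n, k) + RtoC (INR p) + RtoC 1))
     * RCpower h ((INR n, k) + RtoC (2 * INR p)))%C = (e * (bcoef k n p * RtoC ((h ^ 2) ^ p)))%C).
  { intros p.
    replace ((INR n, k) + RtoC (INR p) + RtoC 1)%C with ((INR (n + p) + 1)%R, k)
      by (apply injective_projections; unfold Cplus, RtoC, fst, snd; rewrite ?plus_INR; ring).
    rewrite (HG (n + p)%nat _ eq_refl).
    replace ((INR n, k) + RtoC (2 * INR p))%C with (INR (n + 2 * p), k)
      by (apply injective_projections; unfold Cplus, RtoC, fst, snd; rewrite ?plus_INR, ?mult_INR; simpl; ring).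
    rewrite RCpower_pos by exact Hh.
    rewrite (Rmult_comm (INR (n + 2 * p))), <- (Rmult_comm (INR (n + 2 * p))).
    replace (exp (INR (n + 2 * p) * ln h)) with (h ^ n * (h ^ 2) ^ p)
      by (rewrite <- pow_mult, <- pow_add, <- Rpower_pow by exact Hh; reflexivity).
    unfold e, bcoef. rewrite RtoC_mult.
    pose proof (Crising_neq_0 k (n + p)). pose proof (RtoC_fact_neq_0 p).
    field. repeat split; assumption. }
  assert (SR : ex_series (fun p => Re (bcoef k n p) * (h ^ 2) ^ p)).
  { apply ex_pseries_R. apply CV_radius_inside. rewrite bes_re_radius. easy. }
  assert (SI : ex_series (fun p => Im (bcoef k n p) * (h ^ 2) ^ p)).
  { apply ex_pseries_R. apply CV_radius_inside. rewrite bes_im_radius. easy. }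
  unfold besselI, CSeries. fold h. apply injective_projections.
  - transitivity (Series (fun p => Re e * (Re (bcoef k n p) * (h ^ 2) ^ p) - Im e * (Im (bcoef k n p) * (h ^ 2) ^ p))).
    + apply Series_ext. intros p. rewrite T. unfold Re, Im, Cmult, RtoC, fst, snd. ring.
    + rewrite Series_minus, !Series_scal_l by (apply (ex_series_scal_l (V := R_NormedModule)); assumption).
      reflexivity.
  - transitivity (Series (fun p => Re e * (Im (bcoef k n p) * (h ^ 2) ^ p) + Im e * (Re (bcoef k n p) * (h ^ 2) ^ p))).
    + apply Series_ext. intros p. rewrite T. unfold Re, Im, Cmult, RtoC, fst, snd. ring.
    + rewrite Series_plus, !Series_scal_l by (apply (ex_series_scal_l (V := R_NormedModule)); assumption).
      reflexivity.
Qed.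

Definition quo (k s : R) : C := (quo_re k s, quo_im k s).

Lemma quo_neq_0 k s : 0 <= s -> quo k s <> RtoC 0.
Proof. intros Hs E. injection E as E1 E2. pose proof (quo_re_ge_1 k s Hs). lra. Qed.

Lemma bes_1_neq_0 k s : 0 <= s -> bes k 1 s <> RtoC 0.
Proof. intros Hs E. injection E as E1 E2. pose proof (bes_1_norm_pos k s Hs). rewrite E1, E2 in *. lra. Qed.

Lemma bes_quotient k s : 0 <= s -> bes k 0 s = (quo k s * bes k 1 s)%C.
Proof.
  intros Hs. destruct (bes_re_im_quotient k s Hs) as [E1 E2]. unfold bes. rewrite E1, E2.
  unfold quo. apply injective_projections; unfold Cmult, fst, snd; ring.
Qed.

Lemma besselI_ratio k r : 0 < r ->
  (besselI (1, k) r / besselI (0, k) r = RtoC (r / 2) / quo k ((r / 2) ^ 2))%C.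
Proof.
  intros Hr. destruct (CGamma_rising k) as [g [Hg HG]].
  pose proof (besselI_eval k g r Hr HG Hg) as F.
  rewrite (F 1%nat (1, k) eq_refl), (F 0%nat (0, k) eq_refl).
  set (s := (r / 2) ^ 2). assert (Hs : 0 <= s) by apply pow2_ge_0.
  rewrite bes_quotient by exact Hs.
  pose proof (quo_neq_0 k s Hs). pose proof (bes_1_neq_0 k s Hs). pose proof (cis_neq_0 (k * ln (r / 2))).
  rewrite pow_1, pow_O. field. repeat split; try assumption.
Qed.

Lemma quo_re_opp k s : quo_re (- k) s = quo_re k s.
Proof. unfold quo_re. now replace ((- k) ^ 2) with (k ^ 2) by ring. Qed.
Lemma quo_im_opp k s : quo_im (- k) s = - quo_im k s.
Proof. unfold quo_im. rewrite twice_im_opp. field. Qed.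

(** The Bessel equation has orders [1 - i k] and [- i k]; it says [w = (mu / 2) e^(- i alpha)] at [- k].
    As [w] at [- k] is the conjugate of [w] at [k], this is [w = (mu / 2) e^(i alpha)] at [k]. *)
Lemma bessel_equation_iff mu alpha k r : 0 < r ->
  bessel_equation mu alpha k r <->
  quo_re k ((r / 2) ^ 2) = mu / 2 * cos alpha /\ quo_im k ((r / 2) ^ 2) = mu / 2 * sin alpha.
Proof.
  intros Hr. unfold bessel_equation.
  replace (RtoC 1 - Ci * RtoC k)%C with (1, - k)
    by (apply injective_projections; unfold Cminus, Cplus, Copp, Cmult, Ci, RtoC, fst, snd; ring).
  replace (- (Ci * RtoC k))%C with (0, - k)
    by (apply injective_projections; unfold Cminus, Cplus, Copp, Cmult, Ci, RtoC, fst, snd; ring).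
  rewrite besselI_ratio by exact Hr.
  set (s := (r / 2) ^ 2). assert (Hs : 0 <= s) by apply pow2_ge_0.
  replace (Cexp (Ci * RtoC alpha)) with (cis alpha).
  2:{ unfold Cexp, cis, Cmult, Ci, RtoC, Re, Im, fst, snd.
      replace (0 * alpha - 1 * 0) with 0 by ring. replace (0 * 0 + 1 * alpha) with alpha by ring.
      rewrite exp_0. f_equal; ring. }
  pose proof (quo_neq_0 (- k) s Hs) as NW.
  assert (EQ : (RtoC mu * (RtoC (r / 2) / quo (- k) s) = cis alpha * RtoC r)%C <->
               (RtoC (mu / 2) = cis alpha * quo (- k) s)%C).
  { assert (Nr : RtoC r <> RtoC 0) by (intros E; injection E; lra).
    assert (N2 : RtoC 2 <> RtoC 0) by (intros E; injection E; lra).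
    rewrite !RtoC_div by lra. split; intros E.
    - apply Cmult_eq_reg_l with (RtoC r); [exact Nr|].
      transitivity (RtoC mu * (RtoC r / RtoC 2 / quo (- k) s) * quo (- k) s)%C; [field; auto|].
      rewrite E. ring.
    - transitivity (RtoC mu / RtoC 2 * RtoC r / quo (- k) s)%C; [field; auto|]. rewrite E. field; auto. }
  rewrite EQ. unfold quo. rewrite quo_re_opp, quo_im_opp.
  pose proof (sin2_cos2 alpha) as SC. unfold Rsqr in SC.
  split.
  - intros E.
    assert (E1 : mu / 2 = cos alpha * quo_re k s - sin alpha * - quo_im k s) by exact (f_equal fst E).
    assert (E2 : 0 = cos alpha * - quo_im k s + sin alpha * quo_re k s) by exact (f_equal snd E).
    split.
    + rewrite E1. transitivity ((sin alpha * sin alpha + cos alpha * cos alpha) * quo_re k s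
        - sin alpha * (cos alpha * - quo_im k s + sin alpha * quo_re k s)); [rewrite SC, <- E2|]; ring.
    + rewrite E1. transitivity ((sin alpha * sin alpha + cos alpha * cos alpha) * quo_im k s
        + cos alpha * (cos alpha * - quo_im k s + sin alpha * quo_re k s)); [rewrite SC, <- E2|]; ring.
  - intros [E1 E2]. rewrite E1, E2.
    apply injective_projections; unfold Cmult, RtoC, cis, fst, snd.
    + transitivity (mu / 2 * (sin alpha * sin alpha + cos alpha * cos alpha)); [rewrite SC; ring|ring].
    + ring.
Qed.

(** At [k = 0] the Euler limit is evaluated directly: it is the limit of [n / (n + 1)]. *)
Lemma besselI0_bes_re r : 0 < r -> besselI0 r = bes_re 0 0 ((r / 2) ^ 2).
Proof.
  intros Hr. destruct (CGamma_rising 0) as [g [Hg HG]].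
  assert (G1 : g = RtoC 1).
  { pose proof (HG 0%nat 1 ltac:(simpl; ring)) as E. simpl in E. rewrite Cmult_1_r in E. rewrite <- E.
    apply CGamma_limit.
    assert (F : forall n, Crising (1, 0) n = RtoC (INR (fact n))).
    { induction n as [|n IH]; [reflexivity|]. rewrite fact_simpl, mult_INR, S_INR.
      change (Crising (1, 0) (S n)) with (Crising (1, 0) n * ((1, 0) + RtoC (INR n)))%C. rewrite IH.
      apply injective_projections; unfold Cmult, Cplus, RtoC, fst, snd; ring. }
    assert (L : is_lim_seq (fun n => 1 - / (INR n + 2)) 1).
    { replace (Finite 1) with (Finite (1 - 0)) by (f_equal; ring).
      apply is_lim_seq_minus'; [apply is_lim_seq_const|].
      pose proof is_lim_seq_inv_succ as L. apply is_lim_seq_incr_1 in L.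
      eapply is_lim_seq_ext; [|exact L]. intros n. cbv beta. rewrite S_INR. f_equal. ring. }
    assert (E2 : forall n, euler_seq (1, 0) (S n) = RtoC (1 - / (INR n + 2))).
    { intros n. unfold euler_seq. rewrite F.
      assert (Hn : 0 < INR (S n)) by (rewrite S_INR; pose proof (pos_INR n); lra).
      rewrite RCpower_pos, Rmult_1_l, exp_ln, Rmult_0_l by exact Hn.
      unfold cis. rewrite cos_0, sin_0. change (1, 0) with (RtoC 1).
      rewrite Cmult_1_r, <- RtoC_mult, <- RtoC_div by apply INR_fact_neq_0.
      f_equal. rewrite (fact_simpl (S n)), mult_INR, !S_INR. pose proof (pos_INR n).
      pose proof (INR_fact_neq_0 (S n)). field. split; [lra|assumption]. }
    split; (eapply is_lim_seq_ext; [intros n; rewrite E2; reflexivity|]); simpl; [exact L|apply is_lim_seq_const]. }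
  unfold besselI0. rewrite (besselI_eval 0 g r Hr HG Hg 0 (RtoC 0) eq_refl), G1.
  rewrite Rmult_0_l. unfold cis. rewrite cos_0, sin_0. change (1, 0) with (RtoC 1).
  rewrite pow_O.
  replace (RtoC 1 * RtoC 1 / RtoC 1 * bes 0 0 ((r / 2) ^ 2))%C with (bes 0 0 ((r / 2) ^ 2)); [reflexivity|].
  field.
Qed.

(** * The profile equation: uniform bound, existence, uniqueness *)

(** [ring] and [field] recognise the type of an equation syntactically; derivatives and integrals leave it
    as the carrier of an algebraic structure on [R]. *)
Ltac as_R := match goal with |- @eq _ ?a ?b => change (@eq R a b) end.

Lemma zero_derive_const (F : R -> R) : (forall x, is_derive F x 0) -> forall x y, F x = F y.
Proof.
  intros D x y. destruct (MVT_gen F x y (fun _ => 0)) as [z [_ E]].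
  - intros t _. apply D.
  - intros t _. apply continuity_pt_filterlim. apply continuous_derivable. eexists. apply D.
  - lra.
Qed.

Section Antiderivative.
Context (f : R -> R) (Cf : forall x, continuous f x).

Definition primitive (x : R) : R := RInt f 0 x.

Lemma primitive_derive x : is_derive primitive x (f x).
Proof.
  apply (is_derive_RInt f primitive 0 x); [|apply Cf].
  apply filter_forall. intros y. apply (RInt_correct (V := R_CompleteNormedModule)), ex_RInt_cont, Cf.
Qed.

Lemma RInt_primitive a b : RInt f a b = primitive b - primitive a.
Proof. apply is_RInt_unique, (is_RInt_deriv primitive f); [apply primitive_derive|exact Cf]. Qed.

Lemma primitive_0 : primitive 0 = 0.
Proof. unfold primitive. now rewrite RInt_point. Qed.

(** Covers periodic functions ([q = 1]) and the integrating factor. *)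
Lemma primitive_quasi_periodic q : (forall x, f (x + 2 * PI) = q * f x) ->
  forall x, primitive (x + 2 * PI) = q * primitive x + primitive (2 * PI).
Proof.
  intros Hq x. set (G := fun x => primitive (x + 2 * PI) - q * primitive x).
  assert (D : forall t, is_derive G t 0).
  { intros t. unfold G. auto_derive.
    - repeat split; eexists; apply primitive_derive.
    - change (fun x => primitive x) with primitive.
      rewrite !(is_derive_unique _ _ _ (primitive_derive _)), Hq. ring. }
  pose proof (zero_derive_const G D x 0) as E. unfold G in E. rewrite primitive_0, Rplus_0_l in E. lra.
Qed.
End Antiderivative.

Lemma RInt_shift f a : periodic f -> (forall x, continuous f x) ->
  RInt (fun x => f (x + a)) 0 (2 * PI) = RInt f 0 (2 * PI) :> R.
Proof.
  intros Pf Cf. pose proof (primitive_quasi_periodic f Cf 1 ltac:(intros x; rewrite Pf; ring) a) as E.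
  assert (D : forall x, is_derive (fun x => primitive f (x + a)) x (f (x + a))).
  { intros x. auto_derive; [eexists; now apply primitive_derive|].
    change (fun x => primitive f x) with (primitive f).
    rewrite (is_derive_unique _ _ _ (primitive_derive f Cf _)). apply Rmult_1_l. }
  assert (C : forall x, continuous (fun x => f (x + a)) x).
  { intros x. apply (continuous_comp (fun x => x + a) f); [|apply Cf].
    apply continuous_derivable. now auto_derive. }
  transitivity (primitive f (2 * PI + a) - primitive f (0 + a));
    [exact (is_RInt_unique _ _ _ _ (is_RInt_deriv _ _ 0 (2 * PI) D C))|].
  rewrite (RInt_primitive f Cf), (Rplus_comm (2 * PI)), E, primitive_0, Rplus_0_l. ring.
Qed.

Lemma RInt_positive f : (forall x, continuous f x) -> (forall x, 0 < f x) -> 0 < RInt f 0 (2 * PI).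
Proof.
  intros Cf Hf. apply RInt_gt_0; [pose proof PI_RGT_0; lra|intros; apply Hf|intros; apply Cf].
Qed.

Lemma circle_ode_scale k r c f a : circle_ode k r c f -> circle_ode k r (a * c) (fun x => a * f x).
Proof.
  intros [Pf Df]. split.
  - intros x. now rewrite Pf.
  - intros x. specialize (Df x). auto_derive; [eexists; exact Df|].
    change (fun x => f x) with f. rewrite (is_derive_unique _ _ _ Df). ring.
Qed.

(** Reflection changes the sign of [k], so that estimates may assume [0 <= k]. *)
Lemma circle_ode_reflect k r c f : circle_ode k r c f -> circle_ode (- k) r (- c) (fun x => f (- x)).
Proof.
  intros [Pf Df]. split.
  - intros x. rewrite <- (Pf (- (x + 2 * PI))). f_equal. ring.
  - intros x. specialize (Df (- x)). auto_derive; [eexists; exact Df|].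
    change (fun x => f x) with f. rewrite (is_derive_unique _ _ _ Df), sin_neg. ring.
Qed.

Section SupBound.
Context (k r c : R) (f : R -> R) (Hf : circle_ode k r c f) (Hr : 0 <= r)
  (Pos : forall x, 0 < f x) (Mass : RInt f 0 (2 * PI) = 1).

Lemma sin_moment_le : Rabs (sin_moment f 1) <= 1.
Proof.
  pose proof PI_RGT_0. pose proof (circle_ode_continuous k r c f Hf) as Cf.
  unfold sin_moment. rewrite <- Mass.
  eapply Rle_trans; [apply abs_RInt_le; [lra|]|].
  - apply ex_RInt_cont. intros; apply continuous_mul; [apply Cf|apply continuous_sin_lin].
  - apply RInt_le; [lra| | |].
    + apply ex_RInt_cont. intros x. apply (continuous_comp (fun x => f x * sin (INR 1 * x)) Rabs); [|apply continuous_Rabs].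
      apply continuous_mul; [apply Cf|apply continuous_sin_lin].
    + apply ex_RInt_cont, Cf.
    + intros x _. rewrite Rabs_mult, (Rabs_pos_eq (f x)) by (apply Rlt_le, Pos).
      rewrite <- (Rmult_1_r (f x)) at 2. apply Rmult_le_compat_l; [apply Rlt_le, Pos|apply Rabs_le, SIN_bound].
Qed.

(** The integral of the equation over a period. *)
Lemma mean_flux : 2 * PI * c = k + r * sin_moment f 1.
Proof.
  pose proof (circle_ode_continuous k r c f Hf) as Cf.
  pose proof (is_sin_moment f 1 Cf) as S1.
  assert (C0 : is_RInt f 0 (2 * PI) 1).
  { rewrite <- Mass. apply (RInt_correct (V := R_CompleteNormedModule)), ex_RInt_cont, Cf. }
  pose proof (is_RInt_lin2 _ _ _ _ _ _ (- r) (- k) S1 C0) as I1.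
  set (g := fun x => - r * (f x * sin (INR 1 * x)) + - k * f x) in *.
  assert (I2 : is_RInt g 0 (2 * PI) ((f (2 * PI) - c * (2 * PI)) - (f 0 - c * 0))).
  { apply (is_RInt_deriv (fun x => f x - c * x)).
    - intros x. pose proof (proj2 Hf x) as D. unfold g. auto_derive; [eexists; exact D|].
      change (fun x => f x) with f. rewrite (is_derive_unique _ _ _ D). replace (INR 1 * x) with x by (symmetry; exact (Rmult_1_l x)). as_R. ring.
    - intros x. unfold g.
      apply (continuous_plus (fun x => - r * (f x * sin (INR 1 * x))) (fun x => - k * f x)).
      + apply continuous_mul; [apply continuous_const|]. apply continuous_mul; [apply Cf|apply continuous_sin_lin].
      + apply continuous_mul; [apply continuous_const|apply Cf]. }
  apply (is_RInt_unique (V := R_CompleteNormedModule)) in I1.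
  apply (is_RInt_unique (V := R_CompleteNormedModule)) in I2.
  rewrite I1, (periodic_0 k r c f Hf) in I2. lra.
Qed.

(** By the mean value theorem for the primitive [P] of [f], the function [f - 1 / (2 PI)] has a zero [x0] in
    the period that ends at [x].  From there its distance to 0 grows at most like the integral [Phi] of
    [r / (2 PI) + r f], because the term [k] is damping for [0 <= k]; over one period [Phi] is at most [2 r]. *)
Lemma sup_bound_forward x : 0 <= k -> Rabs (f x - 1 / (2 * PI)) <= 2 * r.
Proof.
  intros Hk. pose proof PI_RGT_0 as HP.
  pose proof (circle_ode_continuous k r c f Hf) as Cf.
  set (P := primitive f).
  assert (DP : forall t, is_derive P t (f t)) by apply primitive_derive, Cf.
  assert (QP : forall t, P (t + 2 * PI) = P t + 1).
  { intros t. unfold P. rewrite (primitive_quasi_periodic f Cf 1) by (intros; rewrite (proj1 Hf); ring).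
    unfold primitive at 2. rewrite Mass. ring. }
  assert (Hmono : forall a b, a <= b -> P a <= P b).
  { intros a b Hab. unfold P. assert (0 <= RInt f a b).
    { apply RInt_ge_0; [exact Hab|apply ex_RInt_cont, Cf|intros; apply Rlt_le, Pos]. }
    rewrite (RInt_primitive f Cf) in H. lra. }
  destruct (MVT_gen P (x - 2 * PI) x f) as [x0 [Hx0 E0]].
  { intros t _. apply DP. }
  { intros t _. apply continuity_pt_filterlim, continuous_derivable. eexists. apply DP. }
  rewrite Rmin_left, Rmax_right in Hx0 by lra.
  assert (E1 := QP (x - 2 * PI)). replace (x - 2 * PI + 2 * PI) with x in E1 by ring.
  assert (U0 : f x0 = 1 / (2 * PI)).
  { apply Rmult_eq_reg_r with (2 * PI); [|lra]. unfold Rdiv. rewrite Rmult_assoc, Rinv_l by lra. lra. }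
  set (a := 1 / (2 * PI)) in *. assert (Ha : a * (2 * PI) = 1) by (unfold a; field; lra).
  assert (Ha0 : 0 < a) by (apply Rdiv_lt_0_compat; lra). clearbody a.
  assert (Hc : Rabs (c - k * a) <= r * a).
  { replace (c - k * a) with (r * sin_moment f 1 * a).
    - rewrite !Rabs_mult, (Rabs_pos_eq r Hr), (Rabs_pos_eq a) by nra.
      pose proof sin_moment_le. rewrite Rmult_assoc. apply Rmult_le_compat_l; [exact Hr|].
      nra.
    - pose proof mean_flux as M. replace (r * sin_moment f 1) with (2 * PI * c - k) by lra.
      transitivity (c * (a * (2 * PI)) - k * a); [ring|]. rewrite Ha. ring. }
  apply Rabs_le_between in Hc.
  set (Phi := fun t => r * a * t + r * (P (x0 + t) - P x0)).
  assert (Phi_nonneg : forall t, 0 <= t -> 0 <= Phi t).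
  { intros t Ht. unfold Phi. pose proof (Hmono x0 (x0 + t) ltac:(lra)).
    apply Rplus_le_le_0_compat; repeat apply Rmult_le_pos; lra. }
  set (T := x - x0).
  (* Where [Phi + sg * (f - a)] is negative, [sg * (f - a)] is negative too, so that the term with [k]
     pushes upwards; the remaining terms are nonnegative by the choice of [Phi]. *)
  assert (main : forall sg, sg = 1 \/ sg = -1 -> 0 <= Phi T + sg * (f x - a)).
  { intros sg Hsg. set (F := fun t => Phi t + sg * (f (x0 + t) - a)).
    assert (DF : forall t, is_derive F t (r * a + r * f (x0 + t) + sg * (c - (r * sin (x0 + t) + k) * f (x0 + t)))).
    { intros t. pose proof (proj2 Hf (x0 + t)) as D. unfold F, Phi. auto_derive.
      - repeat split; eexists; [apply DP|exact D].
      - change (fun x => P x) with P. change (fun x => f x) with f.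
        rewrite (is_derive_unique _ _ _ D), (is_derive_unique _ _ _ (DP _)). ring. }
    assert (B : 0 <= F T).
    { apply (nonneg_barrier F T ltac:(unfold T; lra)).
      - intros t _. eexists. apply DF.
      - unfold F, Phi. rewrite Rplus_0_r, U0. right. ring.
      - intros t Ht Hneg. rewrite (is_derive_unique _ _ _ (DF t)).
        pose proof (Phi_nonneg t ltac:(lra)) as HPhi. unfold F in Hneg.
        pose proof (Pos (x0 + t)) as Hp. set (y := f (x0 + t)) in *.
        pose proof (SIN_bound (x0 + t)) as Hs. set (s := sin (x0 + t)) in *.
        replace (r * a + r * y + sg * (c - (r * s + k) * y))
          with ((r * a + sg * (c - k * a)) + r * y * (1 - sg * s) + - (k * (sg * (y - a)))) by ring.
        assert (0 <= r * a + sg * (c - k * a)) by (destruct Hsg as [-> | ->]; lra).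
        assert (0 <= r * y * (1 - sg * s)).
        { apply Rmult_le_pos; [apply Rmult_le_pos; lra|destruct Hsg as [-> | ->]; lra]. }
        assert (0 <= - (k * (sg * (y - a)))) by nra.
        lra. }
    unfold F, T in B. replace (x0 + (x - x0)) with x in B by ring. exact B. }
  assert (PT : Phi T <= 2 * r).
  { unfold Phi, T. replace (x0 + (x - x0)) with x by ring.
    pose proof (Hmono (x - 2 * PI) x0 ltac:(lra)).
    assert (r * (P x - P x0) <= r * 1) by (apply Rmult_le_compat_l; lra).

    assert (r * a * (x - x0) <= r * a * (2 * PI)) by (apply Rmult_le_compat_l; [apply Rmult_le_pos; lra|lra]).
    replace (r * a * (2 * PI)) with (r * (a * (2 * PI))) in * by ring. rewrite Ha in *. lra. }
  pose proof (main 1 ltac:(now left)). pose proof (main (-1) ltac:(now right)).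
  apply Rabs_le. lra.
Qed.
End SupBound.

Lemma sup_bound k r c f : circle_ode k r c f -> 0 <= r -> (forall x, 0 < f x) ->
  RInt f 0 (2 * PI) = 1 -> forall x, Rabs (f x - 1 / (2 * PI)) <= 2 * r.
Proof.
  intros Hf Hr Pos Mass x. destruct (Rle_or_lt 0 k) as [Hk|Hk].
  - now apply (sup_bound_forward k r c f).
  - pose proof (circle_ode_continuous k r c f Hf) as Cf. pose proof (circle_ode_reflect _ _ _ _ Hf) as Hg.
    replace (f x) with ((fun x => f (- x)) (- x)) by (cbv beta; f_equal; ring).
    apply (sup_bound_forward _ _ _ _ Hg); auto; [|lra].
    rewrite <- Mass.
    assert (D : forall y, is_derive (fun y => - primitive f (- y)) y (f (- y))).
    { intros y. auto_derive; [eexists; now apply primitive_derive|].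
      change (fun x => primitive f x) with (primitive f).
      rewrite (is_derive_unique _ _ _ (primitive_derive f Cf _)).
      transitivity (- (-1 * f (- y))); [reflexivity|]. ring. }
    transitivity (- primitive f (- (2 * PI)) - - primitive f (- 0));
      [exact (is_RInt_unique _ _ _ _ (is_RInt_deriv _ _ 0 (2 * PI) D (circle_ode_continuous _ _ _ _ Hg)))|].
    pose proof (primitive_quasi_periodic f Cf 1 ltac:(intros y; rewrite (proj1 Hf); ring) (- (2 * PI))) as E.
    rewrite Rplus_opp_l in E. rewrite (RInt_primitive f Cf), Ropp_0, primitive_0 in *. lra.
Qed.

Definition integrating_factor (k r x : R) : R := exp (k * x - r * cos x).

Lemma integrating_factor_pos k r x : 0 < integrating_factor k r x.
Proof. apply exp_pos. Qed.

Lemma integrating_factor_shift k r x : integrating_factor k r (x + 2 * PI) = exp (2 * PI * k) * integrating_factor k r x.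
Proof.
  unfold integrating_factor. rewrite <- exp_plus. f_equal. rewrite (cos_plus x), cos_2PI, sin_2PI. ring.
Qed.

Lemma integrating_factor_derive k r x : is_derive (integrating_factor k r) x ((r * sin x + k) * integrating_factor k r x).
Proof. unfold integrating_factor. auto_derive; [easy|]. unfold Rminus. ring. Qed.

Lemma integrating_factor_continuous k r x : continuous (integrating_factor k r) x.
Proof. apply continuous_derivable. eexists. apply integrating_factor_derive. Qed.

Lemma circle_ode_integrating_factor k r c f : circle_ode k r c f -> forall x,
  is_derive (fun x => f x * integrating_factor k r x) x (c * integrating_factor k r x).
Proof.
  intros Hf x. pose proof (proj2 Hf x) as D. pose proof (integrating_factor_derive k r x) as D2.
  auto_derive; [repeat split; eexists; eassumption|].
  change (fun x => f x) with f. change (fun x => integrating_factor k r x) with (integrating_factor k r).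
  rewrite (is_derive_unique _ _ _ D), (is_derive_unique _ _ _ D2). ring.
Qed.

Lemma exp_turn_eq_1 k : exp (2 * PI * k) = 1 -> k = 0.
Proof.
  intros E. rewrite <- exp_0 in E. apply exp_inv in E. pose proof PI_RGT_0.
  apply Rmult_integral in E. lra.
Qed.

(** [f] times the integrating factor is constant, but the integrating factor is multiplied by
    [exp (2 PI k) <> 1] over a period. *)
Lemma circle_ode_homogeneous k r f : circle_ode k r 0 f -> k <> 0 -> forall x, f x = 0.
Proof.
  intros Hf Hk x.
  pose proof (circle_ode_integrating_factor _ _ _ _ Hf) as D.
  assert (E : f (x + 2 * PI) * integrating_factor k r (x + 2 * PI) = f x * integrating_factor k r x).
  { apply (zero_derive_const (fun x => f x * integrating_factor k r x)). intros t. rewrite <- (Rmult_0_l (integrating_factor k r t)). apply D. }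
  rewrite (proj1 Hf), integrating_factor_shift in E. pose proof (integrating_factor_pos k r x).
  destruct (Req_dec (f x) 0) as [Z|NZ]; [exact Z|exfalso].
  apply Hk, exp_turn_eq_1. apply Rmult_eq_reg_r with (f x * integrating_factor k r x); [lra|]. nra.
Qed.

Lemma circle_ode_minus k r c d f g : circle_ode k r c f -> circle_ode k r d g ->
  circle_ode k r (c - d) (fun x => f x - g x).
Proof.
  intros [Pf Df] [Pg Dg]. split.
  - intros x. now rewrite Pf, Pg.
  - intros x. specialize (Df x). specialize (Dg x). auto_derive; [repeat split; eexists; eassumption|].
    change (fun x => f x) with f. change (fun x => g x) with g.
    rewrite (is_derive_unique _ _ _ Df), (is_derive_unique _ _ _ Dg). ring.
Qed.

(** For [k = 0] the integrating factor is periodic, so the flux [c] vanishes. *)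
Lemma circle_ode_k0 r c f : circle_ode 0 r c f ->
  c = 0 /\ forall x, f x = f 0 * exp (- r) * exp (r * cos x).
Proof.
  intros Hf. pose proof (circle_ode_integrating_factor _ _ _ _ Hf) as D. set (F := fun x => f x * integrating_factor 0 r x) in *.
  assert (c0 : c = 0).
  { destruct (MVT_gen F 0 (2 * PI) (fun x => c * integrating_factor 0 r x)) as [z [_ E]].
    - intros; apply D.
    - intros t _. apply continuity_pt_filterlim, continuous_derivable. eexists. apply D.
    - pose proof PI_RGT_0. pose proof (integrating_factor_pos 0 r z).
      assert (F (2 * PI) = F 0).
      { unfold F. rewrite (periodic_0 _ _ _ _ Hf). rewrite <- (Rplus_0_l (2 * PI)), integrating_factor_shift.
        rewrite Rmult_0_r, exp_0, Rmult_1_l. reflexivity. }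
      assert (X : c * (integrating_factor 0 r z * (2 * PI)) = 0) by nra.
      apply Rmult_integral in X. destruct X as [X|X]; [exact X|nra]. }
  split; [exact c0|]. intros x.
  assert (E : F x = F 0).
  { apply zero_derive_const. intros t. pose proof (D t) as Dt. rewrite c0, Rmult_0_l in Dt. exact Dt. }
  unfold F, integrating_factor in E. rewrite cos_0 in E.
  replace (0 * x - r * cos x) with (- (r * cos x)) in E by ring.
  replace (0 * 0 - r * 1) with (- r) in E by ring.
  rewrite <- E, Rmult_assoc, <- exp_plus, Rplus_opp_l, exp_0. ring.
Qed.

(** [f = F / E] with [E] the integrating factor and [F' = k E].  The constant [A] in [F = k P + A] is
    chosen so that [F] is multiplied over a period by the same factor [q] as [E].  Positivity: the mean
    value theorem gives [(q - 1) F x = 2 PI k E z], and [k / (q - 1)] is positive. *)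
Lemma circle_ode_exists k r : k <> 0 -> exists f, circle_ode k r k f /\ forall x, 0 < f x.
Proof.
  intros Hk. set (E := integrating_factor k r). set (P := primitive E). set (q := exp (2 * PI * k)).
  assert (CE : forall x, continuous E x) by (intros; apply integrating_factor_continuous).
  assert (DP : forall x, is_derive P x (E x)) by (apply primitive_derive, CE).
  assert (Hq : 0 < k / (q - 1) /\ q - 1 <> 0).
  { pose proof PI_RGT_0. unfold q. destruct (Rdichotomy _ _ Hk) as [L|L].
    - assert (exp (2 * PI * k) < 1) by (rewrite <- exp_0; apply exp_increasing; nra).
      split; [|lra]. replace (k / (exp (2 * PI * k) - 1)) with ((- k) / (1 - exp (2 * PI * k))) by (field; lra).
      apply Rdiv_lt_0_compat; lra.
    - assert (1 < exp (2 * PI * k)) by (rewrite <- exp_0; apply exp_increasing; nra).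
      split; [|lra]. apply Rdiv_lt_0_compat; lra. }
  destruct Hq as [Hq Hq1].
  set (A := k / (q - 1) * P (2 * PI)).
  set (F := fun x => k * P x + A).
  assert (QF : forall x, F (x + 2 * PI) = q * F x).
  { intros x. unfold F, P. rewrite (primitive_quasi_periodic E CE q) by (intros; apply integrating_factor_shift).
    fold P. unfold A. field. exact Hq1. }
  assert (DF : forall x, is_derive F x (k * E x)).
  { intros x. unfold F. auto_derive; [eexists; apply DP|]. change (fun x => P x) with P.
    rewrite (is_derive_unique _ _ _ (DP x)). ring. }
  assert (PF : forall x, 0 < F x).
  { intros x. destruct (MVT_gen F x (x + 2 * PI) (fun x => k * E x)) as [z [_ M]].
    - intros; apply DF.
    - intros t _. apply continuity_pt_filterlim, continuous_derivable. eexists. apply DF.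
    - rewrite QF in M. assert (X : F x = k / (q - 1) * (E z * (2 * PI))).
      { apply Rmult_eq_reg_l with (q - 1); [|exact Hq1].
        transitivity (k * E z * (x + 2 * PI - x)); [lra|field; exact Hq1]. }
      rewrite X. apply Rmult_lt_0_compat; [exact Hq|].
      pose proof PI_RGT_0. apply Rmult_lt_0_compat; [apply integrating_factor_pos|lra]. }
  exists (fun x => F x / E x). split.
  - split.
    + intros x. unfold E. rewrite QF, integrating_factor_shift. fold q E. pose proof (integrating_factor_pos k r x).
      assert (0 < q) by apply exp_pos. unfold E. field. split; lra.
    + intros x. pose proof (DF x) as D1. pose proof (integrating_factor_derive k r x) as D2. pose proof (integrating_factor_pos k r x).
      unfold E. auto_derive.
      * repeat split; try (eexists; eassumption). lra.
      * change (fun x => F x) with F. change (fun x => integrating_factor k r x) with (integrating_factor k r).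
        rewrite (is_derive_unique _ _ _ D1), (is_derive_unique _ _ _ D2). fold E. field. unfold E; lra.
  - intros x. apply Rdiv_lt_0_compat; [apply PF|apply integrating_factor_pos].
Qed.

Lemma is_chi_ode k r f : is_chi k r f <-> circle_ode k r k f.
Proof.
  split; intros [P D]; split; try exact P; intros x.
  - destruct (D x) as [E Q].
    replace (k - (r * sin x + k) * f x) with (Derive f x) by lra. now apply Derive_correct.
  - specialize (D x). split; [eexists; exact D|]. rewrite (is_derive_unique _ _ _ D). ring.
Qed.

Lemma chi_ode k r : circle_ode k r k (chi k r).
Proof.
  unfold chi. destruct (Req_EM_T k 0) as [-> | Hk].
  - split.
    + intros x. now rewrite cos_plus, cos_2PI, sin_2PI, Rmult_1_r, Rmult_0_r, Rminus_0_r.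
    + intros x. auto_derive; [easy|]. ring.
  - apply is_chi_ode. apply epsilon_spec. destruct (circle_ode_exists k r Hk) as [f [Hf _]].
    exists f. now apply is_chi_ode.
Qed.

Lemma chi_pos k r : 0 < besselI0 r -> forall x, 0 < chi k r x.
Proof.
  intros H0 x. destruct (Req_dec k 0) as [E|Hk].
  - unfold chi. destruct (Req_EM_T k 0); [|contradiction].
    apply Rmult_lt_0_compat; [exact H0|apply exp_pos].
  - destruct (circle_ode_exists k r Hk) as [f [Hf Pf]].
    pose proof (circle_ode_minus _ _ _ _ _ _ (chi_ode k r) Hf) as Hd. rewrite Rminus_diag in Hd.
    pose proof (circle_ode_homogeneous _ _ _ Hd Hk x). specialize (Pf x). lra.
Qed.

(** Solutions for given [k] and [r] form a line: for [k <> 0] by [circle_ode_homogeneous], for [k = 0] by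
    [circle_ode_k0]. *)
Lemma chi_multiple k r c f : besselI0 r <> 0 -> circle_ode k r c f ->
  exists a, forall x, f x = a * chi k r x.
Proof.
  intros H0 Hf. destruct (Req_dec k 0) as [E|Hk].
  - subst k. destruct (circle_ode_k0 r c f Hf) as [_ Ef]. exists (f 0 * exp (- r) / besselI0 r).
    intros x. rewrite Ef. unfold chi. destruct (Req_EM_T 0 0); [|contradiction]. field. exact H0.
  - exists (c / k). intros x.
    pose proof (circle_ode_minus _ _ _ _ _ _ Hf (circle_ode_scale _ _ _ _ (c / k) (chi_ode k r))) as Hd.
    replace (c - c / k * k) with 0 in Hd by (field; exact Hk).
    pose proof (circle_ode_homogeneous _ _ _ Hd Hk x). lra.
Qed.

(** * Normalisation of the densities *)

Lemma exp_cos_ode r : circle_ode 0 r 0 (fun x => exp (r * cos x)).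
Proof.
  split.
  - intros x. now rewrite cos_plus, cos_2PI, sin_2PI, Rmult_1_r, Rmult_0_r, Rminus_0_r.
  - intros x. auto_derive; [easy|]. ring.
Qed.

Definition vM_mass (r : R) : R := RInt (fun x => exp (r * cos x)) 0 (2 * PI).

Lemma vM_mass_pos r : 0 < vM_mass r.
Proof. apply RInt_positive; [apply (circle_ode_continuous _ _ _ _ (exp_cos_ode r))|intros; apply exp_pos]. Qed.

Lemma vM_mass_derive r : is_derive vM_mass r (cos_moment (fun x => exp (r * cos x)) 1).
Proof.
  unfold cos_moment.
  assert (D : forall u v, is_derive (fun z => exp (z * cos v)) u (exp (u * cos v) * cos v)).
  { intros u v. auto_derive; [easy|]. ring. }
  replace (RInt (fun x => exp (r * cos x) * cos (INR 1 * x)) 0 (2 * PI))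
    with (RInt (fun t => Derive (fun u => exp (u * cos t)) r) 0 (2 * PI)).
  2:{ apply RInt_ext. intros x _.
      transitivity (exp (r * cos x) * cos x); [exact (is_derive_unique _ _ _ (D r x))|].
      do 3 f_equal. symmetry. exact (Rmult_1_l x). }
  apply (is_derive_RInt_param (fun u t => exp (u * cos t))).
  - apply filter_forall. intros u t _. eexists. apply D.
  - intros t _. apply continuity_2d_pt_ext with (fun u v => exp (u * cos v) * cos v).
    + intros u v. symmetry. apply is_derive_unique, D.
    + assert (Cc : continuity_2d_pt (fun _ v => cos v) r t).
      { apply (continuity_1d_2d_pt_comp cos (fun _ v => v)); [apply continuity_cos|apply continuity_2d_pt_id2]. }
      apply continuity_2d_pt_mult; [|exact Cc].
      apply (continuity_1d_2d_pt_comp exp (fun u v => u * cos v)).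
      * apply derivable_continuous_pt, derivable_pt_exp.
      * apply continuity_2d_pt_mult; [apply continuity_2d_pt_id1|exact Cc].
  - apply filter_forall. intros u. apply ex_RInt_cont. apply (circle_ode_continuous _ _ _ _ (exp_cos_ode u)).
Qed.

(** The derivative of the mass is its first cosine moment, so [first_moment_law] at [k = 0] says that the
    mass and [B_0] have the same logarithmic derivative in [r].  Their quotient is its value at [r = 0]. *)
Lemma vM_mass_bessel r : 0 < r -> vM_mass r = 2 * PI * besselI0 r.
Proof.
  intros Hr. rewrite besselI0_bes_re by exact Hr. pose proof PI_RGT_0 as HP.
  set (B := fun t => bes_re 0 0 ((t / 2) ^ 2)).
  assert (DB : forall t, is_derive B t (t / 2 * bes_re 0 1 ((t / 2) ^ 2))).
  { intros t. pose proof (bes_re_is_derive 0 0 ((t / 2) ^ 2)) as D. unfold B.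
    auto_derive.
    - replace (t * / 2 * (t * / 2 * 1)) with ((t / 2) ^ 2) by (unfold Rdiv; ring). eexists; exact D.
    - change (fun x => bes_re 0 0 x) with (bes_re 0 0).
      replace (t * / 2 * (t * / 2 * 1)) with ((t / 2) ^ 2) by (unfold Rdiv; ring).
      rewrite (is_derive_unique _ _ _ D). field. }
  set (Q := fun t => B t / vM_mass t).
  assert (DQ : forall t, is_derive Q t
     ((t / 2 * bes_re 0 1 ((t / 2) ^ 2) * vM_mass t - B t * cos_moment (fun x => exp (t * cos x)) 1) / vM_mass t ^ 2)).
  { intros t. pose proof (vM_mass_pos t). unfold Q.
    apply (is_derive_div B vM_mass t); [apply DB|apply vM_mass_derive|lra]. }
  destruct (MVT_gen Q 0 r (fun _ => 0)) as [z [_ E]].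
  - intros t Ht. rewrite Rmin_left, Rmax_right in Ht by lra.
    pose proof (vM_mass_pos t) as Hm. pose proof (DQ t) as D.
    match type of D with is_derive _ _ ?d => replace 0 with d; [exact D|] end.
    destruct (first_moment_law 0 t 0 _ (exp_cos_ode t) ltac:(lra)) as [L _].
    replace (cos_moment (fun x => exp (t * cos x)) 0) with (vM_mass t) in L.
    2:{ unfold cos_moment, vM_mass. apply RInt_ext. intros x _. simpl INR. rewrite Rmult_0_l, cos_0.
        symmetry. apply Rmult_1_r. }
    assert (W0 : quo_im 0 ((t / 2) ^ 2) = 0) by (unfold quo_im, twice_im, Rdiv; now rewrite !Rmult_0_l).
    rewrite W0 in L.
    destruct (bes_re_im_quotient 0 ((t / 2) ^ 2) ltac:(apply pow2_ge_0)) as [Q1 _]. rewrite W0 in Q1.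
    unfold B. rewrite Q1.
    set (m := cos_moment _ _) in *.
    replace (t / 2 * bes_re 0 1 ((t / 2) ^ 2) * vM_mass t - (quo_re 0 ((t / 2) ^ 2) * bes_re 0 1 ((t / 2) ^ 2) - 0 * bes_im 0 1 ((t / 2) ^ 2)) * m)
      with (bes_re 0 1 ((t / 2) ^ 2) * (t / 2 * vM_mass t - (m * quo_re 0 ((t / 2) ^ 2) - sin_moment (fun x => exp (t * cos x)) 1 * 0))) by ring.
    rewrite L. field. lra.
  - intros t _. apply continuity_pt_filterlim, continuous_derivable. eexists. apply DQ.
  - assert (Q0 : Q 0 = 1 / (2 * PI)).
    { unfold Q, B. replace ((0 / 2) ^ 2) with 0 by field. rewrite (proj1 (bes_0_at_0 0)). f_equal.
      unfold vM_mass. rewrite (RInt_ext _ (fun _ => 1)).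
      - rewrite RInt_const. unfold scal; simpl. unfold mult; simpl. ring.
      - intros. rewrite Rmult_0_l. apply exp_0. }
    rewrite Q0 in E. unfold Q in E. fold (B r). pose proof (vM_mass_pos r).
    assert (E' : B r / vM_mass r = 1 / (2 * PI)) by lra.
    apply Rmult_eq_reg_r with (/ (2 * PI)); [|apply Rinv_neq_0_compat; lra].
    transitivity (vM_mass r * (1 / (2 * PI))); [field; lra|]. rewrite <- E'. field. split; lra.
Qed.

Lemma besselI0_pos r : 0 < r -> 0 < besselI0 r.
Proof.
  intros Hr. pose proof (vM_mass_pos r). rewrite vM_mass_bessel in H by exact Hr.
  pose proof PI_RGT_0. apply Rmult_lt_reg_l with (2 * PI); lra.
Qed.

Section ChiFacts.
Context (k r : R) (Hr : 0 < r).

Lemma Z_pos : 0 < Z_EMvM k r.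
Proof.
  apply RInt_positive; [apply (circle_ode_continuous _ _ _ _ (chi_ode k r))|].
  apply chi_pos, besselI0_pos, Hr.
Qed.

Definition chi_density (x : R) : R := chi k r x / Z_EMvM k r.

Lemma chi_density_scal : chi_density = fun x => / Z_EMvM k r * chi k r x.
Proof. apply functional_extensionality. intros x. apply Rmult_comm. Qed.

Lemma chi_density_ode : circle_ode k r (/ Z_EMvM k r * k) chi_density.
Proof. rewrite chi_density_scal. apply (circle_ode_scale _ _ _ _ _ (chi_ode k r)). Qed.

Lemma chi_density_pos x : 0 < chi_density x.
Proof. apply Rdiv_lt_0_compat; [apply chi_pos, besselI0_pos, Hr|apply Z_pos]. Qed.

Lemma chi_density_mass : RInt chi_density 0 (2 * PI) = 1.
Proof.
  rewrite chi_density_scal, (RInt_scal (V := R_CompleteNormedModule) (chi k r)).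
  - unfold scal; simpl. unfold mult; simpl. fold (Z_EMvM k r). apply Rinv_l. pose proof Z_pos; lra.
  - apply ex_RInt_cont, (circle_ode_continuous _ _ _ _ (chi_ode k r)).
Qed.

Lemma circle_density_unique c f : circle_ode k r c f -> RInt f 0 (2 * PI) = 1 ->
  forall x, f x = chi_density x.
Proof.
  intros Hf Mass. destruct (chi_multiple k r c f) as [a Ha]; [pose proof (besselI0_pos r Hr); lra|exact Hf|].
  assert (E : a * Z_EMvM k r = 1).
  { rewrite <- Mass, (RInt_ext f (fun x => a * chi k r x)) by (intros; apply Ha).
    symmetry. apply (RInt_scal (V := R_CompleteNormedModule) (chi k r)).
    apply ex_RInt_cont, (circle_ode_continuous _ _ _ _ (chi_ode k r)). }
  intros x. rewrite Ha, chi_density_scal. f_equal. pose proof Z_pos.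
  apply Rmult_eq_reg_r with (Z_EMvM k r); [rewrite Rinv_l; lra|lra].
Qed.
End ChiFacts.

(** * From the convolution equation to the profile equation and back *)

Section Convolution.
Context (g : R -> R) (Cg : forall x, continuous g x).

Lemma is_RInt_first_moments a b :
  is_RInt (fun s => a * (g s * cos s) + b * (g s * sin s)) 0 (2 * PI) (a * cos_moment g 1 + b * sin_moment g 1).
Proof.
  apply is_RInt_lin2.
  - apply is_RInt_ext with (2 := is_cos_moment g 1 Cg). intros s _. now rewrite INR_1, Rmult_1_l.
  - apply is_RInt_ext with (2 := is_sin_moment g 1 Cg). intros s _. now rewrite INR_1, Rmult_1_l.
Qed.

Lemma conv_W alpha x :
  circle_conv (W alpha) g x = - (cos (x - alpha) * cos_moment g 1 + sin (x - alpha) * sin_moment g 1).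
Proof.
  unfold circle_conv, W.
  replace (- (cos (x - alpha) * cos_moment g 1 + sin (x - alpha) * sin_moment g 1))
    with (- cos (x - alpha) * cos_moment g 1 + - sin (x - alpha) * sin_moment g 1) by ring.
  apply is_RInt_unique. eapply is_RInt_ext; [|apply is_RInt_first_moments]. intros s _. cbv beta.
  replace (x - s - alpha) with (x - alpha - s) by ring. rewrite (cos_minus (x - alpha) s). as_R. ring.
Qed.

Lemma W_derive alpha x : Derive (W alpha) x = sin (x - alpha).
Proof. apply is_derive_unique. unfold W. auto_derive; [easy|]. unfold Rminus. ring. Qed.

(** The convolution depends on [g] only through its first Fourier coefficient. *)
Lemma conv_dW alpha x :
  circle_conv (Derive (W alpha)) g x = sin (x - alpha) * cos_moment g 1 - cos (x - alpha) * sin_moment g 1.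
Proof.
  unfold circle_conv.
  replace (sin (x - alpha) * cos_moment g 1 - cos (x - alpha) * sin_moment g 1)
    with (sin (x - alpha) * cos_moment g 1 + - cos (x - alpha) * sin_moment g 1) by ring.
  apply is_RInt_unique. eapply is_RInt_ext; [|apply is_RInt_first_moments]. intros s _. cbv beta.
  rewrite W_derive.
  replace (x - s - alpha) with (x - alpha - s) by ring. rewrite (sin_minus (x - alpha) s). as_R. ring.
Qed.

Lemma shift_moments a : periodic g ->
  cos_moment (fun x => g (x + a)) 1 = cos a * cos_moment g 1 + sin a * sin_moment g 1 /\
  sin_moment (fun x => g (x + a)) 1 = - sin a * cos_moment g 1 + cos a * sin_moment g 1.
Proof.
  intros Pg.
  assert (X : forall u v, RInt (fun x => u * (g (x + a) * cos (x + a)) + v * (g (x + a) * sin (x + a))) 0 (2 * PI)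
     = u * cos_moment g 1 + v * sin_moment g 1).
  { intros u v. set (h := fun s => u * (g s * cos s) + v * (g s * sin s)).
    transitivity (RInt h 0 (2 * PI)).
    - apply (RInt_shift h a).
      + intros x. unfold h. rewrite Pg, cos_plus, sin_plus, cos_2PI, sin_2PI. ring.
      + intros x. unfold h. apply (continuous_plus (fun s => u * (g s * cos s)) (fun s => v * (g s * sin s)));
          (apply continuous_mul; [apply continuous_const|]); (apply continuous_mul; [apply Cg|]);
          apply continuous_derivable; now auto_derive.
    - apply is_RInt_unique, is_RInt_first_moments. }
  split; rewrite <- X; unfold cos_moment, sin_moment; apply RInt_ext; intros x _; rewrite INR_1, Rmult_1_l;
    set (y := x + a); replace x with (y - a) by (unfold y; as_R; ring); rewrite ?cos_minus, ?sin_minus; as_R; ring.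
Qed.
End Convolution.

Lemma polar_turn x y : exists R t, 0 <= R /\ 0 <= t < 2 * PI /\ x = R * cos t /\ y = R * sin t.
Proof.
  pose proof PI_RGT_0 as HP.
  set (R := sqrt (x ^ 2 + y ^ 2)). assert (HR : 0 <= R) by apply sqrt_pos.
  assert (R2 : R * R = x ^ 2 + y ^ 2) by (apply sqrt_sqrt; nra).
  destruct (Req_dec R 0) as [E|NE].
  - exists 0, 0. rewrite E in R2. repeat split; nra.
  - assert (HR' : 0 < R) by lra.
    set (q := x / R).
    assert (Ex : x = R * q) by (unfold q; field; lra).
    assert (Hq : -1 <= q <= 1) by (split; apply Rmult_le_reg_l with R; nra).
    pose proof (acos_bound q) as AB.
    assert (SA : sin (acos q) = Rabs y / R).
    { rewrite sin_acos by exact Hq. unfold Rsqr.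
      replace (1 - q * q) with ((Rabs y / R) ^ 2).
      - apply sqrt_pow2. apply Rdiv_le_0_compat; [apply Rabs_pos|lra].
      - replace ((Rabs y / R) ^ 2) with (Rabs y ^ 2 / (R * R)) by (field; lra).
        rewrite pow2_abs. unfold q. replace (1 - x / R * (x / R)) with ((R * R - x ^ 2) / (R * R)) by (field; lra).
        rewrite R2. f_equal. ring. }
    destruct (Rle_or_lt 0 y) as [Hy|Hy].
    + exists R, (acos q). rewrite cos_acos, SA, Rabs_pos_eq by assumption.
      repeat split; try lra. field; lra.
    + exists R, (2 * PI - acos q).
      assert (acos q <> 0) by (intros E; rewrite E, sin_0, Rabs_left in SA by exact Hy;
        assert (0 < - y / R) by (apply Rdiv_lt_0_compat; lra); lra).
      replace (cos (2 * PI - acos q)) with (cos (acos q))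
        by (rewrite cos_minus, cos_2PI, sin_2PI; ring).
      replace (sin (2 * PI - acos q)) with (- sin (acos q))
        by (rewrite sin_minus, cos_2PI, sin_2PI; ring).
      rewrite cos_acos, SA, Rabs_left by assumption.
      repeat split; try lra. field; lra.
Qed.

(** The angle [t0] is the argument of [e^(i alpha)] times the first Fourier coefficient, which turns the
    mean field into [mu R sin (x - t0)]; [R] is the modulus of this coefficient. *)
Lemma profile_rotate mu alpha rho k c : profile_solution mu alpha rho k c ->
  exists R t0, 0 <= R /\ 0 <= t0 < 2 * PI /\
    circle_ode k (mu * R) c (fun x => rho (x + t0)) /\
    (forall x, 0 < rho (x + t0)) /\ RInt (fun x => rho (x + t0)) 0 (2 * PI) = 1 /\
    cos_moment (fun x => rho (x + t0)) 1 = R * cos alpha /\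
    sin_moment (fun x => rho (x + t0)) 1 = - (R * sin alpha).
Proof.
  intros [[Pos [Per Mass]] Eq].
  assert (Cr : forall x, continuous rho x) by (intros x; apply continuous_derivable, Eq).
  set (C1 := cos_moment rho 1). set (S1 := sin_moment rho 1).
  destruct (polar_turn (C1 * cos alpha - S1 * sin alpha) (S1 * cos alpha + C1 * sin alpha))
    as (R & t0 & HR & Ht & Ex & Ey).
  pose proof (sin2_cos2 alpha) as SCa. pose proof (sin2_cos2 t0) as SCt. unfold Rsqr in SCa, SCt.
  assert (EC : C1 = R * (cos t0 * cos alpha + sin t0 * sin alpha)).
  { replace (R * (cos t0 * cos alpha + sin t0 * sin alpha)) with (R * cos t0 * cos alpha + R * sin t0 * sin alpha) by ring.
    rewrite <- Ex, <- Ey. transitivity (C1 * (sin alpha * sin alpha + cos alpha * cos alpha)); [rewrite SCa|]; ring. }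
  assert (ES : S1 = R * (sin t0 * cos alpha - cos t0 * sin alpha)).
  { replace (R * (sin t0 * cos alpha - cos t0 * sin alpha)) with (R * sin t0 * cos alpha - R * cos t0 * sin alpha) by ring.
    rewrite <- Ex, <- Ey. transitivity (S1 * (sin alpha * sin alpha + cos alpha * cos alpha)); [rewrite SCa|]; ring. }
  exists R, t0. split; [exact HR|]. split; [exact Ht|].
  split; [split|split; [|split; [|split]]].
  - intros x. rewrite <- (Per (x + t0)). f_equal. ring.
  - intros x. destruct (Eq (x + t0)) as [D E]. apply Derive_correct in D.
    rewrite (conv_dW rho Cr) in E. fold C1 S1 in E.
    auto_derive; [eexists; exact D|]. change (fun x => rho x) with rho.
    assert (Q : sin (x + t0 - alpha) * C1 - cos (x + t0 - alpha) * S1 = R * sin x).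
    { rewrite EC, ES, <- cos_minus, <- sin_minus.
      transitivity (R * (sin (x + t0 - alpha) * cos (t0 - alpha) - cos (x + t0 - alpha) * sin (t0 - alpha))); [ring|].
      rewrite <- sin_minus. do 2 f_equal. ring. }
    rewrite Q in E. lra.
  - intros x. apply Pos.
  - rewrite (RInt_shift rho t0 Per Cr). exact Mass.
  - rewrite (proj1 (shift_moments rho Cr t0 Per)). fold C1 S1. rewrite EC, ES.
    transitivity (R * cos alpha * (sin t0 * sin t0 + cos t0 * cos t0)); [ring|rewrite SCt; ring].
  - rewrite (proj2 (shift_moments rho Cr t0 Per)). fold C1 S1. rewrite EC, ES.
    transitivity (- (R * sin alpha) * (sin t0 * sin t0 + cos t0 * cos t0)); [ring|rewrite SCt; ring].
Qed.

Lemma zero_moment_mass (f : R -> R) : cos_moment f 0 = RInt f 0 (2 * PI) :> R.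
Proof.
  unfold cos_moment. apply RInt_ext. intros x _. simpl INR. rewrite Rmult_0_l, cos_0. apply Rmult_1_r.
Qed.

(** [w = (mu / 2) e^(i alpha)], the condition that the field [r sin] be the one generated by the density. *)
Definition self_consistent (mu alpha k r : R) : Prop :=
  quo_re k ((r / 2) ^ 2) = mu / 2 * cos alpha /\ quo_im k ((r / 2) ^ 2) = mu / 2 * sin alpha.

Lemma self_consistency mu alpha R k c f : 0 < mu -> 0 < R ->
  circle_ode k (mu * R) c f -> RInt f 0 (2 * PI) = 1 ->
  cos_moment f 1 = R * cos alpha -> sin_moment f 1 = - (R * sin alpha) ->
  self_consistent mu alpha k (mu * R).
Proof.
  intros Hmu HR Hf Mass EC ES.
  destruct (first_moment_law k (mu * R) c f Hf) as [L1 L2]; [now apply Rmult_lt_0_compat|].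
  rewrite zero_moment_mass, Mass, EC, ES in *.
  unfold self_consistent. set (p := quo_re _ _) in *. set (q := quo_im _ _) in *.
  pose proof (sin2_cos2 alpha) as SC. unfold Rsqr in SC.
  assert (M1 : p * cos alpha + q * sin alpha = mu / 2).
  { apply Rmult_eq_reg_l with R; [|lra]. lra. }
  assert (M2 : q * cos alpha - p * sin alpha = 0).
  { apply Rmult_eq_reg_l with R; [|lra]. lra. }
  split; rewrite <- M1.
  - transitivity (p * (sin alpha * sin alpha + cos alpha * cos alpha)); [rewrite SC; ring|].
    transitivity ((p * cos alpha + q * sin alpha) * cos alpha - sin alpha * (q * cos alpha - p * sin alpha)); [ring|].
    rewrite M2. ring.
  - transitivity (q * (sin alpha * sin alpha + cos alpha * cos alpha)); [rewrite SC; ring|].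
    transitivity ((p * cos alpha + q * sin alpha) * sin alpha + cos alpha * (q * cos alpha - p * sin alpha)); [ring|].
    rewrite M2. ring.
Qed.

Section Wave.
Context (mu alpha k r c : R) (f : R -> R) (Hmu : 0 < mu) (Hr : 0 < r) (Hf : circle_ode k r c f)
  (Pos : forall x, 0 < f x) (Mass : RInt f 0 (2 * PI) = 1) (SC : self_consistent mu alpha k r).

(** The converse of [self_consistency]: the Fourier coefficient is read off from [a_1 w = r / 2]. *)
Lemma wave_first_moments : cos_moment f 1 = r / mu * cos alpha /\ sin_moment f 1 = - (r / mu * sin alpha).
Proof.
  destruct (first_moment_law k r c f Hf Hr) as [L1 L2]. destruct SC as [E1 E2].
  rewrite E1, E2, zero_moment_mass, Mass in *.
  set (C1 := cos_moment f 1) in *. set (S1 := sin_moment f 1) in *.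
  pose proof (sin2_cos2 alpha) as SCa. unfold Rsqr in SCa.
  assert (M1 : C1 * cos alpha - S1 * sin alpha = r / mu).
  { apply Rmult_eq_reg_l with (mu / 2); [|lra]. transitivity (r / 2); [lra|field; lra]. }
  assert (M2 : C1 * sin alpha + S1 * cos alpha = 0).
  { apply Rmult_eq_reg_l with (mu / 2); [|lra]. lra. }
  rewrite <- M1. split.
  - transitivity (C1 * (sin alpha * sin alpha + cos alpha * cos alpha)); [rewrite SCa; ring|].
    transitivity ((C1 * cos alpha - S1 * sin alpha) * cos alpha + sin alpha * (C1 * sin alpha + S1 * cos alpha)); [ring|].
    rewrite M2. ring.
  - transitivity (S1 * (sin alpha * sin alpha + cos alpha * cos alpha)); [rewrite SCa; ring|].
    transitivity (- ((C1 * cos alpha - S1 * sin alpha) * sin alpha) + cos alpha * (C1 * sin alpha + S1 * cos alpha)); [ring|].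
    rewrite M2. ring.
Qed.

Let Cf : forall x, continuous f x := circle_ode_continuous k r c f Hf.

Lemma wave_shift_continuous a x : continuous (fun x => f (x + a)) x.
Proof.
  apply continuous_derivable. pose proof (proj2 Hf (x + a)) as D. auto_derive. eexists; exact D.
Qed.

Lemma wave_conv_dW a x :
  circle_conv (Derive (W alpha)) (fun x => f (x + a)) x = r / mu * sin (x + a).
Proof.
  rewrite (conv_dW (fun x => f (x + a)) (wave_shift_continuous a)).
  destruct (shift_moments f Cf a (proj1 Hf)) as [-> ->]. destruct wave_first_moments as [-> ->].
  pose proof (sin2_cos2 alpha) as SCa. unfold Rsqr in SCa.
  rewrite sin_minus, cos_minus, sin_plus.
  transitivity (r / mu * (sin x * cos a + cos x * sin a) * (sin alpha * sin alpha + cos alpha * cos alpha)); [ring|].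
  rewrite SCa. ring.
Qed.

Lemma wave_conv_W a x :
  circle_conv (W alpha) (fun x => f (x + a)) x = - (r / mu * cos (x + a)).
Proof.
  rewrite (conv_W (fun x => f (x + a)) (wave_shift_continuous a)).
  destruct (shift_moments f Cf a (proj1 Hf)) as [-> ->]. destruct wave_first_moments as [-> ->].
  pose proof (sin2_cos2 alpha) as SCa. unfold Rsqr in SCa.
  rewrite sin_minus, cos_minus, cos_plus.
  transitivity (- (r / mu * (cos x * cos a - sin x * sin a) * (sin alpha * sin alpha + cos alpha * cos alpha))); [ring|].
  rewrite SCa. ring.
Qed.

Lemma wave_profile a : profile_solution mu alpha (fun x => f (x + a)) k c.
Proof.
  split; [split; [|split]|].
  - intros x. apply Pos.
  - intros x. cbv beta. rewrite <- (proj1 Hf (x + a)). f_equal. ring.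
  - rewrite (RInt_shift f a (proj1 Hf) Cf). exact Mass.
  - intros x. rewrite wave_conv_dW. pose proof (proj2 Hf (x + a)) as D.
    assert (Ds : is_derive (fun x => f (x + a)) x (c - (r * sin (x + a) + k) * f (x + a))).
    { auto_derive; [eexists; exact D|]. change (fun x => f x) with f. rewrite (is_derive_unique _ _ _ D). apply Rmult_1_l. }
    split; [eexists; exact Ds|].
    transitivity (c - (r * sin (x + a) + k) * f (x + a) + (mu * (r / mu * sin (x + a)) + k) * f (x + a)).
    + f_equal. exact (is_derive_unique _ _ _ Ds).
    + field. lra.
Qed.

(** A constant solution would make [r sin x] constant. *)
Lemma wave_coherent a : coherent (fun x => f (x + a)).
Proof.
  apply Classical_Prop.NNPP. intros N.
  assert (E : forall x, f x = 1 / (2 * PI)).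
  { intros x. apply Classical_Prop.NNPP. intros NE. apply N. exists (x - a).
    replace (x - a + a) with x by ring. exact NE. }
  assert (D : forall x, c - (r * sin x + k) * f x = 0).
  { intros x. rewrite <- (is_derive_unique _ _ _ (proj2 Hf x)).
    rewrite (Derive_ext _ (fun _ => 1 / (2 * PI))) by exact E. apply Derive_const. }
  pose proof (D 0) as D0. pose proof (D (PI / 2)) as D1.
  rewrite E, sin_0 in D0. rewrite E, sin_PI2 in D1. pose proof PI_RGT_0.
  assert (0 < r * (1 / (2 * PI))) by (apply Rmult_lt_0_compat; [exact Hr|apply Rdiv_lt_0_compat; lra]). lra.
Qed.

(** In the frame of the wave the potential is [- (r / mu) cos], and the equation is the derivative of the
    profile equation. *)
Lemma wave_McKean_Vlasov a : McKean_Vlasov mu alpha (fun t x => f (x - k * t + a)).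
Proof.
  intros t x drift.
  set (b := - (k * t) + a).
  set (u := fun x => f (x + b)).
  set (v := fun x => c - (r * sin (x + b) + k) * f (x + b)).
  assert (Eu : (fun x => f (x - k * t + a)) = u).
  { apply functional_extensionality. intros y. unfold u, b. f_equal. ring. }
  assert (Df := proj2 Hf).
  assert (Du : forall y, is_derive u y (v y)).
  { intros y. unfold u, v. specialize (Df (y + b)). auto_derive; [eexists; exact Df|].
    change (fun x => f x) with f. rewrite (is_derive_unique _ _ _ Df). apply Rmult_1_l. }
  assert (Dv : forall y, is_derive v y (- (r * cos (y + b) * u y + (r * sin (y + b) + k) * v y))).
  { intros y. pose proof (Df (y + b)) as D. unfold v at 1. auto_derive; [eexists; exact D|].
    change (fun x => f x) with f. rewrite (is_derive_unique _ _ _ D). unfold u, v. ring. }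
  assert (EDu : Derive u = v).
  { apply functional_extensionality. intros y. apply is_derive_unique, Du. }
  assert (Dt : is_derive (fun s => f (x - k * s + a)) t (- k * v x)).
  { pose proof (Df (x + b)) as D.
    assert (Ex : x - k * t + a = x + b) by (unfold b; ring).
    auto_derive; replace (x + - (k * t) + a) with (x + b) by (unfold b; ring).
    - eexists; exact D.
    - change (fun x => f x) with f. rewrite (is_derive_unique _ _ _ D). unfold v. ring. }
  assert (Ec : circle_conv (W alpha) u = fun y => - (r / mu * cos (y + b))).
  { apply functional_extensionality. intros y. apply (wave_conv_W b y). }
  assert (Dc : forall y, is_derive (circle_conv (W alpha) u) y (r / mu * sin (y + b))).
  { intros y. rewrite Ec. auto_derive; [easy|]. ring. }
  assert (Ed : drift = fun y => u y * (r / mu * sin (y + b))).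
  { unfold drift. rewrite Eu. apply functional_extensionality. intros y.
    rewrite (is_derive_unique _ _ _ (Dc y)). f_equal. apply (f_equal (fun h => h y) Eu). }
  assert (Dd : is_derive drift x (v x * (r / mu * sin (x + b)) + u x * (r / mu * cos (x + b)))).
  { rewrite Ed. specialize (Du x). auto_derive; [eexists; exact Du|].
    change (fun x => u x) with u. rewrite (is_derive_unique _ _ _ Du). ring. }
  rewrite Eu. repeat split.
  - eexists; exact Dt.
  - eexists; apply Du.
  - change (ex_derive (Derive u) x). rewrite EDu. eexists; apply Dv.
  - eexists; apply Dc.
  - eexists; exact Dd.
  - change (Derive_n u 2 x) with (Derive (Derive u) x). rewrite EDu.
    transitivity (- k * v x); [exact (is_derive_unique _ _ _ Dt)|].
    rewrite (is_derive_unique _ _ _ (Dv x)), (is_derive_unique _ _ _ Dd).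
    field. lra.
Qed.
End Wave.

(** * The phase transition *)

Lemma self_consistent_unique mu alpha k1 r1 k2 r2 : 0 < r1 -> 0 < r2 ->
  self_consistent mu alpha k1 r1 -> self_consistent mu alpha k2 r2 -> k1 = k2 /\ r1 = r2.
Proof.
  intros H1 H2 [A1 B1] [A2 B2]. unfold quo_re, quo_im in *.
  destruct (means_injective k1 k2 ((r1 / 2) ^ 2) ((r2 / 2) ^ 2)) as [Ek Es]; [nra|nra|lra|lra|].
  split; [exact Ek|nra].
Qed.

Lemma self_consistent_exists mu alpha : 2 < mu * cos alpha ->
  exists k r, 0 < r /\ self_consistent mu alpha k r.
Proof.
  intros H. destruct (means_surjective (mu * cos alpha - 1) (mu * sin alpha)) as (k & s & Hs & EG & Eh); [lra|].
  exists k, (2 * sqrt s). pose proof (sqrt_lt_R0 s Hs). split; [lra|].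
  unfold self_consistent, quo_re, quo_im. replace ((2 * sqrt s / 2) ^ 2) with s.
  - rewrite EG, Eh. lra.
  - replace (2 * sqrt s / 2) with (sqrt s) by field. symmetry. apply pow2_sqrt. lra.
Qed.

(** [Re w > 1] for [r > 0]. *)
Lemma self_consistent_supercritical mu alpha k r : 0 < r -> self_consistent mu alpha k r -> 2 < mu * cos alpha.
Proof.
  intros Hr [E _]. unfold quo_re in E. pose proof (mean2_gt_1 (k ^ 2) ((r / 2) ^ 2) ltac:(nra) ltac:(nra)). lra.
Qed.

Lemma incoherent_solution mu alpha : incoherent_is_solution mu alpha.
Proof.
  exists 0, 0. pose proof PI_RGT_0 as HP.
  assert (Ode : circle_ode 0 0 0 rho_inf).
  { split; [easy|]. intros x. unfold rho_inf. auto_derive; [easy|]. ring. }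
  pose proof (circle_ode_continuous _ _ _ _ Ode) as Cr.
  split; [split; [|split]|].
  - intros x. unfold rho_inf. apply Rdiv_lt_0_compat; lra.
  - easy.
  - unfold rho_inf. rewrite RInt_const. unfold scal; simpl. unfold mult; simpl. field. lra.
  - intros x. split; [eexists; apply Ode|].
    assert (C1 : cos_moment rho_inf 1 = 0 /\ sin_moment rho_inf 1 = 0).
    { pose proof (moment_rec 0 0 0 rho_inf Ode 0) as M.
      pose proof (f_equal fst M) as M1. pose proof (f_equal snd M) as M2.
      unfold Cplus, Cminus, Copp, Cmult, RtoC, fst, snd in M1, M2. simpl INR in M1, M2. lra. }
    rewrite (conv_dW rho_inf Cr), (proj1 C1), (proj2 C1).
    rewrite (is_derive_unique _ _ _ (proj2 Ode x)). ring.
Qed.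

(** If the first Fourier coefficient of [rho] vanishes, [sup_bound] holds with [r = 0] and [rho] is uniform. *)
Lemma profile_dichotomy mu alpha rho k c : 0 < mu -> profile_solution mu alpha rho k c ->
  (forall x, rho x = rho_inf x) \/
  exists r t0, 0 < r /\ 0 <= t0 < 2 * PI /\ self_consistent mu alpha k r /\
    (forall x, Rabs (rho x - rho_inf x) <= 2 * r) /\
    forall x, rho x = rho_EMvM t0 k r x.
Proof.
  intros Hmu Hp. destruct (profile_rotate _ _ _ _ _ Hp) as (R & t0 & HR & Ht & Hf & Pos & Mass & EC & ES).
  assert (Sup : forall x, Rabs (rho x - rho_inf x) <= 2 * (mu * R)).
  { intros x. replace (rho x) with ((fun y => rho (y + t0)) (x - t0)) by (cbv beta; f_equal; ring).
    apply (sup_bound k (mu * R) c (fun y => rho (y + t0)) Hf); auto. nra. }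
  destruct (Req_dec R 0) as [E|NE].
  - left. intros x. specialize (Sup x). rewrite E, !Rmult_0_r in Sup.
    pose proof (Rabs_pos (rho x - rho_inf x)) as P.
    assert (Z : Rabs (rho x - rho_inf x) = 0) by lra.
    destruct (Req_dec (rho x - rho_inf x) 0) as [Q|Q]; [lra|]. apply Rabs_no_R0 in Q. contradiction.
  - right. assert (HR' : 0 < R) by lra. assert (Hr : 0 < mu * R) by now apply Rmult_lt_0_compat.
    exists (mu * R), t0. repeat (split; [assumption|]). split; [|split; [exact Sup|]].
    + exact (self_consistency mu alpha R k c _ Hmu HR' Hf Mass EC ES).
    + intros x. transitivity ((fun y => rho (y + t0)) (x - t0)); [cbv beta; f_equal; ring|].
      exact (circle_density_unique k (mu * R) Hr c _ Hf Mass (x - t0)).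
Qed.

Lemma incoherent_unique_subcritical mu alpha : 0 < mu -> mu * cos alpha <= 2 -> incoherent_unique mu alpha.
Proof.
  intros Hmu Hsub. split; [apply incoherent_solution|]. intros rho k c Hp.
  destruct (profile_dichotomy mu alpha rho k c Hmu Hp) as [H|(r & t0 & Hr & _ & SC & _)]; [exact H|].
  pose proof (self_consistent_supercritical _ _ _ _ Hr SC). lra.
Qed.

Lemma EMvM_wave mu alpha k r t0 : 0 < mu -> 0 < r -> self_consistent mu alpha k r ->
  profile_solution mu alpha (rho_EMvM t0 k r) k (/ Z_EMvM k r * k) /\
  coherent (rho_EMvM t0 k r) /\
  McKean_Vlasov mu alpha (fun t x => rho_EMvM t0 k r (x - k * t)).
Proof.
  intros Hmu Hr SC.
  pose proof (chi_density_ode k r) as Hf. pose proof (chi_density_pos k r Hr) as Pos.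
  pose proof (chi_density_mass k r Hr) as Mass.
  split; [|split].
  - exact (wave_profile mu alpha k r _ _ Hmu Hr Hf Pos Mass SC (- t0)).
  - exact (wave_coherent k r _ _ Hr Hf (- t0)).
  - exact (wave_McKean_Vlasov mu alpha k r _ _ Hmu Hr Hf Mass SC (- t0)).
Qed.

Lemma coherent_classification mu alpha k r rho k' c' : 0 < mu -> 0 < r -> self_consistent mu alpha k r ->
  profile_solution mu alpha rho k' c' -> coherent rho ->
  k' = k /\ exists t0, 0 <= t0 < 2 * PI /\ forall x, rho x = rho_EMvM t0 k r x.
Proof.
  intros Hmu Hr SC Hp [x Hx].
  destruct (profile_dichotomy mu alpha rho k' c' Hmu Hp) as [H|(r' & t0 & Hr' & Ht & SC' & _ & E)].
  - exfalso. apply Hx, H.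
  - destruct (self_consistent_unique _ _ _ _ _ _ Hr Hr' SC SC') as [<- <-].
    split; [reflexivity|]. exists t0. split; assumption.
Qed.

Lemma L1_small f r : (forall x, continuous f x) -> (forall x, Rabs (f x - rho_inf x) <= 2 * r) ->
  RInt (fun x => Rabs (f x - rho_inf x)) 0 (2 * PI) <= 4 * PI * r.
Proof.
  intros Cf H. pose proof PI_RGT_0.
  apply Rle_trans with (RInt (fun _ => 2 * r) 0 (2 * PI)).
  - apply RInt_le; [lra| | |].
    + apply ex_RInt_cont. intros x. apply (continuous_comp (fun x => f x - rho_inf x) Rabs); [|apply continuous_Rabs].
      apply (continuous_minus f rho_inf); [apply Cf|apply continuous_const].
    + apply ex_RInt_const.
    + intros; apply H.
  - rewrite RInt_const. unfold scal; simpl. unfold mult; simpl. lra.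
Qed.

(** [|k| <= |k (1 + 1 / mean1)| = mu |sin alpha|]. *)
Lemma self_consistent_speed mu alpha k r : 0 < mu -> 0 < r -> self_consistent mu alpha k r -> k ^ 2 <= mu ^ 2.
Proof.
  intros Hmu Hr [_ E]. unfold quo_im, twice_im in E.
  set (s := (r / 2) ^ 2) in *. assert (Hs : 0 <= s) by apply pow2_ge_0.
  pose proof (mean1_pos (k ^ 2) s ltac:(nra) Hs) as Hk. pose proof (SIN_bound alpha).
  set (i := / mean1 (k ^ 2) s) in *. assert (Hi : 0 < i) by now apply Rinv_0_lt_compat.
  assert (E' : k * (1 + i) = mu * sin alpha) by lra.
  assert (k ^ 2 <= (k * (1 + i)) ^ 2).
  { rewrite Rpow_mult_distr. assert (1 <= (1 + i) ^ 2) by nra. pose proof (pow2_ge_0 k). nra. }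
  rewrite E', Rpow_mult_distr in *. assert ((sin alpha) ^ 2 <= 1) by nra. pose proof (pow2_ge_0 mu). nra.
Qed.

(** If [r] were at least [r0 = eps / (8 PI)], monotonicity of [mean2] in [s] and in [K] and the bound
    [k^2 <= (mu_crit + 1)^2] would give [mean2 >= 1 + eta] with [eta > 0] depending on [eps] only; but
    [mean2 = mu cos alpha - 1 < 1 + eta] for [mu] close to [mu_crit].  So [r < r0], and the [L^1] distance
    is at most [4 PI r < eps]. *)
Lemma continuous_transition alpha : 0 < cos alpha -> L1_continuous_at_transition (mu_crit alpha) alpha.
Proof.
  intros Hc eps Heps. pose proof PI_RGT_0 as HP.
  set (muc := mu_crit alpha). assert (Hmuc : 0 < muc) by (apply Rdiv_lt_0_compat; lra).
  assert (Emuc : muc * cos alpha = 2) by (unfold muc, mu_crit; field; lra).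
  set (r0 := eps / (8 * PI)). assert (Hr0 : 0 < r0) by (apply Rdiv_lt_0_compat; lra).
  set (s0 := (r0 / 2) ^ 2). assert (Hs0 : 0 < s0) by (unfold s0; nra).
  set (K := (muc + 1) ^ 2). assert (HK : 0 <= K) by apply pow2_ge_0.
  set (eta := mean2 K s0 - 1). assert (Heta : 0 < eta) by (pose proof (mean2_gt_1 K s0 HK Hs0); unfold eta; lra).
  exists (Rmin 1 (eta / cos alpha)). split.
  { apply Rmin_glb_lt; [lra|]. now apply Rdiv_lt_0_compat. }
  intros mu [Hmu1 Hmu2] rho k c Hp. assert (Hmu : 0 < mu) by lra.
  pose proof (Rmin_l 1 (eta / cos alpha)). pose proof (Rmin_r 1 (eta / cos alpha)).
  assert (Hlt : mu * cos alpha < 2 + eta).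
  { apply Rlt_le_trans with ((muc + eta / cos alpha) * cos alpha).
    - apply Rmult_lt_compat_r; lra.
    - rewrite Rmult_plus_distr_r, Emuc. right. field. lra. }
  assert (Cr : forall x, continuous rho x) by (intros x; apply continuous_derivable, Hp).
  destruct (profile_dichotomy mu alpha rho k c Hmu Hp) as [H1|(r & t0 & Hr & _ & SC & Sup & _)].
  - eapply Rle_lt_trans; [apply (L1_small rho 0 Cr)|lra].
    intros x. rewrite H1, Rminus_diag, Rabs_R0. lra.
  - eapply Rle_lt_trans; [apply (L1_small rho r Cr Sup)|].
    assert (r < r0).
    { apply Rnot_le_lt. intros Hle.
      pose proof (self_consistent_speed _ _ _ _ Hmu Hr SC) as Hk.
      destruct SC as [E _]. unfold quo_re in E.
      assert (mu ^ 2 <= K) by (apply pow_incr; lra).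
      assert (Hs : s0 <= (r / 2) ^ 2) by (apply pow_incr; lra).
      assert (mean2 K s0 <= mean2 (k ^ 2) ((r / 2) ^ 2)).
      { apply mean2_mono; [exact HK|apply pow2_ge_0|lra|lra|].
        intros m Hm. pose proof (pow2_ge_0 k). apply Rmult_le_compat; lra. }
      unfold eta in Hlt. lra. }
    apply Rlt_le_trans with (4 * PI * r0); [apply Rmult_lt_compat_l; lra|].
    replace (4 * PI * r0) with (eps / 2) by (unfold r0; field; lra). lra.
Qed.

Lemma rho_vM_EMvM t0 r x : 0 < r -> rho_vM t0 r x = rho_EMvM t0 0 r x.
Proof.
  intros Hr. pose proof (besselI0_pos r Hr) as HI. pose proof PI_RGT_0.
  assert (Ez : Z_EMvM 0 r = besselI0 r * (2 * PI * besselI0 r)).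
  { rewrite <- vM_mass_bessel by exact Hr. unfold Z_EMvM, vM_mass.
    rewrite (RInt_ext _ (fun y => besselI0 r * exp (r * cos y))).
    - apply (RInt_scal (V := R_CompleteNormedModule) (fun y => exp (r * cos y))).
      apply ex_RInt_cont, (circle_ode_continuous _ _ _ _ (exp_cos_ode r)).
    - intros y _. unfold chi. destruct (Req_EM_T 0 0); [reflexivity|contradiction]. }
  unfold rho_vM, rho_EMvM. rewrite Ez. unfold chi. destruct (Req_EM_T 0 0); [|contradiction].
  field. split; lra.
Qed.

Lemma self_consistent_symmetric mu k r : self_consistent mu 0 k r -> k = 0.
Proof.
  intros [_ E]. unfold quo_im in E. rewrite sin_0 in E.
  pose proof (twice_im_sign k ((r / 2) ^ 2) (pow2_ge_0 _)) as [H1 H2].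
  destruct (Rtotal_order k 0) as [L|[Z|G]]; [specialize (H2 L)|exact Z|specialize (H1 G)]; lra.
Qed.

Theorem theorem5p3 :
  (* (a) *)
  (forall alpha : R, - (PI / 2) < alpha < PI / 2 ->
    (forall mu : R, 0 < mu -> mu <= mu_crit alpha ->
       incoherent_unique mu alpha) /\
    (forall mu : R, mu_crit alpha < mu ->
       incoherent_is_solution mu alpha /\
       (exists k r : R, 0 < r /\ bessel_equation mu alpha k r) /\
       (forall k r : R, 0 < r -> bessel_equation mu alpha k r ->
          (forall theta0 : R, 0 <= theta0 < 2 * PI ->
             (exists c : R, profile_solution mu alpha (rho_EMvM theta0 k r) k c) /\
             coherent (rho_EMvM theta0 k r) /\
             McKean_Vlasov mu alpha
               (fun t theta => rho_EMvM theta0 k r (theta - k * t))) /\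
          (forall (rho : R -> R) (k' c' : R),
             profile_solution mu alpha rho k' c' -> coherent rho ->
             k' = k /\
             exists theta0 : R, 0 <= theta0 < 2 * PI /\
               forall theta : R, rho theta = rho_EMvM theta0 k r theta))) /\
    L1_continuous_at_transition (mu_crit alpha) alpha)
  /\
  (* (b) *)
  ((forall mu : R, 0 < mu -> mu <= 2 -> incoherent_unique mu 0) /\
   (forall mu : R, 2 < mu ->
      incoherent_is_solution mu 0 /\
      exists r : R, 0 < r /\
        (forall theta0 : R, 0 <= theta0 < 2 * PI ->
           profile_solution mu 0 (rho_vM theta0 r) 0 0 /\
           coherent (rho_vM theta0 r)) /\
        (forall (rho : R -> R) (k' c' : R),
           profile_solution mu 0 rho k' c' -> coherent rho ->
           k' = 0 /\
           exists theta0 : R, 0 <= theta0 < 2 * PI /\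
             forall theta : R, rho theta = rho_vM theta0 r theta)))
  /\
  (* (c) *)
  (forall alpha mu : R, alpha = PI / 2 \/ alpha = - (PI / 2) -> 0 < mu ->
     incoherent_unique mu alpha).
Proof.
  assert (Hcos : forall alpha mu, 0 < cos alpha -> mu_crit alpha < mu -> 2 < mu * cos alpha).
  { intros alpha mu Hc Hmu. replace 2 with (mu_crit alpha * cos alpha) by (unfold mu_crit; field; lra).
    now apply Rmult_lt_compat_r. }
  assert (Hcrit : forall alpha, 0 < cos alpha -> 0 < mu_crit alpha).
  { intros alpha Hc. apply Rdiv_lt_0_compat; lra. }
  split; [|split].
  - intros alpha Ha. assert (Hc : 0 < cos alpha) by (apply cos_gt_0; lra).
    split; [|split; [|now apply continuous_transition]].
    + intros mu Hmu Hle. apply incoherent_unique_subcritical; [exact Hmu|].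
      replace 2 with (mu_crit alpha * cos alpha) by (unfold mu_crit; field; lra).
      apply Rmult_le_compat_r; lra.
    + intros mu Hgt. assert (Hmu : 0 < mu) by (pose proof (Hcrit alpha Hc); lra).
      split; [apply incoherent_solution|]. split.
      * destruct (self_consistent_exists mu alpha (Hcos alpha mu Hc Hgt)) as (k & r & Hr & SC).
        exists k, r. split; [exact Hr|]. now apply bessel_equation_iff.
      * intros k r Hr BE. apply (bessel_equation_iff mu alpha k r Hr) in BE.
        split.
        -- intros t0 _. destruct (EMvM_wave mu alpha k r t0 Hmu Hr BE) as (P1 & P2 & P3).
           split; [eexists; exact P1|]. split; assumption.
        -- intros rho k' c'. now apply coherent_classification.
  - split.
    + intros mu Hmu Hle. apply incoherent_unique_subcritical; [exact Hmu|]. rewrite cos_0. lra.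
    + intros mu Hgt. assert (Hmu : 0 < mu) by lra.
      split; [apply incoherent_solution|].
      destruct (self_consistent_exists mu 0) as (k & r & Hr & SC); [rewrite cos_0; lra|].
      pose proof (self_consistent_symmetric _ _ _ SC) as Ek. subst k.
      assert (EvM : forall t0, rho_vM t0 r = rho_EMvM t0 0 r).
      { intros t0. apply functional_extensionality. intros x. now apply rho_vM_EMvM. }
      exists r. split; [exact Hr|]. split.
      * intros t0 _. rewrite EvM. destruct (EMvM_wave mu 0 0 r t0 Hmu Hr SC) as (P1 & P2 & _).
        rewrite Rmult_0_r in P1. split; assumption.
      * intros rho k' c' Hp Hco.
        destruct (coherent_classification mu 0 0 r rho k' c' Hmu Hr SC Hp Hco) as (Ek & t0 & Ht & E).
        split; [exact Ek|]. exists t0. split; [exact Ht|]. intros x. now rewrite EvM.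
  - intros alpha mu Ha Hmu. apply incoherent_unique_subcritical; [exact Hmu|].
    replace (cos alpha) with 0; [lra|]. destruct Ha as [-> | ->]; [|rewrite cos_neg]; now rewrite cos_PI2.
Qed.
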